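(* Let $S(x)=\sum_{n=1}^\infty a_nX_n\phi_n(\lambda_n x)$ be the random complex series described in the context, with associated exponents $\sigma$ and $\tau$, and let $G_S(A)=\{(x,S(x)):x\in A\}\subset\mathbb{R}^3$ be its graph over $A$. If $0<\sigma\le\tau\le1$, then for any Borel set $A\subset\mathbb{R}$, almost surely, $$\min\Bigl\{\frac{\dim_{\mathcal H}A}{\tau},\ \dim_{\mathcal H}A+2-2\tau\Bigr\}\le\dim_{\mathcal H}G_S(A)\le\min\Bigl\{\frac{\dim_{\mathcal H}A}{\sigma},\ \dim_{\mathcal H}A+2-2\sigma\Bigr\}.$$ Moreover, if (instead) $\tau=0$ and $A\subset\mathbb{R}$ is a Borel set with $\dim_{\mathcal H}A>0$, then $\dim_{\mathcal H}G_S(A)=2+\dim_{\mathcal H}A$ almost surely.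
   Context: Functions $\phi_n:\mathbb{R}\to\mathbb{C}$ ($n\ge1$) are given that are uniformly bounded and locally uniformly bi-Lipschitz: $\sup_n\|\phi_n\|_\infty<\infty$ and there are constants $L\ge1$, $\delta>0$ with $L^{-1}|x-y|\le|\phi_n(x)-\phi_n(y)|\le L|x-y|$ for all $n$ and all $x,y$ with $|x-y|\le\delta$. The coefficients satisfy $a_n\in\mathbb{C}\setminus\{0\}$ and $\sum_n|a_n|<\infty$. The sequence $(\lambda_n)_{n\ge1}$ of real numbers is increasing with $\lambda_1=1$ and $q:=\sup_n\lambda_{n+1}/\lambda_n<\infty$, $q>1$. For $k\ge0$ put $$s_k=\Bigl(\sum_{n:\,q^k\le\lambda_n<q^{k+1}}|a_n|^2\Bigr)^{1/2},\qquad \sigma=\liminf_{k\to\infty}\frac{-\log s_k}{k\log q},\qquad \tau=\limsup_{k\to\infty}\frac{-\log s_k}{k\log q}$$ (with $-\log 0=+\infty$). The $\theta_n$ are independent random variables uniformly distributed on $[0,1]$, and $X_n=e^{2\pi i\theta_n}$. $\dim_{\mathcal H}$ is Hausdorff dimension; $\mathbb{C}$ is identified with $\mathbb{R}^2$. ''Almost surely'' is with respect to $(\theta_n)$, and the exceptional null event may depend on $A$. *)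

(* Defs.v *)
From HB Require Import structures.
From mathcomp Require Import all_boot all_order all_algebra.
From mathcomp Require Import all_classical all_reals all_analysis.
From mathcomp Require Export complex.

Set Implicit Arguments.
Unset Strict Implicit.
Unset Printing Implicit Defensive.

Import Order.TTheory GRing.Theory Num.Theory.
Import numFieldNormedType.Exports.

Local Open Scope classical_set_scope.
Local Open Scope ring_scope.

Section hausdorff_dimension.
Context {R : realType} {T : Type} (dist : T -> T -> R).
Implicit Types (s delta : R) (A U : set T).
Local Open Scope ereal_scope.

Definition diam U : \bar R :=
  ereal_sup [set (dist x y)%:E | x in U & y in U].

(* The case split makes an empty set cost 0 also when s = 0, where
   [poweR x 0 = 1]; a nonempty set then costs 1. *)
Definition diam_pow s U : \bar R :=
  if U == set0 then 0 else diam U `^ s.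

(* Finite covers are the sequences that are eventually empty. *)
Definition hausdorff_premeasure s delta A : \bar R :=
  ereal_inf [set \sum_(0 <= i <oo) diam_pow s (U i) |
    U in [set U : nat -> set T |
      A `<=` \bigcup_i U i /\ forall i, diam (U i) <= delta%:E]].

Definition hausdorff_measure s A : \bar R :=
  ereal_sup [set hausdorff_premeasure s delta A |
    delta in [set delta | (0 < delta)%R]].

Definition hausdorff_dim A : \bar R :=
  ereal_inf [set s%:E |
    s in [set s | (0 <= s)%R /\ hausdorff_measure s A = 0]].

End hausdorff_dimension.

Definition rdist {R : realType} (x y : R) : R := `|x - y|.

(* The library norm on ['rV[R]_n] is the maximum norm, hence an explicit
   Euclidean distance. *)
Definition eucl_dist {R : realType} {n : nat} (u v : 'rV[R]_n) : R :=
  Num.sqrt (\sum_(i < n) (u 0 i - v 0 i) ^+ 2).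

Definition mutually_independent d (T : measurableType d) (R : realType)
    (P : probability T R) (X : nat -> {RV P >-> R}) : Prop :=
  forall (I : seq nat) (B : nat -> set R), uniq I ->
    (forall i, measurable (B i)) ->
    P (\big[setI/setT]_(i <- I) (X i @^-1` B i)) =
    (\prod_(i <- I) P (X i @^-1` B i))%E.

Definition uniform01 d (T : measurableType d) (R : realType)
    (P : probability T R) (X : {RV P >-> R}) : Prop :=
  forall B : set R, measurable B ->
    distribution P X B = uniform_prob (@ltr01 R) B.

Section random_series.
Context {R : realType}.
Local Notation C := R[i].

(* [`|z|] is itself an element of R[i]; this is its value in R. *)
Definition modulus (z : C) : R := ComplexField.Normc.normc z.

Definition expi (t : R) : C := (cos t +i* sin t)%C.

(* Sequences are indexed from 0: index n stands for n + 1 in the usual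
   numbering. *)
Implicit Types (a : nat -> C) (phi : nat -> R -> C) (lam : nat -> R).

Definition uniformly_bounded phi : Prop :=
  exists M : R, forall n x, modulus (phi n x) <= M.

Definition locally_uniformly_bilipschitz phi : Prop :=
  exists L delta : R, [/\ 1 <= L, 0 < delta &
    forall n x y, `|x - y| <= delta ->
      L^-1 * `|x - y| <= modulus (phi n x - phi n y) <= L * `|x - y|].

Definition block_norm a lam (q : R) (k : nat) : \bar R :=
  ((\esum_(n in [set n | (q ^+ k <= lam n < q ^+ k.+1)%R])
     ((modulus (a n)) ^+ 2)%:E) `^ (2^-1))%E.

(* [lne 0 = -oo]; the value at k = 0 is a division by 0, irrelevant for the
   limits. *)
Definition block_exponent a lam (q : R) (k : nat) : \bar R :=
  (- lne (block_norm a lam q k) / (k%:R * ln q)%:E)%E.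

Definition sigma_exp a lam (q : R) : \bar R :=
  limn_einf (block_exponent a lam q).

Definition tau_exp a lam (q : R) : \bar R :=
  limn_esup (block_exponent a lam q).

(* [theta n] is one outcome of the n-th random angle. *)
Definition rseries a phi lam (theta : nat -> R) (x : R) : C :=
  limn (series (fun n =>
    a n * expi (2 * pi * theta n) * phi n (lam n * x)) : nat -> C^o).

Definition point3 (x : R) (z : C) : 'rV[R]_3 :=
  \row_j [:: x; complex.Re z; complex.Im z]`_j.

Definition graph (f : R -> C) (A : set R) : set 'rV[R]_3 :=
  [set point3 x (f x) | x in A].

End random_series.

(* Main.v *)
Require Import Defs.
From HB Require Import structures.
From mathcomp Require Import all_boot all_order all_algebra.
From mathcomp Require Import all_classical all_reals all_analysis.
From mathcomp Require Import ring lra.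
From mathcomp Require Import measurable_realfun.

Import Order.TTheory GRing.Theory Num.Theory.
Import numFieldNormedType.Exports.

Local Open Scope classical_set_scope.
Local Open Scope ring_scope.

Set Implicit Arguments.
Unset Strict Implicit.
Unset Printing Implicit Defensive.

(* Write Z = S(x) - S(y) and h = |x - y|.
   Upper bound: for g < sigma the sum Z is subgaussian with variance O(h^(2g)),
   so dyadic chaining makes S locally g-Holder almost surely; the pieces of the
   graph over the intervals of a cover of A, or these pieces cut into
   l^(2g-2) cubes of side l, then cover the graph.
   Lower bound: for t > tau the blocks of frequencies slightly below 1/h carry
   a mass at least h^(2t), and the decay of the characteristic function of Z, a
   product of values of the Bessel function J_0, gives
   P(|Z| <= r) <= C (r / h^t)^2.  Integrating this over a Frostman measure mu of
   A bounds E mu{y : |x - y| <= r, |S(x) - S(y)| <= r} by C r^t', and the mass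
   distribution principle applies to the image of mu on the graph.  Frostman
   measures of Borel sets are built from the dyadic content, for which Souslin
   sets are capacitable. *)

(** * Hausdorff measure and dimension *)

(** In both bounds the minimum comes from two uses of one estimate. For the upper bound these are
    the two coverings. For the lower bound, min(1, C (r / h^t)^2) is interpolated as a power t'/2
    when the target dimension is below 2, and the square is used as it stands otherwise.

    J_0(u) decays only like u^(-1/2), while the characteristic function of Z has to be integrable
    over the plane. One block of frequencies is not enough for that, so sixteen consecutive blocks
    are used. Since J_0(u)^8 <= 1 / (1 + k u^2), the eighth power of the product is at most (1 +
    x)^(-16), and the product itself at most (1 + x)^(-2).

    Probabilistic estimates are proved for finite sums only. The remainders of the series are small
    uniformly in x and in the angles, because the a_n are summable and the phi_n uniformly bounded;
    so the number of terms can be chosen after the radius or the threshold at hand.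

    Almost sure statements are obtained for one exponent at a time and then combined along sequences
    of exponents, so that the exceptional events remain null. *)

Section hausdorff.
Context {R : realType} {T : Type} (dist : T -> T -> R).
Hypothesis dist_ge0 : forall x y, 0 <= dist x y.
Implicit Types (s : R) (A U : set T).
Local Notation diam := (diam dist).
Local Notation diam_pow := (diam_pow dist).
Local Notation hmeas := (hausdorff_measure dist).
Local Notation hdim := (hausdorff_dim dist).

Lemma diam_leP U r : (diam U <= r%:E)%E <-> (forall x y, U x -> U y -> dist x y <= r).
Proof.
split=> [h x y Ux Uy|h].
  rewrite -lee_fin; apply: le_trans h.
  by apply: ereal_sup_ubound; exists x => //; exists y.
by apply: ge_ereal_sup => _ [x Ux [y Uy <-]]; rewrite lee_fin h.
Qed.

Lemma diam_ge0 U : U !=set0 -> (0 <= diam U)%E.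
Proof.
move=> [x Ux]; apply: (@le_trans _ _ (dist x x)%:E); first by rewrite lee_fin.
by apply: ereal_sup_ubound; exists x => //; exists x.
Qed.

Lemma diam_pow_ge0 s U : (0 <= diam_pow s U)%E.
Proof. by rewrite /Defs.diam_pow; case: ifP => // _; exact: poweR_ge0. Qed.

Lemma diam_pow_le s U r : 0 <= s -> (diam U <= r%:E)%E ->
  (diam_pow s U <= (r `^ s)%:E)%E.
Proof.
move=> s0 h; rewrite /Defs.diam_pow; case: ifPn => [_|/set0P U0].
  by rewrite lee_fin powR_ge0.
have := diam_ge0 U0; case: (diam U) h => [d| |] //.
rewrite !lee_fin => dr d0; rewrite ge0_ler_powR ?nnegrE//.
exact: le_trans dr.
Qed.

Lemma hmeas_ge0 s A : (0 <= hmeas s A)%E.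
Proof.
apply: le_ereal_sup_tmp; exists (hausdorff_premeasure dist s 1 A); first by exists 1 => //=.
by apply: le_ereal_inf_tmp => _ [U _ <-]; apply: nneseries_ge0 => *; exact: diam_pow_ge0.
Qed.

Lemma hmeas_eq0P s A : hmeas s A = 0%E <->
  (forall delta eps : R, 0 < delta -> 0 < eps -> exists U : nat -> set T,
    [/\ A `<=` \bigcup_i U i, forall i, (diam (U i) <= delta%:E)%E &
     (\sum_(0 <= i <oo) diam_pow s (U i) <= eps%:E)%E]).
Proof.
split=> [h delta eps d0 e0|h].
  have : (hausdorff_premeasure dist s delta A < eps%:E)%E.
    apply: (@le_lt_trans _ _ 0%E); last by rewrite lte_fin.
    by rewrite -h; apply: ereal_sup_ubound; exists delta.
  move=> /ereal_inf_lt [_ [U [AU dU] <-]] lt; exists U; split=> //.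
  exact: ltW.
apply/eqP; rewrite eq_le hmeas_ge0 andbT; apply: ge_ereal_sup => _ [delta /= d0 <-].
apply/lee_addgt0Pr => eps e0; rewrite add0e.
have [U [AU dU le]] := h _ _ d0 e0.
by apply: le_trans le; apply: ereal_inf_lbound; exists U.
Qed.

Lemma hmeas_eq0_count s A : 0 <= s ->
  (forall delta eps : R, 0 < delta -> 0 < eps ->
    exists (I : countType) (U : I -> set T) (r : I -> R),
    [/\ A `<=` \bigcup_i U i, forall i x y, U i x -> U i y -> dist x y <= r i,
        forall i, r i <= delta &
     (\esum_(i in [set: I]) (r i `^ s)%:E <= eps%:E)%E]) ->
  hmeas s A = 0%E.
Proof.
move=> s0 h; apply/hmeas_eq0P => delta eps d0 e0.
have [I [U [r [AU Ur rd le]]]] := h _ _ d0 e0.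
pose V n := if pickle_inv n is Some i then U i else set0.
have Vp i : V (pickle i) = U i by rewrite /V pickleK_inv.
exists V; split.
- by move=> x /AU [i _ Ux]; exists (pickle i) => //; rewrite Vp.
- move=> n; rewrite /V; case: pickle_inv => [i|].
    by apply: (@le_trans _ _ (r i)%:E); [apply/diam_leP/Ur|rewrite lee_fin].
  by apply/diam_leP.
- apply: le_trans le; rewrite nneseries_esumT; last by move=> *; exact: diam_pow_ge0.
  rewrite (esumID (range (@pickle I))); last by move=> *; exact: diam_pow_ge0.
  rewrite [X in (_ + X)%E]esum1; last first.
    move=> n [_ nr]; rewrite /V; case E: pickle_inv => [i|]; last by rewrite /Defs.diam_pow eqxx.
    by case: nr; exists i => //; have := @pickle_invK I n; rewrite E.
  rewrite adde0 setTI esum_image; last by move=> ? ? _ _; exact: (pcan_inj pickleK).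
  by apply: le_esum => i _; rewrite Vp; apply: diam_pow_le => //; apply/diam_leP/Ur.
Qed.

(** A converse with strictly positive radii. A covering set may be a single point, and the arguments
    on graphs divide by the radius, so each cost is raised a little before the root is taken. *)
Lemma hmeas_eq0_radii s A : 0 < s -> hmeas s A = 0%E ->
  forall delta eps : R, 0 < delta -> 0 < eps ->
    exists (U : nat -> set T) (r : nat -> R),
    [/\ A `<=` \bigcup_i U i, forall i x y, U i x -> U i y -> dist x y <= r i,
        forall i, 0 < r i <= delta &
     (\sum_(0 <= i <oo) (r i `^ s)%:E <= eps%:E)%E].
Proof.
move=> s0 /hmeas_eq0P h delta eps d0 e0.
have d20 : 0 < delta / 2 by rewrite divr_gt0.
have e20 : 0 < eps / 2 by rewrite divr_gt0.
have [U [AU Ud le]] := h _ _ d20 e20.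
pose D i := fine (diam_pow s (U i)).
have D0 i : 0 <= D i by rewrite /D fine_ge0// diam_pow_ge0.
have DU i : diam_pow s (U i) = (D i)%:E.
  rewrite fineK// ge0_fin_numE ?diam_pow_ge0//.
  by apply: le_lt_trans (diam_pow_le (ltW s0) (Ud i)) _; rewrite ltry.
have Dd i : D i <= (delta / 2) `^ s.
  by rewrite -lee_fin -DU; apply: diam_pow_le => //; exact: ltW.
have gap : 0 < delta `^ s - (delta / 2) `^ s.
  by rewrite subr_gt0; apply: gt0_ltr_powR; rewrite ?nnegrE ?ltW// ltr_pdivrMr// ltr_pMr// ltr1n.
(* The first term keeps the total increase below [eps / 2]; the second keeps the new radius below
   [delta], which is why the cover was taken of mesh [delta / 2]. *)
pose eta i := Num.min (eps / 2 / (2 ^ i.+1)%:R) (delta `^ s - (delta / 2) `^ s).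
have eta0 i : 0 < eta i by rewrite lt_min gap andbT divr_gt0// ltr0n expn_gt0.
pose r i := (D i + eta i) `^ s^-1.
have sN0 : s != 0 by rewrite gt_eqF.
have rs i : r i `^ s = D i + eta i.
  by rewrite /r -powRrM mulVf// powRr1// addr_ge0// ltW.
have r0 i : 0 < r i by rewrite powR_gt0// ltr_wpDl.
exists U, r; split=> //.
- move=> i x y Ux Uy.
  have Un : U i !=set0 by exists x.
  have e : diam_pow s (U i) = (diam (U i) `^ s)%E by rewrite /Defs.diam_pow ifF//; apply/negbTE/set0P.
  have := diam_ge0 Un; move: e; have := Ud i; case Ed : (diam (U i)) => [d| |]//= _ e.
  rewrite lee_fin => dge0; apply: (@le_trans _ _ d).
    by move: x y Ux Uy {e dge0}; apply/diam_leP; rewrite Ed.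
  have -> : d = (d `^ s) `^ s^-1 by rewrite -powRrM mulfV// powRr1.
  rewrite /r ge0_ler_powR ?nnegrE ?invr_ge0 ?powR_ge0 ?addr_ge0// ?ltW//.
  by move: e; rewrite DU => -[->]; rewrite ltrDl.
- move=> i; rewrite r0/=.
  have -> : delta = (delta `^ s) `^ s^-1 by rewrite -powRrM mulfV// powRr1// ltW.
  rewrite /r ge0_ler_powR ?nnegrE ?invr_ge0 ?powR_ge0 ?addr_ge0 ?(ltW s0) ?(ltW (eta0 _))//.
  have : eta i <= delta `^ s - (delta / 2) `^ s by rewrite ge_min lexx orbT.
  by have := Dd i; lra.
- under eq_eseriesr do rewrite rs EFinD -DU.
  rewrite nneseriesD; [|by move=> *; exact: diam_pow_ge0|by move=> *; rewrite lee_fin ltW].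
  rewrite [eps in leRHS]splitr EFinD leeD//.
  apply: (@le_trans _ _ (\sum_(0 <= i <oo) (eps / 2 / (2 ^ i.+1)%:R)%:E)%E).
    apply: lee_nneseries => [n _ _|n _]; first by rewrite lee_fin ltW.
    by rewrite lee_fin /eta ge_min lexx.
  by apply: (epsilon_trick0 xpredT); rewrite ltW.
Qed.

Lemma hmeas_eq0_mono s t A : 0 <= s -> s <= t -> hmeas s A = 0%E -> hmeas t A = 0%E.
Proof.
move=> s0 st /hmeas_eq0P h; apply/hmeas_eq0P => delta eps d0 e0.
(* Diameters at most 1 make the cost decrease as the exponent grows. *)
have m0 : 0 < Num.min delta 1 by rewrite lt_min d0 ltr01.
have [U [AU Ud le]] := h _ _ m0 e0.
exists U; split=> //.
  by move=> i; apply: (le_trans (Ud i)); rewrite lee_fin ge_min lexx.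
apply: le_trans le; apply: lee_nneseries => [*|i _]; first exact: diam_pow_ge0.
rewrite /Defs.diam_pow; case: ifPn => // /set0P Un.
have := Ud i; have := diam_ge0 Un; case: diam => [d| |]//.
rewrite !lee_fin => d0' dle /=.
have d1 : d <= 1 by apply: (le_trans dle); rewrite ge_min lexx orbT.
have [->|dN0] := eqVneq d 0.
  have [->|sN0] := eqVneq s 0; first by rewrite powRr0; have [->|tN0] := eqVneq t 0; rewrite ?powRr0// powR0.
  by rewrite !powR0//; apply: contra_neq sN0 => t0; apply/eqP; rewrite eq_le s0 -t0 st.
by rewrite ger_powR// d1 andbT lt_neqAle eq_sym dN0.
Qed.

Lemma hmeas_eq0_sub s A B : A `<=` B -> hmeas s B = 0%E -> hmeas s A = 0%E.
Proof.
move=> AB /hmeas_eq0P h; apply/hmeas_eq0P => delta eps d0 e0.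
have [U [BU Ud le]] := h _ _ d0 e0; exists U; split=> //.
exact: subset_trans BU.
Qed.

Lemma hmeas_eq0_bigcup s (A : nat -> set T) : 0 < s ->
  (forall n, hmeas s (A n) = 0%E) -> hmeas s (\bigcup_n A n) = 0%E.
Proof.
move=> s0 h; apply: hmeas_eq0_count; first exact: ltW.
move=> delta eps d0 e0.
have e20 n : 0 < eps / (2 ^ n.+1)%:R by rewrite divr_gt0// ltr0n expn_gt0.
pose G n (p : (nat -> set T) * (nat -> R)) := [/\ A n `<=` \bigcup_i p.1 i,
   forall i x y, p.1 i x -> p.1 i y -> dist x y <= p.2 i, forall i, 0 < p.2 i <= delta &
   (\sum_(0 <= i <oo) (p.2 i `^ s)%:E <= (eps / (2 ^ n.+1)%:R)%:E)%E].
have /choice[F HF] : forall n, exists p, G n p.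
  move=> n; have [U [r [? ? ? ?]]] := hmeas_eq0_radii s0 (h n) d0 (e20 n).
  by exists (U, r).
exists (nat * nat)%type, (fun p => (F p.1).1 p.2), (fun p => (F p.1).2 p.2); split.
- move=> x [n _ Ax]; have [/(_ _ Ax)[i _ Ui] _ _ _] := HF n.
  by exists (n, i).
- by move=> [n i] x y; have [_ + _ _] := HF n; apply.
- by move=> [n i]; have [_ _ /(_ i)/andP[]] := HF n.
- rewrite (_ : setT = setT `*`` (fun=> setT)); last by apply/seteqP; split=> -[].
  rewrite -(@esum_esum _ _ _ setT (fun=> setT) (fun i j => ((F i).2 j `^ s)%:E)); last first.
    by move=> *; rewrite lee_fin powR_ge0.
  apply: (@le_trans _ _ (\sum_(0 <= n <oo) (eps / (2 ^ n.+1)%:R)%:E)%E); last first.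
    by apply: (epsilon_trick0 xpredT); exact: ltW.
  rewrite nneseries_esumT; last by move=> *; rewrite lee_fin ltW.
  apply: le_esum => n _; rewrite -nneseries_esumT; last by move=> *; rewrite lee_fin powR_ge0.
  by have [] := HF n.
Qed.

Lemma hdim_ge0 A : (0 <= hdim A)%E.
Proof. by apply: le_ereal_inf_tmp => _ [s [s0 _] <-]; rewrite lee_fin. Qed.

Lemma hdim_le s A : 0 <= s -> hmeas s A = 0%E -> (hdim A <= s%:E)%E.
Proof. by move=> s0 h; apply: ereal_inf_lbound; exists s. Qed.

Lemma hdim_lt s A : (hdim A < s%:E)%E -> hmeas s A = 0%E.
Proof.
move=> /ereal_inf_lt[_ [t [t0 h] <-]]; rewrite lte_fin => ts.
by apply: hmeas_eq0_mono h => //; exact: ltW.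
Qed.

Lemma hdim_ge s A : hmeas s A <> 0%E -> (s%:E <= hdim A)%E.
Proof. by move=> h; rewrite leNgt; apply/negP => /hdim_lt. Qed.

Lemma hdim_gt s A : 0 <= s -> (s%:E < hdim A)%E -> hmeas s A <> 0%E.
Proof. by move=> s0 + /(hdim_le s0); rewrite ltNge => /negP. Qed.
End hausdorff.

(** * Graphs of Holder functions *)

Section graph_dimension.
Context {R : realType}.
Implicit Types (A : set R) (f : R -> R[i]).

Lemma eucl_dist_ge0 n (u v : 'rV[R]_n) : 0 <= eucl_dist u v.
Proof. exact: sqrtr_ge0. Qed.

Lemma rdist_ge0 (x y : R) : 0 <= rdist x y.
Proof. exact: normr_ge0. Qed.

Lemma eucl_dist_point3 (x y : R) (z w : R[i]) :
  eucl_dist (point3 x z) (point3 y w) =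
  Num.sqrt ((x - y) ^+ 2 + (complex.Re z - complex.Re w) ^+ 2
            + (complex.Im z - complex.Im w) ^+ 2).
Proof. by rewrite /eucl_dist !big_ord_recl big_ord0 !mxE /= addr0 addrA. Qed.

Lemma eucl_dist_point3_le (x y : R) (z w : R[i]) :
  eucl_dist (point3 x z) (point3 y w) <=
  `|x - y| + `|complex.Re z - complex.Re w| + `|complex.Im z - complex.Im w|.
Proof.
rewrite eucl_dist_point3.
set a := x - y; set b := complex.Re z - _; set c := complex.Im z - _.
have -> : `|a| + `|b| + `|c| = Num.sqrt ((`|a| + `|b| + `|c|) ^+ 2).
  by rewrite sqrtr_sqr [RHS]ger0_norm// !addr_ge0.
apply: ler_wsqrtr.
rewrite -(real_normK (num_real a)) -(real_normK (num_real b)) -(real_normK (num_real c)).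
have := normr_ge0 a; have := normr_ge0 b; have := normr_ge0 c.
move: `|a| `|b| `|c| => {}a {}b {}c; nra.
Qed.

Lemma eucl_dist_point3_ge (x y : R) (z w : R[i]) :
  [/\ `|x - y| <= eucl_dist (point3 x z) (point3 y w),
  `|complex.Re z - complex.Re w| <= eucl_dist (point3 x z) (point3 y w) &
  `|complex.Im z - complex.Im w| <= eucl_dist (point3 x z) (point3 y w)].
Proof.
rewrite eucl_dist_point3.
set a := x - y; set b := complex.Re z - _; set c := complex.Im z - _.
have [a2 b2 c2] : [/\ 0 <= a ^+ 2, 0 <= b ^+ 2 & 0 <= c ^+ 2] by rewrite !sqr_ge0.
by split; rewrite -sqrtr_sqr; apply: ler_wsqrtr; lra.
Qed.

(** The bound involves any [r] above the distance, which is what a covering set provides. For g = 0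
    it says that the oscillation at distances up to 1 is at most [C]. *)
Definition holder_on A (g C : R) (u : R -> R) :=
  forall x y r, A x -> A y -> 0 < r <= 1 -> `|x - y| <= r -> `|u x - u y| <= C * r `^ g.

(** Over a set of size r <= 1 the graph has size at most D r^g, because r <= r^g. Its cost at
    exponent s / g is a constant times r^s. *)
Lemma hmeas_graph_div A f (g C s : R) : 0 < g <= 1 -> 0 <= C -> 0 < s ->
  holder_on A g C (fun x => complex.Re (f x)) -> holder_on A g C (fun x => complex.Im (f x)) ->
  hausdorff_measure rdist s A = 0%E ->
  hausdorff_measure eucl_dist (s / g) (graph f A) = 0%E.
Proof.
move=> /andP[g0 g1] C0 s0 hu hv hA.
have sg0 : 0 < s / g by rewrite divr_gt0.
apply: (hmeas_eq0_count (@eucl_dist_ge0 3)); first exact: ltW.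
move=> delta eps d0 e0.
pose D := 1 + 2 * C.
have D0 : 0 < D by rewrite /D ltr_wpDr// mulr_ge0.
have Dsg : 0 < D `^ (s / g) by rewrite powR_gt0.
have dD0 : 0 < (delta / D) `^ g^-1 by rewrite powR_gt0// divr_gt0.
have m0 : 0 < Num.min 1 ((delta / D) `^ g^-1) by rewrite lt_min ltr01.
have e'0 : 0 < eps / D `^ (s / g) by rewrite divr_gt0.
have [U [r [AU Ur rd le]]] := hmeas_eq0_radii rdist_ge0 s0 hA m0 e'0.
have r0 i : 0 < r i by have /andP[] := rd i.
have r1 i : r i <= 1 by have /andP[_] := rd i; rewrite le_min => /andP[].
exists nat, (fun i => [set point3 x (f x) | x in A `&` U i]), (fun i => D * r i `^ g); split.
- by move=> _ [x Ax <-]; have [i _ Ui] := AU _ Ax; exists i => //; exists x.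
- move=> i _ _ [x [Ax Ux] <-] [y [Ay Uy] <-].
  apply: le_trans (eucl_dist_point3_le _ _ _ _) _.
  have xy := Ur _ _ _ Ux Uy.
  have r01 : 0 < r i <= 1 by rewrite r0 r1.
  have := hu _ _ _ Ax Ay r01 xy; have := hv _ _ _ Ax Ay r01 xy => /=.
  have : r i <= r i `^ g by rewrite -{1}(powRr1 (ltW (r0 i))) ger_powR// r0 r1.
  by move: xy; rewrite /rdist /D; lra.
- move=> i; have /andP[_] := rd i; rewrite le_min => /andP[_ h].
  rewrite -ler_pdivlMl// mulrC.
  have -> : delta / D = ((delta / D) `^ g^-1) `^ g.
    by rewrite -powRrM mulVf ?gt_eqF// powRr1// ltW// divr_gt0.
  by rewrite ge0_ler_powR ?nnegrE ?(ltW g0) ?(ltW (r0 _)) ?(ltW dD0).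
- rewrite -nneseries_esumT; last by move=> *; rewrite lee_fin powR_ge0.
  under eq_eseriesr => i _.
    rewrite powRM ?(ltW D0) ?powR_ge0// -powRrM mulrCA mulfV ?gt_eqF// mulr1 EFinM.
    over.
  rewrite nneseriesZl; last by move=> *; rewrite lee_fin powR_ge0.
  apply: (@le_trans _ _ ((D `^ (s / g))%:E * (eps / D `^ (s / g))%:E)%E).
    by rewrite lee_pmul2l// ?lte_fin.
  by rewrite -EFinM lee_fin mulrC divfK// gt_eqF.
Qed.

(** Over a set of size r each coordinate of f stays within C r^g of its value at a reference point,
    so it meets O(r^(g - 1)) intervals of length r. The graph is cut into the square of that number
    of pieces of size 3 r, and r^(2 g - 2) r^(s + 2 - 2 g) = r^s. *)
Lemma hmeas_graph_add A f (g C s : R) : 0 <= g <= 1 -> 0 <= C -> 0 < s ->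
  holder_on A g C (fun x => complex.Re (f x)) -> holder_on A g C (fun x => complex.Im (f x)) ->
  hausdorff_measure rdist s A = 0%E ->
  hausdorff_measure eucl_dist (s + 2 - 2 * g) (graph f A) = 0%E.
Proof.
move=> /andP[g0 g1] C0 s0 hu hv hA.
set t := s + 2 - 2 * g; have t0 : 0 < t by rewrite /t; lra.
apply: (hmeas_eq0_count (@eucl_dist_ge0 3)); first exact: ltW.
move=> delta eps d0 e0.
pose D := (2 * C + 1) ^+ 2 * 3 `^ t.
have D0 : 0 < D by rewrite /D mulr_gt0 ?powR_gt0// exprn_gt0//; lra.
have m0 : 0 < Num.min 1 (delta / 3) by rewrite lt_min ltr01 divr_gt0.
have e'0 : 0 < eps / D by rewrite divr_gt0.
have [U [r [AU Ur rd le]]] := hmeas_eq0_radii rdist_ge0 s0 hA m0 e'0.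
have r0 i : 0 < r i by have /andP[] := rd i.
have r1 i : r i <= 1 by have /andP[_] := rd i; rewrite le_min => /andP[].
have r01 i : 0 < r i <= 1 by rewrite r0 r1.
pose x0 i := xget 0 (A `&` U i).
have x0P i x : A x -> U i x -> A (x0 i) /\ U i (x0 i).
  by move=> Ax Ux; rewrite /x0; case: xgetP => [y -> []//|/(_ x) []].
pose N i := (Num.truncn (2 * C * r i `^ g / r i)).+1.
pose cell i (u : R -> R) y := Num.truncn ((u y - u (x0 i) + C * r i `^ g) / r i).
have cellN i u y : holder_on A g C u -> A y -> U i y ->
    0 <= (u y - u (x0 i) + C * r i `^ g) / r i /\ (cell i u y < N i)%N.
  move=> h Ay Uy; have [A0 U0] := x0P _ _ Ay Uy.
  have := h _ _ _ Ay A0 (r01 i) (Ur _ _ _ Uy U0); rewrite ler_norml => /andP[h1 h2].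
  split; first by rewrite divr_ge0 ?(ltW (r0 i))//; lra.
  rewrite ltnS le_truncn// ler_wpM2r ?invr_ge0 ?(ltW (r0 i))//; lra.
have cellD i u y z : holder_on A g C u -> A y -> U i y -> A z -> U i z ->
    cell i u y = cell i u z -> `|u y - u z| <= r i.
  move=> h Ay Uy Az Uz; have [py _] := cellN _ _ _ h Ay Uy; have [pz _] := cellN _ _ _ h Az Uz.
  rewrite /cell => e; have := truncn_itv py; have := truncn_itv pz; rewrite e.
  move: (Num.truncn _) => n; rewrite !ler_pdivlMr// !ltr_pdivrMr// -natr1 => /andP[a1 a2] /andP[b1 b2].
  by rewrite ler_norml; apply/andP; split; move: a2 b2; rewrite !mulrDl mul1r; lra.
pose Re x := complex.Re (f x); pose Im x := complex.Im (f x).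
(* The second index codes a pair of cells as quotient and remainder modulo [N]. From [N * N] on the
   pieces are empty, and radius 0 makes them free. *)
exists (nat * nat)%type,
  (fun k => [set point3 x (f x) | x in [set x | [/\ A x, U k.1 x,
     cell k.1 Re x = (k.2 %/ N k.1)%N & cell k.1 Im x = (k.2 %% N k.1)%N]]]),
  (fun k => if k.2 \in `I_(N k.1 * N k.1) then 3 * r k.1 else 0); split.
- move=> _ [x Ax <-]; have [i _ Ui] := AU _ Ax.
  have [_ lu] := cellN _ _ _ hu Ax Ui; have [_ lv] := cellN _ _ _ hv Ax Ui.
  exists (i, cell i Re x * N i + cell i Im x)%N => //; exists x => //=.
  split=> //; first by rewrite divnMDl// divn_small// addn0.
  by rewrite modnMDl modn_small.
- move=> [i m] _ _ [x [/= Ax Ux eux evx] <-] [y [/= Ay Uy euy evy] <-].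
  have [_ lu] := cellN _ _ _ hu Ax Ux.
  rewrite ifT; last first.
    rewrite inE /=; rewrite -/Re eux in lu.
    by rewrite -ltn_divLR.
  apply: le_trans (eucl_dist_point3_le _ _ _ _) _.
  have := Ur _ _ _ Ux Uy; rewrite /rdist.
  have := cellD i Re x y hu Ax Ux Ay Uy; rewrite eux euy => /(_ erefl).
  have := cellD i Im x y hv Ax Ux Ay Uy; rewrite evx evy => /(_ erefl).
  by rewrite /Re /Im /=; lra.
- move=> [i m] /=; case: ifP => _; last exact: ltW.
  have /andP[_] := rd i; rewrite le_min => /andP[_]; rewrite ler_pdivlMr//; lra.
- rewrite (_ : setT = setT `*`` (fun=> setT)); last by apply/seteqP; split=> -[].
  rewrite -(@esum_esum R nat nat setT (fun=> setT) (fun i m =>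
    ((if m \in `I_(N i * N i) then 3 * r i else 0) `^ t)%:E)); last first.
    by move=> *; rewrite lee_fin powR_ge0.
  apply: (@le_trans _ _ (\esum_(i in [set: nat]) (D%:E * (r i `^ s)%:E)%E)); last first.
    rewrite -nneseries_esumT; last by move=> *; rewrite -EFinM lee_fin mulr_ge0 ?powR_ge0// ltW.
    rewrite nneseriesZl; last by move=> *; rewrite lee_fin powR_ge0.
    apply: (@le_trans _ _ (D%:E * (eps / D)%:E)%E); first by rewrite lee_pmul2l// ?lte_fin.
    by rewrite -EFinM lee_fin mulrC divfK// gt_eqF.
  apply: le_esum => i _.
  rewrite (@eq_esum R nat setT _ (fun m => if m \in `I_(N i * N i) then ((3 * r i) `^ t)%:E else 0%E)); last first.
    by move=> m _; case: ifP => //; rewrite powR0 ?gt_eqF.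
  rewrite -esum_mkcond esum_fset//; last by move=> *; rewrite lee_fin powR_ge0.
  rewrite -fsbig_ord sumEFin lee_fin sumr_const card_ord -[leLHS]mulr_natl natrM.
  rewrite powRM// ?(ltW (r0 i))//.
  have ri2 : (r i `^ (g - 1)) ^+ 2 * r i `^ t = r i `^ s.
    rewrite -powR_mulrn ?powR_ge0// -powRrM -powRD; last by rewrite (gt_eqF (r0 i)) implybT.
    by congr (_ `^ _); rewrite /t; ring.
  have Ni : (N i)%:R <= (2 * C + 1) * r i `^ (g - 1).
    have e : 2 * C * r i `^ g / r i = 2 * C * r i `^ (g - 1).
      by rewrite powRB ?(gt_eqF (r0 i)) ?implybT// powRr1 ?mulrA// ltW.
    rewrite /N -natr1 [leRHS]mulrDl mul1r; apply: lerD.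
      rewrite -e truncn_le//.
      by rewrite divr_ge0 ?(ltW (r0 i))// !mulr_ge0 ?powR_ge0.
    rewrite -[leLHS](powRr0 (r i)) ger_powR ?r0 ?r1//.
    by rewrite subr_le0.
  rewrite -ri2 /D.
  have := powR_ge0 (r i) t; have := powR_ge0 3 t.
  move: (r i `^ t) (3 `^ t) => p q q0 p0.
  have -> : (2 * C + 1) ^+ 2 * q * (r i `^ (g - 1) ^+ 2 * p) =
    ((2 * C + 1) * r i `^ (g - 1)) ^+ 2 * (q * p) by ring.
  rewrite ler_wpM2r ?mulr_ge0// -expr2 ler_pXn2r// ?nnegrE//.
  exact: le_trans Ni.
Qed.
End graph_dimension.

(** * Dyadic content and capacitability *)

Section dyadic_content.
Context {R : realType}.
Implicit Types (d : nat * int) (D : set (nat * int)) (E : set R).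

Definition dyad d : set R := [set x | d.2%:~R <= 2 ^+ d.1 * x < d.2%:~R + 1].

Lemma dyad_ex n x : exists2 d, d.1 = n & dyad d x.
Proof.
exists (n, Num.floor (2 ^+ n * x)) => //; rewrite /dyad /=.
by rewrite floor_le_tmp /= -intrD1; exact: floorD1_gt.
Qed.

Lemma dyad_same d d' x : d.1 = d'.1 -> dyad d x -> dyad d' x -> d = d'.
Proof.
case: d d' => n k [n' k'] /= <-; rewrite /dyad /= -!intrD1 => h h'; congr pair.
by rewrite -(floor_def h) (floor_def h').
Qed.

Lemma dyad_nested d d' x : (d.1 <= d'.1)%N -> dyad d x -> dyad d' x -> dyad d' `<=` dyad d.
Proof.
case: d d' => n k [n' k'] /= nn'; rewrite /dyad /= -(subnK nn') addnC exprD -!intrD1.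
set m := (n' - n)%N => /andP[h1 h2] /andP[h3 h4] y /= /andP[h5 h6].
have m0 : 0 < 2 ^+ m :> R by rewrite exprn_gt0.
have me : 2 ^+ m = (2 ^+ m : int)%:~R :> R by rewrite rmorphXn.
have kk : (k * 2 ^+ m < k' + 1)%R.
  by rewrite -(ltr_int R) intrM -me (le_lt_trans _ h4)// (mulrC (2 ^+ n)) -mulrA mulrC ler_wpM2l// ltW.
have kk' : (k' < (k + 1) * 2 ^+ m)%R.
  by rewrite -(ltr_int R) intrM -me (le_lt_trans h3)// (mulrC (2 ^+ n)) -mulrA mulrC ltr_pM2r.
apply/andP; split.
  rewrite -(ler_pM2l m0) mulrA (mulrC (2 ^+ m) (2 ^+ n)) (le_trans _ h5)// mulrC me -intrM ler_int.
  by rewrite -ltzD1.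
rewrite -(ltr_pM2l m0) mulrA (mulrC (2 ^+ m) (2 ^+ n)) (lt_le_trans h6)// mulrC me -intrM ler_int.
by rewrite lezD1.
Qed.

Lemma dyad_dist d x y : dyad d x -> dyad d y -> `|x - y| <= 2 ^- d.1.
Proof.
rewrite /dyad /= => /andP[a b] /andP[a' b'].
have m0 : 0 < 2 ^+ d.1 :> R by rewrite exprn_gt0.
rewrite -(ler_pM2l m0) mulfV ?gt_eqF// -{1}(gtr0_norm m0) -normrM mulrBr.
by rewrite ler_norml; apply/andP; split; lra.
Qed.

Definition dabove d' d := (d'.1 < d.1)%N /\ dyad d `<=` dyad d'.

Definition dmax D : set (nat * int) := [set d | D d /\ forall d', D d' -> ~ dabove d' d].

Definition dunion D : set R := \bigcup_(d in D) dyad d.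

Lemma dmax_cover D : dunion D `<=` dunion (dmax D).
Proof.
move=> x [d Dd dx].
elim/ltn_ind: {d}(d.1) {-2}d (erefl d.1) Dd dx => n IH d dn Dd dx.
have [dm|] := pselect (dmax D d); first by exists d.
move=> /not_andP[//|/existsNP[d' /not_implyP[Dd' /contrapT[lt sub]]]].
by apply: (IH d'.1 _ d') => //; [rewrite -dn|exact: sub].
Qed.

(** What is left of both families, counted together, once the maximal elements of the union are
    removed. If a point lies in an interval of each family, the smaller one is not maximal, or the
    two coincide; so this still covers the intersection of the two unions. *)
Definition dlow D1 D2 := (D1 `&` D2) `|` ((D1 `|` D2) `\` dmax (D1 `|` D2)).

Lemma dlow_cover D1 D2 : dunion D1 `&` dunion D2 `<=` dunion (dlow D1 D2).
Proof.
move=> x [[d1 D1d d1x] [d2 D2d d2x]].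
have [lt|le] := ltnP d1.1 d2.1.
  exists d2 => //; right; split; first by right.
  move=> [_ /(_ d1 (or_introl D1d))]; apply; split=> //.
  by apply: dyad_nested d1x d2x; exact: ltnW.
move: le; rewrite leq_eqVlt => /predU1P[e|lt].
  by exists d2 => //; left; split=> //; rewrite (dyad_same e d2x d1x).
exists d1 => //; right; split; first by left.
move=> [_ /(_ d2 (or_intror D2d))]; apply; split=> //.
by apply: dyad_nested d2x d1x; exact: ltnW.
Qed.

Variable s : R.
Hypothesis s0 : 0 < s.

Definition dweight d : \bar R := ((2 ^- d.1) `^ s)%:E.
Definition dcost D : \bar R := \esum_(d in D) dweight d.

Lemma dweight_ge0 d : (0 <= dweight d)%E.
Proof. by rewrite lee_fin powR_ge0. Qed.

Lemma dcost_ge0 D : (0 <= dcost D)%E.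
Proof. by apply: esum_ge0 => *; exact: dweight_ge0. Qed.

Lemma dcost_sub D1 D2 : D1 `<=` D2 -> (dcost D1 <= dcost D2)%E.
Proof.
move=> sub; rewrite /dcost esum_mkcond [leRHS]esum_mkcond; apply: le_esum => d _.
case: ifPn => [|_]; first by rewrite inE => /sub; rewrite -inE => ->.
by case: ifP => // _; exact: dweight_ge0.
Qed.

(** No interval is counted more often on the left than on the right: one that belongs to a single
    family is either maximal or in [dlow], never both. *)
Lemma dcost_max_low D1 D2 :
  (dcost (dmax (D1 `|` D2)) + dcost (dlow D1 D2) <= dcost D1 + dcost D2)%E.
Proof.
pose w D d := if d \in D then dweight d else 0%E.
have w0 D d : (0 <= w D d)%E by rewrite /w; case: ifP => // _; exact: dweight_ge0.
rewrite /dcost 4!(esum_mkcond _ dweight) -!esumD; try by move=> *; exact: w0.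
apply: le_esum => d _.
have [d1|d1] := boolP (d \in D1); have [d2|d2] := boolP (d \in D2).
- by apply: leeD; case: ifP => // _; exact: dweight_ge0.
- rewrite adde0; have [dm|dm] := boolP (d \in dmax _); last first.
    by rewrite add0e; case: ifP => // _; exact: dweight_ge0.
  rewrite ifF ?adde0//; apply/negbTE; rewrite notin_setE => -[[_]|[_ ndm]].
    by move: d2; rewrite notin_setE.
  by move: dm; rewrite inE.
- rewrite add0e; have [dm|dm] := boolP (d \in dmax _); last first.
    by rewrite add0e; case: ifP => // _; exact: dweight_ge0.
  rewrite ifF ?adde0//; apply/negbTE; rewrite notin_setE => -[[+ _]|[_ ndm]].
    by move: d1; rewrite notin_setE.
  by move: dm; rewrite inE.
- have nd : ~ (D1 `|` D2) d.
    by move: d1 d2; rewrite !notin_setE => ? ? [].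
  rewrite ifF ?add0e; last by apply/negbTE; rewrite notin_setE => -[].
  rewrite ifF ?add0e//; apply/negbTE; rewrite notin_setE => -[[/(@or_introl _ (D2 d))]|[]] //.
Qed.

(** The dyadic Hausdorff content. Intervals of every size are allowed, so small intervals may be
    replaced by a larger one containing them. *)
Definition content E : \bar R := ereal_inf [set dcost D | D in [set D | E `<=` dunion D]].

Lemma content_ge0 E : (0 <= content E)%E.
Proof. by apply: le_ereal_inf_tmp => _ [D _ <-]; exact: dcost_ge0. Qed.

Lemma content_le E D : E `<=` dunion D -> (content E <= dcost D)%E.
Proof. by move=> h; apply: ereal_inf_lbound; exists D. Qed.

Lemma content_cover E (c : R) : (content E < c%:E)%E ->
  exists2 D, E `<=` dunion D & (dcost D < c%:E)%E.
Proof. by move=> /ereal_inf_lt[_ [D h <-]] lt; exists D. Qed.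

Lemma content_sub E1 E2 : E1 `<=` E2 -> (content E1 <= content E2)%E.
Proof.
move=> sub; apply: le_ereal_inf_tmp => _ [D /= h <-]; apply: content_le.
exact: subset_trans h.
Qed.

Lemma dcost_setU D1 D2 : (dcost (D1 `|` D2) <= dcost D1 + dcost D2)%E.
Proof.
rewrite /dcost 3!(esum_mkcond _ dweight) -esumD; try by move=> *; case: ifP => // _; exact: dweight_ge0.
apply: le_esum => d _; rewrite in_setU.
by case: (d \in D1); case: (d \in D2); rewrite ?adde0 ?add0e//= leeDl// dweight_ge0.
Qed.

Lemma content_setU E1 E2 : (content (E1 `|` E2) <= content E1 + content E2)%E.
Proof.
have c1 := content_ge0 E1; have c2 := content_ge0 E2.
have [->|f1] := eqVneq (content E1) +oo%E; first by rewrite addye ?leey// gt_eqF// (lt_le_trans _ c2)// ltNy0.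
have [->|f2] := eqVneq (content E2) +oo%E; first by rewrite addey ?leey// gt_eqF// (lt_le_trans _ c1)// ltNy0.
have fin1 : content E1 \is a fin_num by rewrite ge0_fin_numE// ltey.
have fin2 : content E2 \is a fin_num by rewrite ge0_fin_numE// ltey.
apply/lee_addgt0Pr => e e0.
have e20 : 0 < e / 2 by rewrite divr_gt0.
have [_ [D1 h1 <-] l1] := lb_ereal_inf_adherent e20 fin1.
have [_ [D2 h2 <-] l2] := lb_ereal_inf_adherent e20 fin2.
apply: (@le_trans _ _ (dcost (D1 `|` D2))).
  apply: content_le => x [/h1[d ? ?]|/h2[d ? ?]]; exists d => //; [by left|by right].
apply: le_trans (dcost_setU _ _) _.
apply: le_trans (leeD (ltW l1) (ltW l2)) _.
by rewrite addeACA -EFinD -splitr.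
Qed.

(* Costs of covers are strongly subadditive ([dcost_max_low]), so near-optimal
   covers of the [E n] can be merged into covers [M n] whose maximal elements
   stabilise, without losing near-optimality. *)
Lemma content_incr (E : nat -> set R) (c : R) : {homo E : m n / (m <= n)%N >-> m `<=` n} ->
  (forall n, (content (E n) <= c%:E)%E) -> (content (\bigcup_n E n) <= c%:E)%E.
Proof.
move=> Em Ec; apply/lee_addgt0Pr => e e0.
have fin n : content (E n) \is a fin_num.
  by rewrite ge0_fin_numE ?content_ge0// (le_lt_trans (Ec n))// ltry.
have en n : 0 < e / (2 ^ n.+1)%:R by rewrite divr_gt0// ltr0n expn_gt0.
pose good n D := E n `<=` dunion D /\ (dcost D <= content (E n) + (e / (2 ^ n.+1)%:R)%:E)%E.
have /choice[D Dg] : forall n, exists D, good n D.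
  move=> n; have [_ [D h <-] l] := lb_ereal_inf_adherent (en n) (fin n).
  by exists D; split=> //; exact: ltW.
pose M := fix M n := if n is m.+1 then dmax (M m `|` D m.+1) else D 0%N.
have M1 n : E n `<=` dunion (M n) /\ M n `<=` \bigcup_i D i.
  elim: n => [|n [IH1 IH2]]; first by split; [have [] := Dg 0%N|move=> d Dd; exists 0%N].
  split.
    apply: subset_trans (@dmax_cover _); have [h _] := Dg n.+1.
    by move=> x /h [d Dd dx]; exists d => //; right.
  by move=> d [[/IH2//|Dd _]]; exists n.+1.
have M2 n : (dcost (M n) <= content (E n) + (\sum_(0 <= i < n.+1) e / (2 ^ i.+1)%:R)%:E)%E.
  elim: n => [|n IH]; first by rewrite big_nat1; have [] := Dg 0%N.
  have [h1 h2] := Dg n.+1.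
  (* [dlow] still covers [E n]. Subtracting this from the strong subadditivity shows that merging
     adds only the error of the new cover. *)
  have low : (content (E n) <= dcost (dlow (M n) (D n.+1)))%E.
    apply: content_le; apply: subset_trans (@dlow_cover _ _) => x Ex; split.
      by have [+ _] := M1 n; apply.
    by apply: h1; apply: Em Ex.
  have := dcost_max_low (M n) (D n.+1).
  move=> /(le_trans (leeD2l _ low)) /le_trans /(_ (leeD IH h2)).
  rewrite -[in leRHS]addeA [leLHS]addeC leeD2lE// => /le_trans; apply.
  by rewrite [in leRHS]big_nat_recr//= EFinD addeCA.
have Dsum n : (dcost (M n) <= (c + e)%:E)%E.
  apply: le_trans (M2 n) _; rewrite EFinD leeD// ?Ec// lee_fin.
  rewrite -lee_fin -sumEFin; apply: le_trans (epsilon_trick0 xpredT (ltW e0)).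
  apply: (@nneseries_lim_ge _ _ xpredT 0%N) => *.
  by rewrite lee_fin ltW.
(* An interval of [W] that occurs in [D i] is never displaced afterwards and lies in every [M n]
   with n >= i. Each finite part of [W] is thus contained in a single [M n], which bounds its
   cost. *)
pose W := dmax (\bigcup_i D i).
have WM n i d : (i <= n)%N -> W d -> D i d -> M n d.
  elim: n => [|n IH]; first by rewrite leqn0 => /eqP -> _.
  move=> le Wd Did; split.
    by move: le; rewrite leq_eqVlt ltnS => /predU1P[<-|le]; [right|left; exact: IH].
  move=> d' h; apply: (Wd.2 d').
  by case: h => [/(M1 n).2//|Dd]; exists n.+1.
apply: (@le_trans _ _ (dcost W)).
  apply: content_le => x [n _ Ex]; apply: dmax_cover.
  by have [/(_ _ Ex)[d Dd dx] _] := Dg n; exists d => //; exists n.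
apply: ge_ereal_sup => _ [F [finF FW] <-].
have [n Fn] : exists n, F `<=` M n.
  have /choice[i Hi] : forall d, exists i, F d -> D i d.
    move=> d; have [Fd|nFd] := pselect (F d); last by exists 0%N.
    by have [[i _ Did] _] := FW _ Fd; exists i.
  have [n ni] : exists n, forall d, F d -> (i d <= n)%N.
    have /finite_seqP[X FX] := finF.
    exists (\max_(d <- X) i d)%N => d; rewrite FX => /= dX.
    exact: (@leq_bigmax_seq _ _ xpredT).
  by exists n => d Fd; apply: (WM n (i d)); [exact: ni|exact: FW|exact: Hi].
apply: le_trans (Dsum n); apply: ereal_sup_ubound; exists F => //.
Qed.

Lemma content_bigcup (E : nat -> set R) : (forall n, content (E n) = 0%E) ->
  content (\bigcup_n E n) = 0%E.
Proof.
move=> h; pose G n := \big[setU/set0]_(i < n) E i.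
have G0 n : (content (G n) <= 0%:E)%E.
  rewrite /G; elim: n => [|n IH].
    rewrite big_ord0; apply: (@le_trans _ _ (dcost set0)); last by rewrite /dcost esum_set0.
    by apply: content_le.
  by rewrite big_ord_recr /=; apply: le_trans (content_setU _ _) _; rewrite h adde0.
apply/eqP; rewrite eq_le content_ge0 andbT.
apply: le_trans (content_incr _ G0).
  by apply: content_sub => x [n _ Ex]; exists n.+1 => //; rewrite /G big_ord_recr /=; right.
move=> m n mn; exact: subset_bigsetU.
Qed.

(** A cover of total cost below delta^s consists of intervals shorter than delta, so the absence of
    a mesh condition is harmless for null sets. *)
Lemma hmeas_content0 E : content E = 0%E -> hausdorff_measure rdist s E = 0%E.
Proof.
move=> h; apply: (hmeas_eq0_count (@rdist_ge0 R)); first exact: ltW.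
move=> delta eps d0 e0.
pose e := Num.min eps (delta `^ s).
have e'0 : 0 < e by rewrite lt_min e0 powR_gt0.
have [D ED lt] : exists2 D, E `<=` dunion D & (dcost D < e%:E)%E.
  by apply: content_cover; rewrite h lte_fin.
exists (nat * int)%type, (fun d => if d \in D then dyad d else set0),
  (fun d => if d \in D then 2 ^- d.1 else 0); split.
- by move=> x /ED[d Dd dx]; exists d => //; rewrite mem_set.
- by move=> d x y; case: ifP => // _; exact: dyad_dist.
- move=> d; case: ifP => [dD|_]; last exact: ltW.
  have : (dweight d < (delta `^ s)%:E)%E.
    apply: (@le_lt_trans _ _ (dcost D)); last by apply: (lt_le_trans lt); rewrite lee_fin ge_min lexx orbT.
    rewrite -(esum_set1 (dweight_ge0 d)); apply: dcost_sub => _ ->.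
    by rewrite inE in dD.
  rewrite lte_fin => l; rewrite leNgt; apply/negP => /ltW l'.
  move: l; rewrite ltNge ge0_ler_powR// ?nnegrE// ?(ltW s0) ?(ltW d0)//.
- apply: (@le_trans _ _ (dcost D)); last by apply: (le_trans (ltW lt)); rewrite lee_fin ge_min lexx.
  rewrite /dcost [leRHS]esum_mkcond; apply: le_esum => d _; case: ifP => // _.
  by rewrite powR0 ?gt_eqF.
Qed.

Definition dshift (k : int) d := (d.1, d.2 + k).
(** Half-open intervals are not neighbourhoods of their points. Adding the two neighbours of each
    interval leaves room for a ball around every covered point and at most triples the cost. *)
Definition dtri D := D `|` dshift 1 @` D `|` dshift (- 1) @` D.

Lemma dcost_shift k D : dcost (dshift k @` D) = dcost D.
Proof.
rewrite /dcost esum_image// => -[n m] [n' m'] _ _ [-> h]; congr pair.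
exact: addIr h.
Qed.

Lemma dcost_tri D : (dcost (dtri D) <= 3%:E * dcost D)%E.
Proof.
rewrite (_ : 3%:E = 1 + 1 + 1)%E; last by rewrite -!EFinD; congr EFin; lra.
rewrite !ge0_muleDl ?adde_ge0 ?mul1e ?lee01//; apply: le_trans (dcost_setU _ _) _.
rewrite dcost_shift; apply: leeD => //; apply: le_trans (dcost_setU _ _) _.
by rewrite dcost_shift.
Qed.

Lemma dtri_ball D d x y : D d -> dyad d x -> `|y - x| <= 2 ^- d.1 -> dunion (dtri D) y.
Proof.
move=> Dd; rewrite /dyad /= => /andP[h1 h2] h.
have m0 : 0 < 2 ^+ d.1 :> R by rewrite exprn_gt0.
have : `|2 ^+ d.1 * y - 2 ^+ d.1 * x| <= 1.
  by rewrite -mulrBr normrM gtr0_norm// -ler_pdivlMl// mulr1.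
rewrite ler_norml => /andP[h3 h4].
have [lt|ge] := ltP (2 ^+ d.1 * y) d.2%:~R.
  exists (dshift (-1) d); first by right; exists d.
  by rewrite /dyad /= intrD; apply/andP; split; lra.
have [lt'|ge'] := ltP (2 ^+ d.1 * y) (d.2%:~R + 1).
  by exists d; [left; left|rewrite /dyad /= ge].
exists (dshift 1 d); first by left; right; exists d.
by rewrite /dyad /= intrD; apply/andP; split; lra.
Qed.

Lemma content_ball (E : set R) n (x0 : R) : (forall x, E x -> `|x - x0| <= 2 ^- n) ->
  (content E <= (3 * (2 ^- n) `^ s)%:E)%E.
Proof.
move=> h; have [d dn dx0] := dyad_ex n x0.
apply: (@le_trans _ _ (dcost (dtri [set d]))).
  apply: content_le => x /h xx0; apply: (@dtri_ball _ d x0) => //.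
  by rewrite dn.
apply: le_trans (dcost_tri _) _.
by rewrite /dcost esum_set1 ?dweight_ge0// /dweight dn EFinM.
Qed.

(** A cover of the intersection, fattened to an open set at three times the cost, contains some
    [K n] by compactness. Passing to the limit costs a factor 3, which does not affect
    positivity. *)
Lemma content_decr_compact (K : nat -> set R) (t : R) : 0 < t -> compact (K 0%N) ->
  (forall n, closed (K n)) -> {homo K : m n / (m <= n)%N >-> n `<=` m} ->
  (forall n, (t%:E <= content (K n))%E) -> content (\bigcap_n K n) <> 0%E.
Proof.
move=> t0 K0 Kc Km Kt h0.
have [D KD lt] : exists2 D, \bigcap_n K n `<=` dunion D & (dcost D < (t / 3)%:E)%E.
  by apply: content_cover; rewrite h0 lte_fin divr_gt0.
pose O := \bigcup_(p in [set p : (nat * int) * R | D p.1 /\ dyad p.1 p.2]) ball p.2 (2 ^- p.1.1 : R).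
have Oo : open O by apply: bigcup_open => -[d x] _; exact: ball_open.
have OD : O `<=` dunion (dtri D).
  move=> y [[d x] [/= Dd dx]]; rewrite /ball /= => /ltW; rewrite distrC; exact: dtri_ball.
have lt3 : (dcost (dtri D) < t%:E)%E.
  apply: le_lt_trans (dcost_tri _) _.
  by rewrite -lte_pdivlMl// -EFinM mulrC.
have nKO n : exists x, K n x /\ ~ O x.
  apply: contrapT => /forallNP h; have := Kt n; rewrite leNgt => /negP; apply.
  apply: le_lt_trans lt3; apply: content_le => x Kx; apply: OD.
  by apply: contrapT => nO; apply: (h x).
have [x xP] := choice nKO.
have [|p [K0p]] := K0 (x @ \oo) _.
  by exists 0%N => // n _; apply: Km (xP n).1.
rewrite clusterE => hp.
have pn n : (K n `\` O) p.
  have cl : closed (K n `\` O) by apply: closedI => //; exact: open_closedC.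
  apply: cl; apply: hp; exists n => // m /= nm; split; last exact: (xP m).2.
  exact: Km nm _ (xP m).1.
have [_] := pn 0%N; apply.
have [d Dd dp] : dunion D p by apply: KD => n _; have [] := pn n.
by exists (d, p) => //; exact: ballxx.
Qed.
End dyadic_content.

(** * Souslin sets and their approximation by compact sets *)

Section souslin.
Context {R : realType}.
Implicit Types (A : set R).

(** A family indexed by finite sequences, represented on infinite sequences of which only the first
    [n] entries matter at stage [n]. *)
Definition souslin_scheme (K : nat -> (nat -> nat) -> set R) :=
  (forall n f, closed (K n f)) /\
  (forall n f g, (forall i, (i < n)%N -> f i = g i) -> K n f = K n g).

Definition souslin A := exists2 K, souslin_scheme K &
  A = [set x | exists f, forall n, K n f x].

Lemma closed_souslin A : closed A -> souslin A.
Proof.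
move=> cA; exists (fun _ _ => A) => //.
by apply/seteqP; split=> [x Ax|x [_ /(_ 0%N)]//]; exists id.
Qed.

(** The first entry of a branch selects the set, the remaining entries are a branch of its
    scheme. *)
Lemma souslin_bigcup (A : nat -> set R) : (forall i, souslin (A i)) -> souslin (\bigcup_i A i).
Proof.
move=> h; have /choice[K KP] : forall i, exists K, souslin_scheme K /\
    A i = [set x | exists f, forall n, K n f x].
  by move=> i; have [K ? ?] := h i; exists K.
exists (fun n f => if n is m.+1 then K (f 0%N) m (f \o succn) else setT).
  split=> [[|n] f|[|n] f g fg] //=.
    by apply: (KP _).1.1.
  rewrite (fg 0%N)//; apply: (KP _).1.2 => i ni /=.
  exact: fg.
apply/seteqP; split=> x.
  move=> [i _]; rewrite (KP i).2 => -[f Kf].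
  by exists (fun n => if n is m.+1 then f m else i) => -[|n]//=; exact: Kf.
move=> [f Kf]; exists (f 0%N) => //; rewrite (KP _).2; exists (f \o succn) => n.
exact: (Kf n.+1).
Qed.

Lemma souslin_bigcap (A : nat -> set R) : (forall i, souslin (A i)) -> souslin (\bigcap_i A i).
Proof.
move=> h; have /choice[K KP] : forall i, exists K, souslin_scheme K /\
    A i = [set x | exists f, forall n, K n f x].
  by move=> i; have [K ? ?] := h i; exists K.
pose c (i j : nat) := pickle (i, j).
(* One branch interleaves a branch for each set. Stage [m] can impose the condition of index p only
   when all the entries that this condition reads come before [m]. *)
pose dom m := [set p : nat * nat | forall j, (j < p.2)%N -> (c p.1 j < m)%N].
exists (fun m f => \bigcap_(p in dom m) K p.1 p.2 (fun j => f (c p.1 j))).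
  split=> [m f|m f g fg]; first by apply: closed_bigI => p _; apply: (KP _).1.1.
  apply: eq_bigcapr => p pm; apply: (KP _).1.2 => j jp.
  by apply: fg; exact: pm.
apply/seteqP; split=> x.
  move=> hx; have /choice[F FP] : forall i, exists f, forall n, K i n f x.
    by move=> i; have := hx i I; rewrite (KP i).2 => -[f Kf]; exists f.
  exists (fun m => if @unpickle (nat * nat)%type m is Some p then F p.1 p.2 else 0%N).
  move=> m [i n] _ /=; have := FP i n.
  congr (K i n _ x); apply/funext => j; by rewrite /c pickleK.
move=> [f Kf] i _; rewrite (KP i).2; exists (fun j => f (c i j)) => n.
apply: (Kf (\max_(j < n) (c i j).+1)%N (i, n)) => j /= jn.
exact: (@leq_bigmax _ (fun j : 'I_n => (c i j).+1) (Ordinal jn)).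
Qed.

(** Complements of Souslin sets need not be Souslin, so the induction on Borel sets carries a set
    together with its complement. *)
Lemma measurable_souslin A : measurable A -> souslin A.
Proof.
rewrite /measurable /= /measurableR RGenInftyO.measurableE => mA.
suff [] : souslin A /\ souslin (~` A) by [].
apply: (smallest_sub (X := fun A => souslin A /\ souslin (~` A)) _ _ mA).
  split.
  - by rewrite setC0; split; apply: closed_souslin; [exact: closed0|exact: closedT].
  - by move=> B [sB sCB]; rewrite setTD setCK.
  - move=> F sF; split; first by apply: souslin_bigcup => i; have [] := sF i.
    by rewrite setC_bigcup; apply: souslin_bigcap => i; have [] := sF i.
move=> _ [x ->]; split; last first.
  by apply: closed_souslin; rewrite setCitvl; exact: interval_closed.
rewrite (_ : `]-oo, x[%classic = \bigcup_n `]-oo, x - n.+1%:R^-1]%classic); last first.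
  apply/seteqP; split=> y /=.
    rewrite in_itv /= => yx.
    have [n ny] : exists n, n.+1%:R^-1 < x - y.
      have /ltr_add_invr[k] : 0 < x - y by rewrite subr_gt0.
      by rewrite add0r; exists k.
    by exists n => //=; rewrite in_itv /= lerBrDl -lerBrDr ltW.
  move=> [n _] /=; rewrite !in_itv /= => yn.
  apply: le_lt_trans yn _; by rewrite ltrBlDr ltrDl invr_gt0.
by apply: souslin_bigcup => n; apply: closed_souslin; exact: interval_closed.
Qed.

Variable s : R.
Hypothesis s0 : 0 < s.

(** Koenig's lemma: bounded branches that satisfy the conditions up to every finite level yield one
    branch that satisfies all of them. *)
Lemma konig (N : nat -> nat) K x : souslin_scheme K ->
  (forall n, exists2 f, (forall i, (i < n)%N -> (f i <= N i)%N) & forall m, (m <= n)%N -> K m f x) ->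
  exists f, forall n, K n f x.
Proof.
move=> [_ Kdep] h.
pose ok n (l : seq nat) := exists f, [/\ forall i, (i < n)%N -> (f i <= N i)%N,
   forall i, (i < size l)%N -> f i = nth 0%N l i & forall m, (m <= n)%N -> K m f x].
(* A good prefix extends to bounded branches that are valid up to any level. If none of its finitely
   many one-step extensions were good, they would all fail at a common level, a contradiction. *)
pose good l := forall n, (size l <= n)%N -> ok n l.
have okS n l : ok n.+1 l -> ok n l.
  move=> [f [h1 h2 h3]]; exists f; split=> // i ni; [apply: h1|apply: h3]; exact: leqW.
have ok_le n m l : (n <= m)%N -> ok m l -> ok n l.
  by move=> /subnK <-; elim: (m - n)%N => // k IH /okS.
have good0 : good [::].
  by move=> n _; have [f h1 h2] := h n; exists f; split.
have step l : good l -> exists k, good (rcons l k).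
  move=> gl; apply: contrapT => /forallNP ng.
  have /choice[n nP] : forall k, exists n, (size (rcons l k) <= n)%N /\ ~ ok n (rcons l k).
    by move=> k; have /existsNP[n /not_implyP[? ?]] := ng k; exists n.
  pose M := (\max_(k < (N (size l)).+1) n k)%N.
  have Ml : (size l < M)%N.
    have := (nP 0%N).1; rewrite size_rcons => /leq_trans; apply.
    exact: (@leq_bigmax _ (fun k : 'I__ => n k) ord0).
  have [f [h1 h2 h3]] := gl M (ltnW Ml).
  have fl := h1 _ Ml; rewrite -ltnS in fl.
  have [_] := nP (f (size l)); apply.
  apply: (@ok_le _ M); first exact: (@leq_bigmax _ (fun k : 'I__ => n k) (Ordinal fl)).
  exists f; split=> // i; rewrite size_rcons ltnS leq_eqVlt nth_rcons => /predU1P[->|il].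
    by rewrite ltnn eqxx.
  by rewrite il h2.
have /choice[g gP] : forall l, exists k, good l -> good (rcons l k).
  by move=> l; have [/step[k]|] := pselect (good l); [exists k|exists 0%N].
pose L := fix L n := if n is m.+1 then rcons (L m) (g (L m)) else [::].
have sL n : size (L n) = n by elim: n => //= n IH; rewrite size_rcons IH.
have Lg n : good (L n) by elim: n => // n IH; exact: gP.
pose f n := g (L n).
have Lf n i : (i < n)%N -> nth 0%N (L n) i = f i.
  elim: n => // n IH; rewrite ltnS leq_eqVlt /= nth_rcons sL => /predU1P[->|lt].
    by rewrite ltnn eqxx.
  by rewrite lt IH.
exists f => n; have [f' [_ h2 h3]] := Lg n n (eq_leq (sL n)).
rewrite (Kdep n f f'); first exact: h3.
move=> i ni; by rewrite h2 ?sL// Lf.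
Qed.

Local Notation segm k := (`[(- k)%R, k]%classic : set R).

(** The capacitability argument. The entries of the branches are bounded one after the other: as the
    bound on the next entry tends to infinity the sets increase, so by [content_incr] some bound
    keeps the content above t. The points with bounded branches up to level n form compact sets that
    decrease to a subset of A. *)
Lemma souslin_capacitable A (k : R) (t : R) : souslin A -> 0 < t ->
  (t%:E < content s (A `&` segm k))%E ->
  exists C : set R, [/\ compact C, C `<=` A & content s C <> 0%E].
Proof.
move=> [K Kscheme AE] t0 tA; have [Kc Kdep] := Kscheme.
pose J := segm k.
pose Al (l : seq nat) := [set x | J x /\
  exists2 f, (forall i, (i < size l)%N -> (f i <= nth 0%N l i)%N) & forall n, K n f x].
have step l : (t%:E < content s (Al l))%E -> exists j, (t%:E < content s (Al (rcons l j)))%E.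
  move=> tl; apply: contrapT => /forallNP h.
  move: tl; rewrite ltNge => /negP; apply.
  have : (content s (\bigcup_j Al (rcons l j)) <= t%:E)%E.
    apply: content_incr; last by move=> j; rewrite leNgt; apply/negP/h.
    move=> i j ij x [Jx [f fl Kf]]; split=> //; exists f => // m ml.
    apply: leq_trans (fl m _) _; first by move: ml; rewrite !size_rcons.
    by rewrite !nth_rcons; case: ltnP => // _; case: ifP.
  apply: le_trans; apply: content_sub => x [Jx [f fl Kf]].
  exists (f (size l)) => //; split=> //; exists f => // m.
  rewrite size_rcons ltnS leq_eqVlt nth_rcons => /predU1P[->|ml]; first by rewrite ltnn eqxx.
  by rewrite ml fl.
have /choice[g gP] : forall l, exists j, (t%:E < content s (Al l))%E -> (t%:E < content s (Al (rcons l j)))%E.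
  move=> l; have [/step[j]|] := pselect (t%:E < content s (Al l))%E; first by exists j.
  by exists 0%N.
pose L := fix L n := if n is m.+1 then rcons (L m) (g (L m)) else [::].
have sL n : size (L n) = n by elim: n => //= n IH; rewrite size_rcons IH.
have Lg n : (t%:E < content s (Al (L n)))%E.
  elim: n => [|n IH]; last exact: gP.
  apply: lt_le_trans tA _; apply: content_sub => x [Ax Jx]; split=> //.
  by move: Ax; rewrite AE => -[f Kf]; exists f.
pose N n := g (L n).
have LN n i : (i < n)%N -> nth 0%N (L n) i = N i.
  elim: n => // n IH; rewrite ltnS leq_eqVlt /= nth_rcons sL => /predU1P[->|lt].
    by rewrite ltnn eqxx.
  by rewrite lt IH.
pose C n := [set x | J x /\ exists2 f, (forall i, (i < n)%N -> (f i <= N i)%N) &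
  forall m, (m <= n)%N -> K m f x].
have Jc : compact J by exact: segment_compact.
have Jcl : closed J by apply: compact_closed => //; exact: Rhausdorff.
(* Only finitely many prefixes of length [n] obey the bounds, so this is a finite union of closed
   sets. *)
have Cc n : closed (C n).
  pose B := (\max_(i < n) N i)%N.
  pose ext (F : {ffun 'I_n -> 'I_B.+1}) i := if insub i is Some j then F j : nat else 0%N.
  rewrite (_ : C n = J `&` \bigcup_(F in [set F : {ffun 'I_n -> 'I_B.+1} | forall i : 'I_n, (F i <= N i)%N])
      \bigcap_(m in `I_n.+1) K m (ext F)).
    apply: closedI => //; apply: closed_bigcup; first exact: finite_finset.
    by move=> F _; apply: closed_bigI => m _; exact: Kc.
  apply/seteqP; split=> x [Jx].
    move=> [f fN Kf]; split=> //.
    exists [ffun i : 'I_n => inord (f i)] => /=.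
      move=> i; rewrite ffunE inordK ?fN// ltnS.
      apply: leq_trans (fN _ (ltn_ord i)) _.
      exact: (@leq_bigmax _ (fun i : 'I_n => N i) i).
    move=> m /= mn; rewrite (Kdep m _ f); [exact: Kf|move=> i im].
    have il : (i < n)%N by exact: leq_trans im _.
    rewrite /ext insubT ffunE inordK // ltnS /=.
    apply: leq_trans (fN _ il) _.
    exact: (@leq_bigmax _ (fun i : 'I_n => N i) (Ordinal il)).
  move=> [F FN Kf]; split=> //; exists (ext F); last by move=> m mn; exact: Kf.
  by move=> i il; rewrite /ext insubT; exact: (FN (Ordinal il)).
exists (\bigcap_n C n); split.
- apply: (@subclosed_compact _ _ J) => //; first by apply: closed_bigI => n _.
  by move=> x /(_ 0%N I) [].
- move=> x Cx; rewrite AE; apply: (konig (N := N)) => // n.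
  by have [] := Cx n I.
- apply: (content_decr_compact (s := s) t0) => //.
  + by apply: (@subclosed_compact _ _ J) => // x [].
  + move=> m n mn x [Jx [f fN Kf]]; split=> //; exists f => i im; last by apply: Kf; exact: leq_trans mn.
    by apply: fN; exact: leq_trans mn.
  + move=> n; apply: le_trans (ltW (Lg n)) _; apply: content_sub => x [Jx [f fl Kf]].
    split=> //; exists f => // i il; rewrite -(LN n)//; apply: fl.
    by rewrite sL.
Qed.

Lemma measurable_compact_content A : measurable A -> hausdorff_measure rdist s A <> 0%E ->
  exists C : set R, [/\ compact C, C `<=` A & content s C <> 0%E].
Proof.
move=> mA hA.
have cA : content s A <> 0%E by move=> /(hmeas_content0 s0).
have [n nP] : exists n, content s (A `&` segm (n%:R)%R) <> 0%E.
  apply: contrapT => /forallNP h; apply: cA.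
  rewrite (_ : A = \bigcup_n (A `&` segm (n%:R)%R)); last first.
    apply/seteqP; split=> [x Ax|x [n _ []]//]; exists (Num.bound `|x|) => //; split=> //=.
    by rewrite in_itv /= -ler_norml ltW// archi_boundP.
  by apply: content_bigcup => n; apply: contrapT; exact: h.
have [t t0 tc] : exists2 t : R, 0 < t & (t%:E < content s (A `&` segm (n%:R)%R))%E.
  have := content_ge0 s (A `&` segm (n%:R)%R); move: nP.
  case: (content _ _) => [r| |]// r0.
    rewrite lee_fin le_eqVlt => /predU1P[e|rp]; first by case: r0; rewrite -e.
    by exists (r / 2); [lra|rewrite lte_fin; lra].
  by exists 1; rewrite ?ltry.
by apply: souslin_capacitable t0 tc; exact: measurable_souslin.
Qed.
End souslin.

(** * Frostman measures *)

Section frostman.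
Context {R : realType}.

Lemma dyadic_scale (r : R) : 0 < r <= 1 -> exists n, 2 ^- n.+1 < r <= 2 ^- n.
Proof.
move=> /andP[r0 r1].
have ex : exists n, 2 ^- n < r.
  have /cvgrPdist_lt/(_ _ r0)[n _ /(_ n (leqnn n))] : ((fun n => (2^-1 : R) ^+ n) @ \oo --> (0 : R)).
    by apply: cvg_expr; rewrite ger0_norm// invf_lt1// ltr1n.
  rewrite sub0r normrN ger0_norm ?exprn_ge0// exprVn => h.
  by exists n.
case: (ex_minnP ex) => -[|n] nr nmin.
  by move: nr; rewrite expr0 invr1 ltNge r1.
exists n; rewrite nr leNgt; apply/negP => /nmin; by rewrite ltnn.
Qed.

Variable s : R.
Hypothesis s0 : 0 < s.

Lemma content_ball_real (E : set R) (x0 r : R) : 0 < r <= 1 ->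
  (forall x, E x -> `|x - x0| <= r) -> (content s E <= (3 * 2 `^ s * r `^ s)%:E)%E.
Proof.
move=> r01; have [n /andP[n1 n2]] := dyadic_scale r01 => h.
apply: (@le_trans _ _ (3 * (2 ^- n) `^ s)%:E).
  by apply: (content_ball s (x0 := x0)) => x /h /le_trans; apply.
rewrite lee_fin -mulrA ler_wpM2l// -powRM// ?(ltW (andP r01).1)//.
rewrite ge0_ler_powR ?(ltW s0) ?nnegrE ?invr_ge0 ?exprn_ge0// ?mulr_ge0 ?(ltW (andP r01).1)//.
by apply/ltW; move: n1; rewrite exprS invfM ltr_pdivrMl.
Qed.

Lemma content_bounded n : (content s [set x : R | (`|x| <= n%:R)%R] < +oo)%E.
Proof.
elim: n => [|n IH].
  apply: (@le_lt_trans _ _ (3 * (2 ^- 0) `^ s)%:E); last by rewrite ltry.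
  apply: (content_ball s (x0 := 0)) => x /= h; rewrite subr0 (le_trans h)//.
  by rewrite expr0 invr1.
apply: (@le_lt_trans _ _ (content s ([set x : R | (`|x| <= n%:R)%R] `|`
    ([set x : R | (`|x - n%:R| <= 1)%R] `|` [set x : R | (`|x + n%:R| <= 1)%R])))).
  apply: content_sub => x /=; rewrite -natr1 !ler_norml => /andP[h1 h2].
  have [l1|l1] := leP x n%:R; last by right; left; apply/andP; split; lra.
  have [l2|l2] := leP (- n%:R) x; first by left.
  by right; right; apply/andP; split; lra.
apply: le_lt_trans (content_setU _ _ _) _; apply: lte_add_pinfty => //.
apply: le_lt_trans (content_setU _ _ _) _; apply: lte_add_pinfty.
  apply: (@le_lt_trans _ _ (3 * (2 ^- 0) `^ s)%:E); last by rewrite ltry.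
  by apply: (content_ball s (x0 := n%:R)) => x /=; rewrite expr0 invr1.
apply: (@le_lt_trans _ _ (3 * (2 ^- 0) `^ s)%:E); last by rewrite ltry.
by apply: (content_ball s (x0 := - n%:R)) => x /=; rewrite expr0 invr1 opprK.
Qed.

Section measure.
Variables (C : set R) (k : nat).
Hypothesis Ck : forall x, C x -> `|x| <= k%:R.
Hypothesis C0 : content s C <> 0%E.

Let cl (x : R) := C `&` `]-oo, x]%classic.

Lemma content_fin E : E `<=` C -> content s E = (fine (content s E))%:E.
Proof.
move=> EC; rewrite fineK// ge0_fin_numE ?content_ge0//.
by apply: le_lt_trans (content_bounded k); apply: content_sub => x /EC /Ck.
Qed.

Let c0 : R := fine (content s C).
Let c0_gt0 : 0 < c0.
Proof.
rewrite lt_neqAle fine_ge0 ?content_ge0// andbT; apply/eqP => h.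
by apply: C0; rewrite content_fin// -/c0 -h.
Qed.

(** On the line a Frostman measure can be given by its distribution function. By subadditivity of
    the content the increment from x to y is at most the normalised content of the slice of [C] in
    []x, y]], hence of order r^s on an interval of radius r. *)
Definition content_cdf x : R := fine (content s (cl x)) / c0.

Lemma content_cdf_incr x y : content_cdf y <= content_cdf x + fine (content s (C `&` `]x, y]%classic)) / c0.
Proof.
rewrite /content_cdf -mulrDl ler_wpM2r ?invr_ge0 ?(ltW c0_gt0)//.
rewrite -lee_fin EFinD -!content_fin; try by move=> ? [].
apply: le_trans (content_setU _ _ _); apply: content_sub => z [Cz] /=.
rewrite in_itv /= => zy; have [zx|xz] := leP z x; [left|right]; split=> //=;
  by rewrite in_itv /= ?xz.
Qed.

Lemma content_cdf_nd : {homo content_cdf : x y / x <= y}.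
Proof.
move=> x y xy; rewrite /content_cdf ler_wpM2r ?invr_ge0 ?(ltW c0_gt0)//.
rewrite -lee_fin -!content_fin; try by move=> ? [].
by apply: content_sub => z [Cz] /=; rewrite !in_itv /= => zx; split=> //=; rewrite in_itv; exact: le_trans xy.
Qed.

Lemma content_cdf_holder (x y x0 r : R) : 0 < r <= 1 -> x0 - r <= x -> y <= x0 + r ->
  content_cdf y <= content_cdf x + 3 * 2 `^ s / c0 * r `^ s.
Proof.
move=> r01 xr yr; apply: le_trans (content_cdf_incr x y) _; rewrite lerD2l mulrAC.
rewrite ler_wpM2r ?invr_ge0 ?(ltW c0_gt0)// -lee_fin -content_fin; last by move=> ? [].
apply: (content_ball_real (x0 := x0)) => // z [_] /=; rewrite in_itv /= => /andP[h1 h2].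
by rewrite ler_norml; apply/andP; split; lra.
Qed.

Lemma content_cdf_rc : right_continuous content_cdf.
Proof.
move=> x; apply/cvgrPdist_le => e e0.
pose M := 3 * 2 `^ s / c0; have M0 : 0 < M by rewrite divr_gt0// mulr_gt0// powR_gt0.
pose r := Num.min 1 ((e / M) `^ s^-1).
have r0 : 0 < r by rewrite lt_min ltr01 powR_gt0// divr_gt0.
near=> y.
have xy : x < y by near: y; exact: nbhs_right_gt.
have yr : y < x + r by near: y; apply: nbhs_right_lt; rewrite ltrDl.
rewrite ler0_norm ?subr_le0 ?content_cdf_nd ?(ltW xy)// opprB lerBlDl.
apply: le_trans (@content_cdf_holder x y x r _ _ _) _.
- by rewrite r0 ge_min lexx.
- by rewrite gerBl ltW.
- exact: ltW.
- rewrite lerD2l -ler_pdivlMl// mulrC.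
  have -> : e / M = ((e / M) `^ s^-1) `^ s.
    by rewrite -powRrM mulVf ?gt_eqF// powRr1// ltW// divr_gt0.
  rewrite ge0_ler_powR ?nnegrE ?(ltW s0) ?(ltW r0) ?powR_ge0//.
  by rewrite ge_min lexx orbT.
Unshelve. all: end_near. Qed.

Lemma content_cdf_y : content_cdf @ +oo --> (1 : R).
Proof.
apply: cvg_near_cst; near=> x; rewrite /content_cdf /cl.
suff -> : C `&` `]-oo, x]%classic = C by rewrite divff// gt_eqF.
apply/seteqP; split=> [z []//|z Cz]; split=> //=; rewrite in_itv /=.
have := Ck Cz; rewrite ler_norml => /andP[_ /le_trans]; apply.
near: x; exact: nbhs_pinfty_ge.
Unshelve. all: end_near. Qed.

Lemma content_cdf_Ny : content_cdf @ -oo --> (0 : R).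
Proof.
apply: cvg_near_cst; near=> x; rewrite /content_cdf /cl.
suff -> : C `&` `]-oo, x]%classic = set0.
  rewrite (_ : content s set0 = 0%E) ?mul0r//; apply/eqP; rewrite eq_le content_ge0 andbT.
  by apply: (@le_trans _ _ (dcost s set0)); [exact: content_le|rewrite /dcost esum_set0].
apply/seteqP; split=> [z [Cz] /=|z//]; rewrite in_itv /= => zx.
have := Ck Cz; rewrite ler_norml => /andP[/le_trans /(_ zx) + _]; apply/negP; rewrite -ltNge.
near: x; exact: nbhs_ninfty_lt.
Unshelve. all: end_near. Qed.

HB.instance Definition _ := isCumulative.Build R _ R content_cdf content_cdf_nd content_cdf_rc.
HB.instance Definition _ := isCumulativeBounded.Build R 0 1 content_cdf content_cdf_Ny content_cdf_y.

Definition content_measure : probability (measurableTypeR R) R :=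
  lebesgue_stieltjes_measure (content_cdf : cumulativeBounded (0:R) (1:R)).

Lemma content_measure_oc (a b : R) : a <= b ->
  content_measure `]a, b]%classic = (content_cdf b - content_cdf a)%:E.
Proof.
move=> ab; rewrite /content_measure /= /lebesgue_stieltjes_measure /measure_extension.
rewrite measurable_mu_extE/=; last exact: is_ocitv.
by rewrite wlength_itv_bnd.
Qed.

Lemma content_measure_ball : exists2 M : R, 0 <= M & forall x r : R, 0 < r ->
  (content_measure `[(x - r)%R, (x + r)%R]%classic <= (M * r `^ s)%:E)%E.
Proof.
(* The first constant serves radii r <= 1/2, where the closed ball is put into a half-open interval
   of radius 2 r. Beyond that the measure is at most 1 <= (2 r)^s. *)
pose M := Num.max (3 * 2 `^ s / c0 * 2 `^ s) (2 `^ s).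
exists M; first by rewrite le_max (powR_ge0 2) orbT.
move=> x r r0; have [r1|r1] := leP (2 * r) 1.
  apply: (@le_trans _ _ (content_measure `](x - 2 * r)%R, (x + r)%R]%classic)).
    apply: le_measure; rewrite ?inE; try exact: measurable_itv.
    by move=> z /=; rewrite !in_itv /= => /andP[h ->]; rewrite andbT; lra.
  rewrite content_measure_oc; last by lra.
  rewrite lee_fin lerBlDl.
  apply: le_trans (@content_cdf_holder (x - 2 * r) (x + r) x (2 * r) _ _ _) _; try lra.
  rewrite lerD2l powRM// ?(ltW r0)// mulrA ler_wpM2r ?powR_ge0//.
  by rewrite le_max lexx.
apply: (@le_trans _ _ 1%E); first by apply: probability_le1; exact: measurable_itv.
rewrite lee_fin; apply: (@le_trans _ _ (2 `^ s * r `^ s)); last first.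
  by rewrite ler_wpM2r ?powR_ge0// le_max lexx orbT.
rewrite -powRM// ?(ltW r0)//.
have /= := @ge0_ler_powR R s (ltW s0) 1 (2 * r); rewrite powR1; apply.
- by rewrite nnegrE.
- by rewrite nnegrE mulr_ge0// ltW.
- exact: ltW.
Qed.

(** The distribution function is constant across any interval that misses [C], and countably many
    such intervals with rational ends fill the complement. *)
Lemma content_measureC : closed C -> content_measure (~` C) = 0%E.
Proof.
move=> Ccl; have oC : open (~` C) by exact: closed_openC.
pose U n : set R := if @pickle_inv (rat * rat)%type n is Some p then
  if `[< `]ratr p.1, ratr p.2]%classic `<=` ~` C >] then `]ratr p.1, ratr p.2]%classic else set0 else set0.
have mU n : measurable (U n).
  by rewrite /U; case: pickle_inv => [p|//]; case: asboolP => // h; exact: measurable_itv.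
have U0 n : content_measure (U n) = 0%E.
  rewrite /U; case: pickle_inv => [[p q]|]; last by rewrite measure0.
  case: asboolP => [h|_]; last by rewrite measure0.
  have [pq|qp] := leP (ratr p) (ratr q : R); last first.
    by rewrite set_itv_ge ?measure0// bnd_simp -leNgt ltW.
  rewrite content_measure_oc//= (_ : content_cdf (ratr q) = content_cdf (ratr p)) ?subrr//.
  rewrite /content_cdf (_ : cl (ratr q) = cl (ratr p))//; apply/seteqP; split=> z [Cz] /=;
    rewrite !in_itv /= => zq; split=> //=; rewrite in_itv /=; last exact: le_trans pq.
  rewrite leNgt; apply/negP => pz; apply: (h z) => //=.
  by rewrite in_itv /= pz.
have sub : ~` C `<=` \bigcup_n U n.
  move=> x Cx; have /nbhs_ballP[e /= e0 xe] := open_nbhs_nbhs (conj oC Cx).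
  have [p /andP[p1 p2]] : exists p : rat, x - e < ratr p < x.
    have [|p] := @rat_in_itvoo _ (x - e) x; first by lra.
    by rewrite in_itv; exists p.
  have [q /andP[q1 q2]] : exists q : rat, x < ratr q < x + e.
    have [|q] := @rat_in_itvoo _ x (x + e); first by lra.
    by rewrite in_itv; exists q.
  have UE : U (pickle (p, q)) = if `[< `]ratr p, ratr q]%classic `<=` ~` C >] then `]ratr p, ratr q]%classic else set0.
    by rewrite /U pickleK_inv.
  exists (pickle (p, q)); first exact: I.
  rewrite UE; case: asboolP => [_|] /=.
    by rewrite in_itv /= p2 ltW.
  case=> z; rewrite /= in_itv /= => /andP[z1 z2]; apply: (xe z); rewrite /ball /= ltr_norml.
  by apply/andP; split; lra.
apply/eqP; rewrite eq_le measure_ge0 andbT.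
have := measure_sigma_subadditive content_measure mU (open_measurable oC) sub.
by rewrite eseries0 => // i _ _; exact: U0.
Qed.

End measure.

Theorem frostman (A : set R) : measurable A -> hausdorff_measure rdist s A <> 0%E ->
  exists (mu : probability (measurableTypeR R) R) (M : R),
  [/\ 0 <= M, mu (~` A) = 0%E & forall x r : R, 0 < r ->
     (mu `[(x - r)%R, (x + r)%R]%classic <= (M * r `^ s)%:E)%E].
Proof.
move=> mA /(measurable_compact_content s0 mA)[C [Cc CA C0]].
have [M [_ Mb]] := compact_bounded Cc.
have [k kP] : exists k : nat, forall x, C x -> `|x| <= k%:R.
  exists (Num.bound `|M + 1|) => x Cx; apply: (@le_trans _ _ (M + 1)).
    by apply: Mb Cx; rewrite ltrDl.
  by apply: le_trans (ler_norm _) _; rewrite ltW// archi_boundP.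
have [K K0 KP] := content_measure_ball kP C0.
exists (content_measure kP C0), K; split=> //.
apply/eqP; rewrite eq_le measure_ge0 andbT.
have Ccl : closed C by apply: compact_closed => //; exact: Rhausdorff.
rewrite -(content_measureC kP C0 Ccl); apply: le_measure; rewrite ?inE.
- exact: measurableC.
- by apply: measurableC; exact: closed_measurable.
- exact: subsetC.
Qed.
End frostman.

(** * Expectations of bounded functions *)

Section norm_le.
Context d {T : measurableType d} {R : realType}.

Lemma measurable_norm_le (f : T -> R) (r : R) :
  measurable_fun setT f -> measurable [set w | `|f w| <= r].
Proof.
move=> mf; rewrite (_ : [set w | _] = f @^-1` `[- r, r]); last first.
  by apply/seteqP; split=> w /=; rewrite in_itv /= -ler_norml.
by rewrite -[X in measurable X]setTI; apply: mf => //; exact: measurable_itv.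
Qed.
End norm_le.

Section bounded_expectation.
Context d {T : measurableType d} {R : realType}.
Implicit Types (P : probability T R) (f g : T -> R).

(** Under a probability such functions are integrable without further ado, so that expectations can
    be manipulated as real numbers. *)
Definition bmf f := measurable_fun [set: T] f /\ exists M, forall x, `|f x| <= M.

Definition Ex P f : R := (\int[P]_x f x)%R.

Lemma bmf_integrable P f : bmf f -> P.-integrable setT (EFin \o f).
Proof.
move=> [mf [M fM]]; apply: measurable_bounded_integrable => //.
  by apply: le_lt_trans (probability_le1 P measurableT) _; rewrite ltry.
exists M; split; first exact: num_real.
by move=> x Mx y _ /=; rewrite (le_trans (fM y))// ltW.
Qed.

Lemma bmf_cst (r : R) : bmf (fun=> r).
Proof. by split; [exact: measurable_cst|exists `|r|]. Qed.

Lemma bmfD f g : bmf f -> bmf g -> bmf (fun x => f x + g x).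
Proof.
move=> [mf [M fM]] [mg [N gN]]; split; first exact: measurable_funD.
by exists (M + N) => x; rewrite (le_trans (ler_normD _ _))// lerD.
Qed.

Lemma bmfM f g : bmf f -> bmf g -> bmf (fun x => f x * g x).
Proof.
move=> [mf [M fM]] [mg [N gN]]; split; first exact: measurable_funM.
by exists (M * N) => x; rewrite normrM ler_pM.
Qed.

Lemma bmfZ (r : R) f : bmf f -> bmf (fun x => r * f x).
Proof. by apply: bmfM; exact: bmf_cst. Qed.

Lemma bmfB f g : bmf f -> bmf g -> bmf (fun x => f x - g x).
Proof.
move=> bf bg; have : bmf (fun x => f x + (-1) * g x) by apply: bmfD => //; exact: bmfZ.
by congr bmf; apply/funext => x; rewrite mulN1r.
Qed.

Lemma bmf_comp (h : R -> R) f (M : R) : continuous h -> (forall y, `|h y| <= M) ->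
  measurable_fun [set: T] f -> bmf (fun x => h (f x)).
Proof.
move=> ch hM mf; split; last by exists M.
by apply: measurableT_comp => //; exact: continuous_measurable_fun.
Qed.

Lemma EFin_Ex P f : bmf f -> (Ex P f)%:E = (\int[P]_x (f x)%:E)%E.
Proof.
by move=> bf; rewrite /Ex /Rintegral fineK//; apply: integrable_fin_num => //; exact: bmf_integrable.
Qed.

Lemma ExD P f g : bmf f -> bmf g -> Ex P (fun x => f x + g x) = Ex P f + Ex P g.
Proof. by move=> bf bg; rewrite /Ex RintegralD//; exact: bmf_integrable. Qed.

Lemma ExB P f g : bmf f -> bmf g -> Ex P (fun x => f x - g x) = Ex P f - Ex P g.
Proof. by move=> bf bg; rewrite /Ex RintegralB//; exact: bmf_integrable. Qed.

Lemma ExZ P r f : bmf f -> Ex P (fun x => r * f x) = r * Ex P f.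
Proof. by move=> bf; rewrite /Ex RintegralZl//; exact: bmf_integrable. Qed.

Lemma ExZr P r f : bmf f -> Ex P (fun x => f x * r) = Ex P f * r.
Proof. by move=> bf; rewrite /Ex RintegralZr//; exact: bmf_integrable. Qed.

Lemma Ex_cst P r : Ex P (fun=> r) = r.
Proof. rewrite /Ex Rintegral_cst// (_ : fine _ = 1) ?mulr1//.
by rewrite -[1]/(fine 1%E); congr fine; exact: probability_setT. Qed.

Lemma Ex_ge0 P f : (forall x, 0 <= f x) -> 0 <= Ex P f.
Proof. by move=> f0; apply: Rintegral_ge0. Qed.

Lemma Ex_le P f g : bmf f -> bmf g -> (forall x, f x <= g x) -> Ex P f <= Ex P g.
Proof. by move=> bf bg fg; apply: le_Rintegral => //; exact: bmf_integrable. Qed.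

Lemma Ex_norm P f : bmf f -> `|Ex P f| <= Ex P (fun x => `|f x|).
Proof. by move=> bf; apply: le_normr_Rintegral => //; exact: bmf_integrable. Qed.

Lemma Ex_sqr P f : bmf f -> (Ex P f) ^+ 2 <= Ex P (fun x => f x ^+ 2).
Proof.
move=> bf; set e := Ex P f.
have bff : bmf (fun x => f x ^+ 2) by apply: bmfM.
have : 0 <= Ex P (fun x => f x ^+ 2 - (2 * e * f x - e ^+ 2)).
  by apply: Ex_ge0 => x; have := sqr_ge0 (f x - e); lra.
have b1 : bmf (fun x => 2 * e * f x) by exact: bmfZ.
rewrite ExB//; last by apply: bmfB => //; exact: bmf_cst.
rewrite ExB//; last exact: bmf_cst.
by rewrite ExZ// Ex_cst -/e; nra.
Qed.

Lemma bmf_indic (A : set T) : measurable A -> bmf (\1_A : T -> R).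
Proof.
move=> mA; split; first exact: measurable_indic.
by exists 1 => x; rewrite indicE; case: (_ \in _); rewrite ?normr1 ?normr0.
Qed.

Lemma Ex_indic P (A : set T) : measurable A -> (Ex P (\1_A : T -> R))%:E = P A.
Proof.
move=> mA; rewrite EFin_Ex; last exact: bmf_indic.
by rewrite integral_indic// setIT.
Qed.

Lemma Ex_markov P (A : set T) f : measurable A -> bmf f -> (forall x, 0 <= f x) ->
  (forall x, A x -> 1 <= f x) -> (P A <= (Ex P f)%:E)%E.
Proof.
move=> mA bf f0 f1; rewrite -Ex_indic// lee_fin; apply: Ex_le => //; first exact: bmf_indic.
move=> x; rewrite indicE; case: (boolP (x \in A)) => [|_] /=; last exact: f0.
by rewrite inE; exact: f1.
Qed.

End bounded_expectation.

Section fubini.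
Context d1 d2 {T1 : measurableType d1} {T2 : measurableType d2} {R : realType}.
Variables (P : probability T1 R) (Q : probability T2 R).

Lemma bmf_pair1 (f : T1 * T2 -> R) x : bmf f -> bmf (fun y => f (x, y)).
Proof.
move=> [mf [M fM]]; split; last by exists M.
exact: measurableT_comp.
Qed.

Lemma bmf_pair2 (f : T1 * T2 -> R) y : bmf f -> bmf (fun x => f (x, y)).
Proof.
move=> [mf [M fM]]; split; last by exists M.
exact: measurableT_comp.
Qed.

Lemma bmf_Ex2 (f : T1 * T2 -> R) : bmf f -> bmf (fun x => Ex Q (fun y => f (x, y))).
Proof.
move=> bf; have [mf [M fM]] := bf; split; last first.
  exists M => x; apply: le_trans (Ex_norm _ (bmf_pair1 x bf)) _.
  rewrite -[leRHS](Ex_cst Q M); apply: Ex_le => //; last exact: bmf_cst.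
  by case: (bmf_pair1 x bf) => m1 [M1 h]; split; [exact: measurableT_comp|exists M1 => y; rewrite normr_id].
(* Adding a bound makes the integrand nonnegative, so that Tonelli's theorem applies; the constant
   is removed afterwards. The other Fubini-type lemmas proceed in the same way. *)
have b2 : bmf (fun z => f z + M) by apply: bmfD => //; exact: bmf_cst.
have m1 : measurable_fun [set: T1] (fun x => (\int[Q]_y (f (x, y) + M)%:E)%E).
  apply: (@measurable_fun_fubini_tonelli_F _ _ _ _ _ Q (fun z => (f z + M)%:E)).
    by apply/measurable_EFinP; exact: b2.1.
  by move=> z; rewrite lee_fin; have := fM z; rewrite ler_norml; lra.
have -> : (fun x => Ex Q (fun y => f (x, y))) = (fun x => fine (\int[Q]_y (f (x, y) + M)%:E)%E - M).
  apply/funext => x; rewrite -(EFin_Ex Q (bmf_pair1 x b2)) /= ExD ?Ex_cst ?addrK//.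
    exact: bmf_pair1.
  exact: bmf_cst.
apply: measurable_funB => //.
exact: measurableT_comp.
Qed.
End fubini.

Section fubini2.
Context d1 d2 {T1 : measurableType d1} {T2 : measurableType d2} {R : realType}.
Variables (P : probability T1 R) (Q : probability T2 R).

Lemma bmf_swap (f : T1 * T2 -> R) : bmf f -> bmf (fun z : T2 * T1 => f (z.2, z.1)).
Proof.
move=> [mf [M fM]]; split; last by exists M.
have ms : measurable_fun setT (fun z : T2 * T1 => (z.2, z.1)).
  by apply: measurable_fun_pair; [exact: measurable_snd|exact: measurable_fst].
exact: measurableT_comp mf ms.
Qed.

Lemma bmf_Ex1 (f : T1 * T2 -> R) : bmf f -> bmf (fun y => Ex P (fun x => f (x, y))).
Proof. by move=> /bmf_swap/(bmf_Ex2 P). Qed.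

Lemma Ex_fubini (f : T1 * T2 -> R) : bmf f ->
  Ex P (fun x => Ex Q (fun y => f (x, y))) = Ex Q (fun y => Ex P (fun x => f (x, y))).
Proof.
move=> bf; have [mf [M fM]] := bf.
have b2 : bmf (fun z => f z + M) by apply: bmfD => //; exact: bmf_cst.
suff : Ex P (fun x => Ex Q (fun y => f (x, y) + M)) = Ex Q (fun y => Ex P (fun x => f (x, y) + M)).
  have -> : (fun x => Ex Q (fun y => f (x, y) + M)) = (fun x => Ex Q (fun y => f (x, y)) + M).
    by apply/funext => x; rewrite ExD ?Ex_cst//; [exact: bmf_pair1|exact: bmf_cst].
  have -> : (fun y => Ex P (fun x => f (x, y) + M)) = (fun y => Ex P (fun x => f (x, y)) + M).
    by apply/funext => y; rewrite ExD ?Ex_cst//; [exact: bmf_pair2|exact: bmf_cst].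
  rewrite !ExD ?Ex_cst//; try exact: bmf_cst; [|exact: bmf_Ex1|exact: bmf_Ex2].
  exact: addIr.
apply: EFin_inj; rewrite (EFin_Ex P (bmf_Ex2 Q b2)) (EFin_Ex Q (bmf_Ex1 b2)).
under eq_integral do rewrite (EFin_Ex Q (bmf_pair1 _ b2)).
under [RHS]eq_integral do rewrite (EFin_Ex P (bmf_pair2 _ b2)).
apply: (fubini_tonelli (fun z => (f z + M)%:E)).
  by apply/measurable_EFinP; exact: b2.1.
by move=> z; rewrite lee_fin; have := fM z; rewrite ler_norml; lra.
Qed.

End fubini2.

Section uniform_expectation.
Context {R : realType}.

Definition unif : probability (measurableTypeR R) R := uniform_prob (@ltr01 R).

Lemma bmf_continuous (f : R -> R) (M : R) : continuous f -> (forall x, `|f x| <= M) ->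
  bmf (f : measurableTypeR R -> R).
Proof. by move=> cf fM; split; [exact: continuous_measurable_fun|exists M]. Qed.

Lemma Ex_unif (f F : R -> R) (M : R) : continuous f -> (forall x, `|f x| <= M) ->
  (forall x : R, -1 < x -> is_derive x 1 F (f x)) -> Ex unif f = F 1 - F 0.
Proof.
move=> cf fM dF; have bf := bmf_continuous cf fM.
have bfM : bmf ((fun x => f x + M) : measurableTypeR R -> R) by apply: bmfD => //; exact: bmf_cst.
suff : Ex unif (fun x => f x + M) = F 1 - F 0 + M.
  rewrite ExD ?Ex_cst//; [exact: addIr|exact: bmf_cst].
apply: EFin_inj; rewrite (EFin_Ex _ bfM) /= integral_uniform; last 2 first.
- by apply/measurable_EFinP; exact: bfM.1.
- by move=> x; rewrite lee_fin; have := fM x; rewrite ler_norml; lra.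
rewrite subr0 invr1 mul1e.
have dG (x : R) : -1 < x -> is_derive x 1 (fun x => F x + M * x) (f x + M).
  move=> x1; have := dF x x1 => h.
  by apply: is_derive_eq; rewrite /GRing.scale /= mulr1.
etransitivity; first apply: (@continuous_FTC2 R (fun x => f x + M) (fun x => F x + M * x) 0 1 ltr01); last first.
- by rewrite -EFinB; congr EFin; ring.
- move=> x; rewrite in_itv /= => /andP[x0 _]; rewrite derive1E.
  by apply: (@derive_val _ _ _ _ _ _ _ (dG x _)); lra.
- have ct (x : R) : -1 < x -> (fun x => F x + M * x) @ x --> F x + M * x.
    move=> x1; suff : {for x, continuous (fun x => F x + M * x)} by [].
    by apply: differentiable_continuous; apply/derivable1_diffP; exact: (@ex_derive _ _ _ _ _ _ _ (dG x x1)).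
  split.
  + by move=> x; rewrite in_itv /= => /andP[x0 _]; apply: (@ex_derive _ _ _ _ _ _ _ (dG x _)); lra.
  + by apply: cvg_at_right_filter; apply: ct; lra.
  + by apply: cvg_at_left_filter; apply: ct; lra.
- by apply: continuous_subspaceT => x; apply: cvgD; [exact: cf|exact: cvg_cst].
Qed.
End uniform_expectation.

(** * Decay of the Bessel function *)

Section derivatives.
Context {R : realType}.
Implicit Types (f g : R -> R) (x a b : R).

Lemma derD f g x a b : is_derive x 1 f a -> is_derive x 1 g b ->
  is_derive x 1 (fun y => f y + g y) (a + b).
Proof. exact: is_deriveD. Qed.

Lemma derB f g x a b : is_derive x 1 f a -> is_derive x 1 g b ->
  is_derive x 1 (fun y => f y - g y) (a - b).
Proof. exact: is_deriveB. Qed.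

Lemma derM f g x a b : is_derive x 1 f a -> is_derive x 1 g b ->
  is_derive x 1 (fun y => f y * g y) (f x * b + g x * a).
Proof. exact: is_deriveM. Qed.

Lemma derZ f (k : R) x a : is_derive x 1 f a -> is_derive x 1 (fun y => k * f y) (k * a).
Proof. exact: is_deriveZ. Qed.

Lemma der_cst (k : R) x : is_derive x 1 (fun=> k) 0.
Proof. exact: is_derive_cst. Qed.

Lemma der_id x : is_derive x 1 (fun y => y) 1.
Proof. exact: is_derive_id. Qed.

Lemma der_aff (k c : R) x : is_derive x 1 (fun y => k * y + c) k.
Proof.
have := derD (derZ k (der_id x)) (der_cst c x).
by rewrite mulr1 addr0.
Qed.

Lemma der_comp f g x a b : is_derive (g x) 1 f a -> is_derive x 1 g b ->
  is_derive x 1 (fun y => f (g y)) (a * b).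
Proof. exact: is_derive1_comp. Qed.

Lemma der_inv f x a : f x != 0 -> is_derive x 1 f a ->
  is_derive x 1 (fun y => (f y)^-1) (- (f x) ^- 2 * a).
Proof. exact: is_deriveV. Qed.

Lemma der_sin f x a : is_derive x 1 f a -> is_derive x 1 (fun y => sin (f y)) (cos (f x) * a).
Proof. by move=> h; apply: der_comp h; exact: is_derive_sin. Qed.

Lemma der_eq f x a b : is_derive x 1 f a -> a = b -> is_derive x 1 f b.
Proof. by move=> h <-. Qed.

Lemma der_continuous f x a : is_derive x 1 f a -> {for x, continuous f}.
Proof.
move=> h; apply: differentiable_continuous; apply/derivable1_diffP.
exact: (@ex_derive _ _ _ _ _ _ _ h).
Qed.

Lemma der_mono f (df : R -> R) (u v : R) : u <= v ->
  (forall x, u <= x <= v -> is_derive x 1 f (df x)) ->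
  (forall x, u <= x <= v -> 0 <= df x) -> f u <= f v.
Proof.
move=> uv hd h0.
have hw : {within `[u, v], continuous f}.
  apply: continuous_in_subspaceT => x; rewrite inE /= in_itv /= => xuv.
  exact: der_continuous (hd x xuv).
have [x|c] := @MVT_segment R f df u v uv _ hw.
  by rewrite in_itv /= => /andP[? ?]; apply: hd; rewrite !ltW.
rewrite in_itv /= => cuv e; rewrite -subr_ge0 e mulr_ge0 ?subr_ge0//.
exact: h0.
Qed.

Lemma der_const f (u v : R) : u <= v ->
  (forall x, u <= x <= v -> is_derive x 1 f 0) -> f u = f v.
Proof.
move=> uv hd; apply/eqP; rewrite eq_le; apply/andP; split.
  by apply: (@der_mono f (fun=> 0)).
suff : (-1) * f u <= (-1) * f v by rewrite !mulN1r lerN2.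
apply: (@der_mono (fun x => (-1) * f x) (fun=> 0)) => [|x /hd h|x _]; [exact: uv| |exact: lexx].
by apply: der_eq (derZ (-1) h) _; rewrite mulr0.
Qed.

Lemma antiderivative (f : R -> R) (a : R) : continuous f ->
  exists F : R -> R, forall x, a < x -> is_derive x 1 F (f x).
Proof.
move=> cf.
exists (fun x => (\int[lebesgue_measure]_(t in `[a, x]) f t)%R) => x ax.
have := @continuous_FTC1_closed R f a x (x + 1).
rewrite ltrDl ltr01 => /(_ isT) [].
- apply: continuous_compact_integrable; first exact: segment_compact.
  exact: continuous_subspaceT.
- exact: ax.
- exact: cf.
move=> h1 h2; apply: DeriveDef => //.
by rewrite -derive1E.
Qed.
End derivatives.

Section bessel.
Context {R : realType}.
Local Notation U := (@unif R).

(* The Bessel function J_0. *)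
Definition bessel (u : R) : R := Ex U (fun t => cos (u * cos (2 * pi * t))).

Lemma continuous_trig (f : R -> R) (g : R -> R) (u b : R) : continuous f -> continuous g ->
  continuous (fun t => f (u * g (2 * pi * t + b)) : R).
Proof.
move=> cf cg x; apply: (@continuous_comp _ _ _ (fun t : R => u * g (2 * pi * t + b)) f); last exact: cf.
apply: continuousM; first exact: cst_continuous.
apply: (@continuous_comp _ _ _ (fun t : R => 2 * pi * t + b) g); last exact: cg.
by apply: continuousD; [apply: continuousM; [exact: cst_continuous|]|exact: cst_continuous].
Qed.

Lemma pi_lt4 : pi < 4 :> R.
Proof. by have /andP[_] := @pihalf_02 R; rewrite ltr_pdivrMr//; lra. Qed.

Section antiderivatives.
Variables (f F : R -> R).
Hypothesis cf : continuous f.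
Hypothesis f1 : forall x, `|f x| <= 1.
(* Antiderivatives are only available on a half-line; the bounds -100 and 50
   leave room for translations by a phase and by [2 * pi]. *)
Hypothesis dF : forall x : R, -100 < x -> is_derive x 1 F (f x).
Hypothesis f2pi : forall x, f (x + 2 * pi) = f x.

(** F (x + 2 pi) - F x has derivative zero, hence the mean over a period does not depend on the
    phase. *)
Lemma Ex_periodic (b : R) : `|b| <= 50 ->
  Ex U (fun t => f (2 * pi * t + b)) = (F (2 * pi) - F 0) / (2 * pi).
Proof.
move=> b50; have p4 := pi_lt4; have p2 := (@pi_ge2 R).
have pp : 2 * pi != 0 :> R by rewrite gt_eqF// mulr_gt0// pi_gt0.
move: b50; rewrite ler_norml => /andP[b1 b2].
have h1 : continuous (fun t => f (2 * pi * t + b)).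
  by have := @continuous_trig f id 1 b cf (fun x => @cvg_id _ _); under eq_fun do rewrite mul1r.
have h3 (x : R) : -1 < x -> is_derive x 1 (fun t => (2 * pi)^-1 * F (2 * pi * t + b)) (f (2 * pi * x + b)).
  move=> x1; have h : -100 < 2 * pi * x + b by nra.
  have := derZ (2 * pi)^-1 (@der_comp R F (fun y => 2 * pi * y + b) x _ _ (dF h) (der_aff (2 * pi) b x)).
  by rewrite mulrCA mulVf// mulr1.
have -> := @Ex_unif R _ _ 1 h1 (fun x => f1 _) h3; move=> {h1 h3}.
rewrite mulr1 mulr0 add0r -mulrBr mulrC; congr (_ / _).
have cst u v : -50 <= u -> u <= v -> F (u + 2 * pi) - F u = F (v + 2 * pi) - F v.
  move=> u50 uv; apply: (@der_const R (fun x => F (x + 2 * pi) - F x)) => // x /andP[ux xv].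
  have h1 : -100 < x + 2 * pi by lra.
  have h2 : -100 < x by lra.
  have d1 : is_derive x 1 (fun y => y + 2 * pi : R) 1.
    by have := der_aff 1 (2 * pi) x; under eq_fun do rewrite mul1r.
  apply: der_eq (derB (@der_comp R F (fun y => y + 2 * pi) x _ _ (dF h1) d1) (dF h2)) _.
  by rewrite mulr1 f2pi subrr.
have := cst (-50) b; have := cst (-50) 0; rewrite !add0r (addrC b).
by move=> -> // ->; lra.
Qed.

(** Here F (x + pi) + F x is constant, so the two half periods cancel. *)
Lemma Ex_antiperiodic (b : R) : `|b| <= 50 -> (forall x, f (x + pi) = - f x) ->
  Ex U (fun t => f (2 * pi * t + b)) = 0.
Proof.
move=> b50 fpi; rewrite Ex_periodic//; have p2 := (@pi_ge2 R).
suff : F (0 + pi) + F 0 = F (pi + pi) + F pi.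
  by rewrite add0r (_ : pi + pi = 2 * pi :> R); [move=> h; rewrite (_ : F (2 * pi) - F 0 = 0) ?mul0r//; lra|ring].
apply: (@der_const R (fun x => F (x + pi) + F x)); first exact: pi_ge0.
move=> x /andP[x0 _].
have h1 : -100 < x + pi by lra.
have h2 : -100 < x by lra.
have d1 : is_derive x 1 (fun y => y + pi : R) 1.
  by have := der_aff 1 pi x; under eq_fun do rewrite mul1r.
apply: der_eq (derD (@der_comp R F (fun y => y + pi) x _ _ (dF h1) d1) (dF h2)) _.
by rewrite mulr1 fpi addNr.
Qed.

(** Reduces the Bessel integral to [0, pi/2], where the derivative of the phase u cos x vanishes
    only at 0. *)
Lemma antiderivative_quarter : (forall x, f (x + pi) = f x) -> (forall x, f (- x) = f x) ->
  F (2 * pi) - F 0 = 4 * (F (pi / 2) - F 0).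
Proof.
move=> fpi fN; have p2 := (@pi_ge2 R); have p0 := @pi_ge0 R.
have e1 : F (0 + pi) - F 0 = F (pi + pi) - F pi.
  apply: (@der_const R (fun x => F (x + pi) - F x)) => // x /andP[x0 _].
  have h1 : -100 < x + pi by lra.
  have h2 : -100 < x by lra.
  have d1 : is_derive x 1 (fun y => y + pi : R) 1.
    by have := der_aff 1 pi x; under eq_fun do rewrite mul1r.
  apply: der_eq (derB (@der_comp R F (fun y => y + pi) x _ _ (dF h1) d1) (dF h2)) _.
  by rewrite mulr1 fpi subrr.
have e2 : F ((-1) * 0 + pi) + F 0 = F ((-1) * (pi / 2) + pi) + F (pi / 2).
  apply: (@der_const R (fun x => F ((-1) * x + pi) + F x)); first by lra.
  move=> x /andP[x0 xp].
  have h1 : -100 < (-1) * x + pi by lra.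
  have h2 : -100 < x by lra.
  apply: der_eq (derD (@der_comp R F (fun y => (-1) * y + pi) x _ _ (dF h1) (der_aff (-1) pi x)) (dF h2)) _.
  by rewrite mulN1r fpi fN mulrN1 addNr.
move: e1 e2; rewrite mulr0 !add0r (_ : -1 * (pi / 2) + pi = pi / 2 :> R); last by lra.
rewrite (_ : pi + pi = 2 * pi :> R); last by ring.
lra.
Qed.
End antiderivatives.

Let g (u : R) := fun x : R => cos (u * cos x).
Let gs (u : R) := fun x : R => sin (u * cos x).

Let cg u : continuous (g u).
Proof.
move=> x; apply: (@continuous_comp _ _ _ (fun t : R => u * cos t) cos); last exact: continuous_cos.
by apply: continuousM; [exact: cst_continuous|exact: continuous_cos].
Qed.

Let cgs u : continuous (gs u).
Proof.
move=> x; apply: (@continuous_comp _ _ _ (fun t : R => u * cos t) sin); last exact: continuous_sin.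
by apply: continuousM; [exact: cst_continuous|exact: continuous_cos].
Qed.

Let cos2pi_per (x : R) : cos (x + 2 * pi) = cos x.
Proof. by rewrite (_ : 2 * pi = pi *+ 2 :> R) ?cosD2pi//; ring. Qed.

Lemma bessel_phase (u b : R) : `|b| <= 50 -> Ex U (fun t => cos (u * cos (2 * pi * t + b))) = bessel u.
Proof.
move=> b50; have [F dF] := antiderivative (-100) (@cg u).
have g1 x : `|g u x| <= 1 by exact: cos_max.
have gp x : g u (x + 2 * pi) = g u x by rewrite /g cos2pi_per.
rewrite -/(Ex U (fun t => g u (2 * pi * t + b))) (Ex_periodic (@cg u) g1 dF gp b50).
have := @Ex_periodic (g u) F (@cg u) g1 dF gp 0; rewrite normr0 => <- //.
by rewrite /bessel; congr Ex; apply/funext => t; rewrite addr0.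
Qed.

Lemma bessel_sin (u b : R) : `|b| <= 50 -> Ex U (fun t => sin (u * cos (2 * pi * t + b))) = 0.
Proof.
move=> b50; have [F dF] := antiderivative (-100) (@cgs u).
have g1 x : `|gs u x| <= 1 by exact: sin_max.
have gp x : gs u (x + 2 * pi) = gs u x by rewrite /gs cos2pi_per.
apply: (Ex_antiperiodic (@cgs u) g1 dF gp b50) => x.
by rewrite /gs (@cosDpi R) mulrN sinN.
Qed.

Lemma sin_ge_half (a : R) : 0 <= a <= 1/2 -> a / 2 <= sin a.
Proof.
move=> /andP[a0 a1].
have cosge (x : R) : 0 <= x -> 1 - x <= cos x.
  move=> x0.
  suff : cos 0 + 0 <= cos x + x by rewrite cos0; lra.
  by apply: (@der_mono R (fun y => cos y + y) (fun y => - sin y + 1)) => // y _.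
suff : sin 0 - 2^-1 * 0 <= sin a - 2^-1 * a by rewrite sin0; lra.
apply: (@der_mono R (fun y => sin y - 2^-1 * y) (fun y => cos y - 2^-1 * 1)) => // y /andP[y0 ya].
by have := cosge y y0; lra.
Qed.

(* Van der Corput: on [a, pi/2] the phase [u cos x] has derivative at least
   [u sin a] in modulus and one integration by parts suffices. *)
Lemma bessel_quarter (u a : R) (F : R -> R) : 0 < u -> 0 < a <= 1/2 ->
  (forall x : R, -100 < x -> is_derive x 1 F (g u x)) ->
  `|F (pi / 2) - F 0| <= a + 4 / (u * a).
Proof.
move=> u0 /andP[a0 a2] dF; have p2 := (@pi_ge2 R).
have apos : 0 <= a <= 1/2 by rewrite ltW.
have sa := sin_ge_half apos.
have cosp x : a <= x <= pi / 2 -> 0 <= cos x.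
  by move=> /andP[? ?]; apply: cos_ge0_pihalf; apply/andP; split; lra.
have sinp x : a <= x <= pi / 2 -> 0 < sin x.
  by move=> /andP[? ?]; apply: sin_gt0_pi; apply/andP; split; lra.
(* [G] is the boundary term of the integration by parts and the derivative of [H] dominates the
   remainder. So F - G + H is nondecreasing and F - G - H nonincreasing, which bounds F without
   integrating the remainder. *)
pose G x := - sin (u * cos x) * (u * sin x)^-1.
pose H x := - (u * sin x)^-1.
have dus (x : R) : is_derive x 1 (fun y => u * sin y) (u * cos x).
  by apply: derZ; exact: is_derive_sin.
have uspos x : a <= x <= pi / 2 -> 0 < u * sin x by move=> /sinp ?; exact: mulr_gt0.
have dH (x : R) : a <= x <= pi / 2 -> is_derive x 1 H (cos x / (u * sin x ^+ 2)).
  move=> ax; have us := uspos x ax; have sx := sinp x ax.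
  have := derZ (-1) (@der_inv R (fun y => u * sin y) x _ (lt0r_neq0 us) (dus x)).
  under eq_fun do rewrite mulN1r.
  move=> h; apply: der_eq h _; field.
  by rewrite !gt_eqF.
have dG (x : R) : a <= x <= pi / 2 ->
    is_derive x 1 G (g u x + sin (u * cos x) * (cos x / (u * sin x ^+ 2))).
  move=> ax; have us := uspos x ax; have sx := sinp x ax.
  have d1 : is_derive x 1 (fun y => - sin (u * cos y)) (cos (u * cos x) * (u * sin x)).
    have dc : is_derive x 1 (fun y => u * cos y) (u * - sin x) by apply: derZ; exact: is_derive_cos.
    have := derZ (-1) (der_sin dc); under eq_fun do rewrite mulN1r.
    by move=> h; apply: der_eq h _; ring.
  apply: der_eq (derM d1 (@der_inv R (fun y => u * sin y) x _ (lt0r_neq0 us) (dus x))) _.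
  rewrite /g; field.
  by rewrite !gt_eqF.
have ap2 : a <= pi / 2 by lra.
have h1 : F a - G a + H a <= F (pi / 2) - G (pi / 2) + H (pi / 2).
  apply: (@der_mono R (fun x => F x - G x + H x) (fun x => g u x -
    (g u x + sin (u * cos x) * (cos x / (u * sin x ^+ 2))) + cos x / (u * sin x ^+ 2))) => [|x ax|x ax]; first exact: ap2.
    apply: derD; last exact: dH.
    by apply: derB; [apply: dF; case/andP: ax => ? _; lra|exact: dG].
  have : 0 <= cos x / (u * sin x ^+ 2) by rewrite divr_ge0 ?cosp// mulr_ge0 ?sqr_ge0// ltW.
  by have := sin_le1 (u * cos x); nra.
have h2 : F (pi / 2) - G (pi / 2) - H (pi / 2) <= F a - G a - H a.
  suff : (-1) * (F a - G a - H a) <= (-1) * (F (pi / 2) - G (pi / 2) - H (pi / 2)) by lra.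
  apply: (@der_mono R (fun x => (-1) * (F x - G x - H x)) (fun x => (-1) * (g u x -
    (g u x + sin (u * cos x) * (cos x / (u * sin x ^+ 2))) - cos x / (u * sin x ^+ 2)))) => [|x ax|x ax]; first exact: ap2.
    apply: derZ; apply: derB; last exact: dH.
    by apply: derB; [apply: dF; case/andP: ax => ? _; lra|exact: dG].
  have : 0 <= cos x / (u * sin x ^+ 2) by rewrite divr_ge0 ?cosp// mulr_ge0 ?sqr_ge0// ltW.
  by have := sin_geN1 (u * cos x); nra.
have h3 : `|F a - F 0| <= a.
  have h3a : F 0 + 0 <= F a + a.
    apply: (@der_mono R (fun x => F x + x) (fun x => g u x + 1)) => [|x /andP[? _]|x _]; first exact: ltW.
      by apply: derD => //; apply: dF; lra.
    by have := cos_geN1 (u * cos x); rewrite /g; lra.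
  have h3b : 0 - F 0 <= a - F a.
    apply: (@der_mono R (fun x => x - F x) (fun x => 1 - g u x)) => [|x /andP[? _]|x _]; first exact: ltW.
      by apply: derB => //; apply: dF; lra.
    by have := cos_le1 (u * cos x); rewrite /g; lra.
  by rewrite ler_norml; apply/andP; split; lra.
have aa : a <= a <= pi / 2 by rewrite lexx.
have usa := uspos a aa.
have inva : (u * sin a)^-1 <= 2 / (u * a).
  rewrite -[2 / _]invrK lef_pV2 ?posrE// ?invr_gt0 ?divr_gt0 ?mulr_gt0//.
  by rewrite invf_div -mulrA ler_wpM2l// ltW.
have Ga : `|G a| <= (u * sin a)^-1.
  rewrite normrM normrN [X in _ * X]gtr0_norm ?invr_gt0//.
  by rewrite ler_piMl ?sin_max// invr_ge0 ltW.
have Gp : G (pi / 2) = 0 by rewrite /G cos_pihalf mulr0 sin0 oppr0 mul0r.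
have Hp : H (pi / 2) <= 0 by rewrite /H sin_pihalf mulr1 oppr_le0 invr_ge0 ltW.
have Ha : H a = - (u * sin a)^-1 by [].
have e4 : 4 / (u * a) = 2 / (u * a) + 2 / (u * a) by rewrite -mulrDl; congr (_ / _); lra.
move: h3 Ga; rewrite !ler_norml => /andP[? ?] /andP[? ?].
by apply/andP; split; rewrite e4; lra.
Qed.

(** The cut a = u^(-1/2) balances the two terms of [bessel_quarter] and gives |J_0(u)| <= 5
    u^(-1/2); it is at most 1/2 because u >= 4. The fourth power removes the root, and 625 = 5^4. *)
Lemma bessel_decay (u : R) : 4 <= u -> bessel u ^+ 4 * u ^+ 2 <= 625.
Proof.
move=> u4; have u0 : 0 < u by lra.
have p2 := (@pi_ge2 R).
have [F dF] := antiderivative (-100) (@cg u).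
have g1 x : `|g u x| <= 1 by exact: cos_max.
have gp x : g u (x + 2 * pi) = g u x by rewrite /g cos2pi_per.
have gpi x : g u (x + pi) = g u x by rewrite /g (@cosDpi R) mulrN cosN.
have gN x : g u (- x) = g u x by rewrite /g cosN.
have z50 : `|0 : R| <= 50 by rewrite normr0.
have := Ex_periodic (@cg u) g1 dF gp z50; rewrite (bessel_phase u z50).
rewrite (antiderivative_quarter dF gpi gN) => ->.
pose r := Num.sqrt u; have r2 : r ^+ 2 = u by rewrite sqr_sqrtr// ltW.
have r0 : 0 < r by rewrite sqrtr_gt0.
have r2' : 2 <= r by rewrite -(@ler_pXn2r _ 2) ?nnegrE ?(ltW r0)// r2; lra.
have a1 : 0 < r^-1 <= 1/2.
  by rewrite invr_gt0 r0 mul1r lef_pV2 ?posrE.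
have := bessel_quarter u0 a1 dF.
rewrite (_ : r^-1 + 4 / (u * r^-1) = 5 / r); last first.
  by rewrite -r2; field; rewrite gt_eqF.
set D := F _ - F 0 => hD.
have bound : `|4 * D / (2 * pi)| <= 5 / r.
  rewrite normrM normrM (gtr0_norm (_ : 0 < 4))// (gtr0_norm (_ : 0 < (2 * pi)^-1)); last first.
    by rewrite invr_gt0 mulr_gt0// pi_gt0.
  rewrite ler_pdivrMr ?mulr_gt0 ?pi_gt0//.
  have := normr_ge0 D; have : 0 < 5 / r by rewrite divr_gt0.
  by nra.
have b4 : (4 * D / (2 * pi)) ^+ 4 <= (5 / r) ^+ 4.
  rewrite -[leLHS]ger0_norm ?exprn_even_ge0// normrX lerXn2r ?nnegrE//.
  by rewrite divr_ge0// ltW.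
rewrite -ler_pdivlMr ?exprn_gt0// (le_trans b4)// -r2 le_eqVlt; apply/orP; left; apply/eqP.
by field; rewrite gt_eqF.
Qed.

Lemma bmf_cos_cos (u : R) : bmf ((fun t => cos (u * cos (2 * pi * t))) : measurableTypeR R -> R).
Proof.
apply: (@bmf_continuous _ _ 1); last by move=> x; exact: cos_max.
have := @continuous_trig cos cos u 0 (@continuous_cos R) (@continuous_cos R).
by under eq_fun do rewrite addr0.
Qed.

Lemma bessel_norm (u : R) : `|bessel u| <= 1.
Proof.
apply: le_trans (Ex_norm _ (bmf_cos_cos u)) _; rewrite -[leRHS](Ex_cst U 1); apply: Ex_le.
- have [m [M h]] := bmf_cos_cos u; split; first exact: measurableT_comp.
  by exists M => x; rewrite normr_id.
- exact: bmf_cst.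
- by move=> x; exact: cos_max.
Qed.

Let cos_double (v : R) : cos (2 * v) = 2 * cos v ^+ 2 - 1.
Proof. by rewrite (_ : 2 * v = v *+ 2) ?cos_mulr2n ?mulr_natl; ring. Qed.

(** Pointwise 1 - cos (2 v) = 2 (1 - cos v) (1 + cos v) <= 4 (1 - cos v). This carries lower bounds
    on 1 - J_0 from large arguments down to small ones. *)
Lemma bessel_double (u : R) : 1 - bessel (2 * u) <= 4 * (1 - bessel u).
Proof.
have b1 := bmf_cst (T := measurableTypeR R) (1 : R).
rewrite -[X in X - bessel (2 * u)](Ex_cst U 1) -[X in 4 * (X - _)](Ex_cst U 1).
rewrite /bessel -!ExB//; try exact: bmf_cos_cos.
rewrite -ExZ; last by apply: bmfB => //; exact: bmf_cos_cos.
apply: Ex_le; first by apply: bmfB => //; exact: bmf_cos_cos.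
  by apply: bmfZ; apply: bmfB => //; exact: bmf_cos_cos.
move=> x; rewrite -mulrA cos_double.
by have := cos_le1 (u * cos (2 * pi * x)); nra.
Qed.

(** Cauchy-Schwarz and the duplication formula. An upper bound on J_0(2 u) thus controls |J_0(u)|,
    which also excludes values near -1. *)
Lemma bessel_sqr (u : R) : bessel u ^+ 2 <= (1 + bessel (2 * u)) / 2.
Proof.
apply: le_trans (Ex_sqr _ (bmf_cos_cos u)) _.
have b1 := bmf_cst (T := measurableTypeR R) (1 : R).
rewrite -[X in X + bessel (2 * u)](Ex_cst U 1) /bessel -ExD//; last exact: bmf_cos_cos.
rewrite -ExZr; last by apply: bmfD => //; exact: bmf_cos_cos.
rewrite le_eqVlt; apply/orP; left; apply/eqP; congr Ex; apply/funext => x.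
by rewrite -(mulrA 2 u) cos_double; field.
Qed.

Section large.
Variable K : R.
Hypothesis K30 : 30 * 30 <= K.

Let K0 : 0 < K. Proof. by apply: lt_le_trans K30; rewrite mulr_gt0. Qed.
Let KK : 30 * 30 * (30 * 30) <= K * K.
Proof. by apply: ler_pM => //; rewrite mulr_ge0. Qed.

Lemma bessel_half (u : R) : K <= u -> bessel u <= 1 / 2.
Proof.
move=> u1; have hK := K30; have hKK := KK; have u4 : 4 <= u by lra.
rewrite leNgt; apply/negP => h.
have b2 : 1 / 4 <= bessel u ^+ 2 by nra.
have b4 : 1 / 16 <= bessel u ^+ 4.
  have -> : bessel u ^+ 4 = bessel u ^+ 2 * bessel u ^+ 2 by ring.
  by move: (bessel u ^+ 2) b2 => B b2; nra.
have uu : K * K <= u ^+ 2 by rewrite expr2; apply: ler_pM => //; exact: ltW.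
have : 1 / 16 * (K * K) <= bessel u ^+ 4 * u ^+ 2.
  by apply: ler_pM; rewrite ?divr_ge0 ?mulr_ge0 ?(ltW K0).
by have := bessel_decay u4; lra.
Qed.

(** The argument is doubled until it lies between K and 2 K, where J_0 <= 1/2. Each doubling
    multiplies u^2 by 4 and 1 - J_0 by at most 4. *)
Lemma bessel_small (u : R) : 0 < u <= 2 * K -> u ^+ 2 / (8 * K ^+ 2) <= 1 - bessel u.
Proof.
move=> /andP[u0 u1]; have K2 : 0 < 2 * K by rewrite mulr_gt0.
have K8 : 0 < 8 * K ^+ 2 by rewrite mulr_gt0// exprn_gt0.
have : 0 < u / (2 * K) <= 1 by rewrite divr_gt0//= ler_pdivrMr// mul1r.
move=> /dyadic_scale[n]; elim: n u u0 {u1} => [|n IH] u u0 /andP[h1 h2].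
  have b : bessel u <= 1 / 2.
    by apply: bessel_half; move: h1; rewrite expr1 ltr_pdivlMr// mulrA mulVf// mul1r => /ltW.
  have uK : u <= 2 * K by move: h2; rewrite expr0 invr1 ler_pdivrMr// mul1r.
  have : u ^+ 2 <= (2 * K) ^+ 2 by rewrite ler_pXn2r// ?nnegrE ltW.
  rewrite exprMn ler_pdivrMr// => h.
  have : 1 / 2 * (8 * K ^+ 2) <= (1 - bessel u) * (8 * K ^+ 2).
    by rewrite ler_wpM2r ?(ltW K8)//; lra.
  by lra.
have u20 : 0 < 2 * u by rewrite mulr_gt0.
have := IH _ u20.
have e k : 2 ^- k.+1 = 2^-1 * 2 ^- k :> R by rewrite exprS invfM.
move: h1 h2; rewrite (e n.+1) (e n) => h1 h2.
have := bessel_double u; move: (bessel (2 * u)) (bessel u) => B b hB.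
have h3 : 2^-1 * 2 ^- n < 2 * u / (2 * K) <= 2 ^- n by rewrite -mulrA; apply/andP; split; lra.
move=> /(_ h3); rewrite exprMn !ler_pdivrMr// => h4.
have : (1 - B) * (8 * K ^+ 2) <= 4 * (1 - b) * (8 * K ^+ 2) by rewrite ler_wpM2r// ltW.
by lra.
Qed.

(** With k = u^2 / (8 K^2): for u <= K, J_0(u)^2 <= 1 - 2 k and (1 - 2 k) (1 + k) <= 1. For larger u
    the decay of J_0^4 holds up to the factor 625 only; the eighth power absorbs it. *)
Lemma bessel_bound (u : R) : 0 <= u -> bessel u ^+ 8 * (1 + u ^+ 2 / (8 * K ^+ 2)) <= 1.
Proof.
have K8 : 0 < 8 * K ^+ 2 by rewrite mulr_gt0// exprn_gt0.
rewrite le_eqVlt => /predU1P[<-|u0].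
  rewrite expr0n /= mul0r addr0 mulr1 -[leLHS]ger0_norm ?exprn_even_ge0// normrX.
  by rewrite exprn_ile1// bessel_norm.
have b8 : bessel u ^+ 8 = bessel u ^+ 2 * bessel u ^+ 6 by rewrite -exprD.
have b1 : bessel u ^+ 2 <= 1.
  by rewrite -(real_normK (num_real _)) exprn_ile1// bessel_norm.
have b0 : 0 <= bessel u ^+ 2 by exact: sqr_ge0.
set k := u ^+ 2 / (8 * K ^+ 2).
have k0 : 0 <= k by rewrite divr_ge0 ?sqr_ge0// ltW.
have [ul|ul] := leP u K.
  have b82 : bessel u ^+ 8 <= bessel u ^+ 2.
    by rewrite b8 (_ : 6%N = (2 * 3)%N)// exprM ler_piMr// exprn_ile1.
  have h2u : 0 < 2 * u <= 2 * K by rewrite mulr_gt0//= ler_pM2l.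
  have := bessel_small h2u; have := bessel_sqr u.
  rewrite (_ : (2 * u) ^+ 2 / _ = 4 * k); last by rewrite /k exprMn mulrA -natrX.
  move=> s1 s2; have b2 : bessel u ^+ 2 <= 1 - 2 * k by lra.
  have fin (B8 B2 c : R) : B2 <= 1 - 2 * c -> 0 <= B2 -> B8 <= B2 -> 0 <= c -> B8 * (1 + c) <= 1.
    by move=> *; nra.
  exact: fin b2 b0 b82 k0.
have hK := K30; have hKK := KK; have u4 : 4 <= u by lra.
have := bessel_decay u4; rewrite (_ : bessel u ^+ 8 = bessel u ^+ 4 * bessel u ^+ 4); last by rewrite -exprD.
have uu : K * K <= u ^+ 2 by rewrite expr2; apply: ler_pM; rewrite ?(ltW K0) ?(ltW ul).
have kV : k <= u ^+ 2 / 8.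
  rewrite /k ler_wpM2l ?sqr_ge0// lef_pV2 ?posrE//.
  by rewrite ler_peMr// expr2; lra.
have : 0 <= bessel u ^+ 4 by rewrite exprn_even_ge0.
clearbody k; move: (bessel u ^+ 4) (u ^+ 2) uu kV k0 => B V uu kV k0 hB hBV.
(* This is 625^2 <= u^2, so the square of [bessel_decay] gives J_0(u)^8 u^2 <= 1. *)
have V1 : 25 * 25 * (25 * 25) <= V by lra.
have BV0 : 0 <= B * V by rewrite mulr_ge0//; lra.
have BB : (B * V) * (B * V) <= 25 * 25 * (25 * 25).
  by apply: ler_pM => //; lra.
have V0 : 0 < V by lra.
have step : B * B * V <= 1.
  rewrite -(ler_pM2r V0) mul1r; apply: le_trans V1; apply: le_trans BB.
  by rewrite le_eqVlt; apply/orP; left; apply/eqP; ring.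
have BB0 : 0 <= B * B by rewrite mulr_ge0.
have : B * B * (1 + k) <= B * B * V by rewrite ler_wpM2l//; lra.
lra.
Qed.
End large.

Lemma bessel_bound_ex : exists2 k : R, 0 < k & forall u, 0 <= u -> bessel u ^+ 8 * (1 + k * u ^+ 2) <= 1.
Proof.
exists (8 * (30 * 30 : R) ^+ 2)^-1; first by rewrite invr_gt0 mulr_gt0// exprn_gt0// mulr_gt0.
by move=> u u0; rewrite [_^-1 * _]mulrC; exact: (bessel_bound (lexx _)).
Qed.
End bessel.

(** * Sums of independent trigonometric terms *)

Section independence.
Context d {T : measurableType d} {R : realType} (P : probability T R).
Variable theta : nat -> {RV P >-> R}.
Hypothesis theta_indep : mutually_independent theta.
Hypothesis theta_unif : forall n, uniform01 (theta n).
Local Notation V := (measurableTypeR R).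

Lemma theta_measurable n : measurable_fun [set: T] (theta n : T -> V).
Proof. exact: (@measurable_funPT _ _ _ _ (theta n)). Qed.

Lemma measurable_thetaE n (B : set R) : measurable B -> measurable (theta n @^-1` B).
Proof. by move=> mB; rewrite -[X in measurable X]setTI; exact: theta_measurable. Qed.

Variable g : nat -> R -> R.
Hypothesis g_cont : forall i, continuous (g i).

Definition indep_partial_sum n w : V := \sum_(i < n) g i (theta i w).
Local Notation F := indep_partial_sum.

Lemma measurable_g i : measurable_fun [set: V] (g i : V -> V).
Proof. exact: continuous_measurable_fun. Qed.

Lemma indep_partial_sum_measurable n : measurable_fun [set: T] (F n).
Proof.
elim: n => [|n IH].
  rewrite (_ : F 0 = fun=> 0); first exact: measurable_cst.
  by apply/funext => w; rewrite /indep_partial_sum big_ord0.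
rewrite (_ : F n.+1 = fun w => F n w + g n (theta n w)); last first.
  by apply/funext => w; rewrite /indep_partial_sum big_ord_recr.
apply: measurable_funD => //; apply: measurableT_comp; first exact: measurable_g.
exact: theta_measurable.
Qed.

Let pair n w : V * V := (F n w, theta n w).

Let mpair n : measurable_fun [set: T] (pair n).
Proof.
apply: measurable_fun_pair; first exact: indep_partial_sum_measurable.
exact: theta_measurable.
Qed.

Let law n : probability V R := distribution P (mfun_Sub (mem_set (indep_partial_sum_measurable n))).

Definition indep_of_sum n (E : set T) := forall A B : set V, measurable A -> measurable B ->
  P ((F n @^-1` A `&` theta n @^-1` B) `&` E) = (P (F n @^-1` A) * (unif B * P E))%E.

(** The restriction of [P] to [E], pushed forward by the pair, agrees with a product measure on
    rectangles, hence on all measurable sets. *)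
Lemma indep_of_sum_prod n E : measurable E -> indep_of_sum n E ->
  forall X : set (V * V), measurable X ->
  P (pair n @^-1` X `&` E) = (P E * (law n \x @unif R) X)%E.
Proof.
move=> mE hE X mX.
have fE : P E \is a fin_num by exact: fin_num_measure.
have r0 : 0 <= fine (P E) by rewrite fine_ge0.
pose r := NngNum r0.
pose m2 : {sigma_finite_measure set V -> \bar R} := mscale r (@unif R).
have m2E B : m2 B = (P E * @unif R B)%E by rewrite -[in RHS](fineK fE).
pose m' : measure (V * V)%type R :=
  @measure_function_pushforward__canonical__measure_function_Measure
    _ _ T (V * V)%type R (mrestr P mE) (pair n) (mpair n).
have -> : P (pair n @^-1` X `&` E) = m' X by [].
have <- : (law n \x m2)%E X = m' X.
  apply: product_measure_unique => // A B mA mB.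
  transitivity (P (((F n @^-1` A) `&` (theta n @^-1` B)) `&` E)) => //.
  by rewrite hE// m2E [X in (_ * X)%E]muleC.
rewrite /product_measure1 /= -ge0_integralZl//.
  by apply: eq_integral => x _ /=; rewrite m2E.
  by apply: measurable_fun_xsection.
Qed.

Definition sum_indep_future n := forall (A : set V) (I : seq nat) (B : nat -> set R), measurable A ->
  uniq I -> (forall i, i \in I -> (n <= i)%N) -> (forall i, measurable (B i)) ->
  P (F n @^-1` A `&` \big[setI/setT]_(i <- I) (theta i @^-1` B i)) =
  (P (F n @^-1` A) * \prod_(i <- I) P (theta i @^-1` B i))%E.

Lemma measurable_future (I : seq nat) (B : nat -> set R) : (forall i, measurable (B i)) ->
  measurable (\big[setI/setT]_(i <- I) (theta i @^-1` B i)).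
Proof.
by move=> mB; apply: big_ind => //; [exact: measurableI|move=> i _; exact: measurable_thetaE].
Qed.

Lemma unifE n (B : set R) : measurable B -> P (theta n @^-1` B) = unif B.
Proof. by move=> mB; exact: (theta_unif n mB). Qed.

Lemma sum_indep_step n I (B : nat -> set R) : sum_indep_future n -> uniq I ->
  (forall i, i \in I -> (n < i)%N) -> (forall i, measurable (B i)) ->
  indep_of_sum n (\big[setI/setT]_(i <- I) (theta i @^-1` B i)).
Proof.
move=> IH uI nI mB A C mA mC.
pose B' i := if i == n then C else B i.
have mB' i : measurable (B' i) by rewrite /B'; case: ifP => _; [exact: mC|exact: mB].
have nnI : n \notin I by apply/negP => /nI; rewrite ltnn.
have uI' : uniq (n :: I) by rewrite /= nnI.
have nI' i : i \in n :: I -> (n <= i)%N.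
  by rewrite inE => /predU1P[->//|/nI/ltnW].
have bE : \big[setI/setT]_(i <- I) (theta i @^-1` B' i) = \big[setI/setT]_(i <- I) (theta i @^-1` B i).
  by apply: eq_big_seq => i iI; rewrite /B' ifF//; apply/negbTE; apply: contraNneq nnI => <-.
have := IH A (n :: I) B' mA uI' nI' mB'.
rewrite !big_cons bE {1}/B' eqxx setIA => ->.
rewrite {1}/B' eqxx unifE//; congr (_ * (_ * _))%E.
by rewrite -bE theta_indep.
Qed.

(** An event about the next partial sum is an event about the pair of the current sum and angle. The
    product formula, used once with the future event and once with the full space, gives the
    factorisation. *)
Lemma sum_indepP n : sum_indep_future n.
Proof.
elim: n => [|n IH] A I B mA uI nI mB.
  have F0 w : F 0 w = 0 by rewrite /indep_partial_sum big_ord0.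
  have [A0|nA0] := pselect (A 0).
    rewrite (_ : F 0 @^-1` A = setT); last by apply/seteqP; split=> w //= _; rewrite F0.
    rewrite setTI probability_setT mul1e; exact: theta_indep.
  rewrite (_ : F 0 @^-1` A = set0); last by apply/seteqP; split=> w //=; rewrite F0.
  by rewrite set0I measure0 mul0e.
set E := \big[_/_]_(_ <- _) _.
have mE : measurable E by exact: measurable_future.
pose X : set (V * V) := [set z | A (z.1 + g n z.2)].
have mX : measurable X.
  have mf : measurable_fun [set: V * V] (fun z : V * V => z.1 + g n z.2 : V).
    apply: measurable_funD; first exact: measurable_fst.
    by apply: measurableT_comp; [exact: measurable_g|exact: measurable_snd].
  by have := mf measurableT A mA; rewrite setTI.
have XE : F n.+1 @^-1` A = pair n @^-1` X.
  by apply/seteqP; split=> w /=; rewrite /X /= /indep_partial_sum big_ord_recr.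
have iE : indep_of_sum n E by exact: (sum_indep_step IH uI nI mB).
have iT : indep_of_sum n setT.
  have := @sum_indep_step n [::] (fun=> setT) IH isT; rewrite big_nil => hT.
  by apply: hT => // i; exact: measurableT.
rewrite XE (indep_of_sum_prod mE iE mX).
have := indep_of_sum_prod measurableT iT mX; rewrite setIT probability_setT mul1e => ->.
by rewrite muleC theta_indep.
Qed.

(** Integrates out the n-th angle while the earlier ones stay fixed; the product formulas for
    characteristic functions and exponential moments rest on it. *)
Lemma freeze n (h : V * V -> R) : bmf h ->
  Ex P (fun w => h (F n w, theta n w)) = Ex P (fun w => Ex (@unif R) (fun v => h (F n w, v))).
Proof.
move=> bh; have [mh [M hM]] := bh.
have bP : bmf (fun w => h (F n w, theta n w)).
  split; last by exists M => w.
  exact: (measurableT_comp mh (mpair n)).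
have b2 : bmf (fun z => h z + M) by apply: bmfD => //; exact: bmf_cst.
have bPP : bmf (fun w => h (F n w, theta n w) + M) by apply: bmfD => //; exact: bmf_cst.
have bI : bmf (fun y => Ex (@unif R) (fun v => h (y, v))) by exact: bmf_Ex2.
have bI2 : bmf (fun y => Ex (@unif R) (fun v => h (y, v) + M)) by exact: (bmf_Ex2 _ b2).
have bIP : bmf (fun w => Ex (@unif R) (fun v => h (F n w, v))).
  split; last by case: bI => _ [N hN]; exists N.
  exact: (measurableT_comp bI.1 (indep_partial_sum_measurable n)).
have bIP2 : bmf (fun w => Ex (@unif R) (fun v => h (F n w, v) + M)).
  split; last by case: bI2 => _ [N hN]; exists N.
  exact: (measurableT_comp bI2.1 (indep_partial_sum_measurable n)).
suff : Ex P (fun w => h (F n w, theta n w) + M) = Ex P (fun w => Ex (@unif R) (fun v => h (F n w, v) + M)).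
  rewrite ExD//; last exact: bmf_cst.
  have -> : (fun w => Ex (@unif R) (fun v => h (F n w, v) + M)) =
            (fun w => Ex (@unif R) (fun v => h (F n w, v)) + M).
    apply/funext => w; rewrite ExD ?Ex_cst//; [exact: bmf_pair1|exact: bmf_cst].
  rewrite ExD//; last exact: bmf_cst.
  by rewrite Ex_cst; exact: addIr.
have h0 z : 0 <= h z + M by have := hM z; rewrite ler_norml; lra.
apply: EFin_inj; rewrite (EFin_Ex _ bPP) (EFin_Ex _ bIP2).
pose H z := (h z + M)%:E.
have mH : measurable_fun setT H by apply/measurable_EFinP; exact: b2.1.
have iT : indep_of_sum n setT.
  have := @sum_indep_step n [::] (fun=> setT) (@sum_indepP n) isT; rewrite big_nil => hT.
  by apply: hT => // i; exact: measurableT.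
pose m' : measure (V * V)%type R :=
  @measure_function_pushforward__canonical__measure_function_Measure _ _ T (V * V)%type R P (pair n) (mpair n).
transitivity (\int[m']_z H z)%E.
  by rewrite (ge0_integral_pushforward (mpair n))// => z _; rewrite lee_fin.
transitivity (\int[(law n \x @unif R)%E]_z H z)%E.
  apply: eq_measure_integral => X mX _.
  have := indep_of_sum_prod measurableT iT mX; rewrite setIT probability_setT mul1e => e.
  exact: e.
rewrite fubini_tonelli1//.
rewrite /fubini_F /law ge0_integral_pushforward//=; last 3 first.
- exact: indep_partial_sum_measurable.
- exact: measurable_fun_fubini_tonelli_F.
- by move=> y _; apply: integral_ge0 => z _; rewrite lee_fin.
apply: eq_integral => w _ /=.
by rewrite EFin_Ex//; exact: (bmf_pair1 (F n w) b2).
Qed.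
End independence.

(** * Characteristic functions and exponential moments of trigonometric sums *)

Section trig_sums.
Context d {T : measurableType d} {R : realType} (P : probability T R).
Variable theta : nat -> {RV P >-> R}.
Hypothesis theta_indep : mutually_independent theta.
Hypothesis theta_unif : forall n, uniform01 (theta n).
Local Notation V := (measurableTypeR R).
Local Notation U := (@unif R).

Definition trig_term (A B : nat -> R) i (t : R) : R := A i * cos (2 * pi * t) + B i * sin (2 * pi * t).
Definition trig_sum A B n w : R := \sum_(i < n) trig_term A B i (theta i w).
Definition amp (A B : nat -> R) i : R := Num.sqrt (A i ^+ 2 + B i ^+ 2).

Lemma continuous_trig_term A B i : continuous (trig_term A B i).
Proof.
have c := @continuous_trig R id cos (A i) 0 (fun x => @cvg_id _ _) (@continuous_cos R).
have s := @continuous_trig R id sin (B i) 0 (fun x => @cvg_id _ _) (@continuous_sin R).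
move: c s; under eq_fun do rewrite addr0; move=> c; under eq_fun do rewrite addr0.
by move=> s x; exact: (continuousD (c x) (s x)).
Qed.

(** The phase is acos (A / amp) up to sign, at most pi in modulus, so the phase lemmas for means
    over a period apply to it. *)
Lemma trig_term_polar A B i : exists2 b : R, `|b| <= 50 &
  forall t, trig_term A B i t = amp A B i * cos (2 * pi * t + b).
Proof.
rewrite /trig_term /amp; move: (A i) (B i) => a b {A B}.
set r := Num.sqrt _.
have ab0 : 0 <= a ^+ 2 + b ^+ 2 by rewrite addr_ge0 ?sqr_ge0.
have r2 : r ^+ 2 = a ^+ 2 + b ^+ 2 by rewrite sqr_sqrtr.
have r0 : 0 <= r by exact: sqrtr_ge0.
have [re|rN] := eqVneq r 0.
  have : a ^+ 2 + b ^+ 2 == 0 by rewrite -r2 re expr0n.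
  rewrite paddr_eq0 ?sqr_ge0// !sqrf_eq0 => /andP[/eqP -> /eqP ->].
  by exists 0; rewrite ?normr0// => t; rewrite re !mul0r addr0.
have rp : 0 < r by rewrite lt_neqAle eq_sym rN.
have ar : -1 <= a / r <= 1.
  rewrite ler_pdivlMr// ler_pdivrMr// mulN1r mul1r -ler_norml.
  rewrite -(@ler_pXn2r _ 2) ?nnegrE// real_normK ?num_real// r2.
  by rewrite lerDl sqr_ge0.
have ap : acos (a / r) <= 4 by apply: (le_trans (acos_lepi ar)); rewrite ltW// pi_lt4.
have a0 := acos_ge0 ar.
have ca : r * cos (acos (a / r)) = a by rewrite acosK ?in_itv//= mulrC divfK.
have sa : r * sin (acos (a / r)) = `|b|.
  rewrite sin_acos// -[X in X * _](ger0_norm r0) -sqrtr_sqr -sqrtrM ?sqr_ge0//.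
  rewrite mulrBr mulr1 expr_div_n mulrCA mulfV ?mulr1; last by rewrite sqrf_eq0.
  by rewrite r2 addrAC subrr add0r sqrtr_sqr.
have [b0|b0] := leP b 0.
  exists (acos (a / r)); first by rewrite ger0_norm//; apply: (le_trans ap); lra.
  move=> t; rewrite cosD mulrBr !(mulrCA r) ca sa ler0_norm//; ring.
exists (- acos (a / r)); first by rewrite normrN ger0_norm//; apply: (le_trans ap); lra.
move=> t; rewrite cosD cosN sinN mulrBr !(mulrCA r) mulrN ca sa gtr0_norm//; ring.
Qed.

Lemma Ex_cos_term A B i : Ex U (fun t => cos (trig_term A B i t)) = bessel (amp A B i).
Proof.
have [b b50 h] := trig_term_polar A B i; rewrite -(bessel_phase _ b50).
by congr Ex; apply/funext => t; rewrite h.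
Qed.

Lemma Ex_sin_term A B i : Ex U (fun t => sin (trig_term A B i t)) = 0.
Proof.
have [b b50 h] := trig_term_polar A B i; rewrite -[RHS](bessel_sin (amp A B i) b50).
by congr Ex; apply/funext => t; rewrite h.
Qed.

Lemma trig_sum_measurable A B n : measurable_fun [set: T] (trig_sum A B n).
Proof.
exact: (indep_partial_sum_measurable theta (@continuous_trig_term A B) n).
Qed.

Lemma bmf_cos (f : T -> R) : measurable_fun [set: T] f -> bmf (fun w => cos (f w)).
Proof. by move=> mf; apply: (@bmf_comp _ _ _ cos _ 1) => //; [exact: continuous_cos|exact: cos_max]. Qed.

Lemma bmf_cos_term A B i : bmf ((fun t => cos (trig_term A B i t)) : V -> R).
Proof.
apply: (@bmf_comp _ _ _ cos _ 1); [exact: continuous_cos|exact: cos_max|].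
exact: continuous_measurable_fun (@continuous_trig_term A B i).
Qed.

Lemma bmf_sin_term A B i : bmf ((fun t => sin (trig_term A B i t)) : V -> R).
Proof.
apply: (@bmf_comp _ _ _ sin _ 1); [exact: continuous_sin|exact: sin_max|].
exact: continuous_measurable_fun (@continuous_trig_term A B i).
Qed.

(** The sine of each term has mean zero, so the addition formula for the cosine reduces to a
    product. *)
Lemma Ex_cos_trig_sum A B n : Ex P (fun w => cos (trig_sum A B n w)) = \prod_(i < n) bessel (amp A B i).
Proof.
elim: n => [|n IH].
  rewrite big_ord0 -[RHS](Ex_cst P 1); congr Ex; apply/funext => w.
  by rewrite /trig_sum big_ord0 cos0.
rewrite big_ord_recr /= -IH.
pose h (z : V * V) : R := cos (z.1 + trig_term A B n z.2).
have bh : bmf h.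
  apply: (@bmf_comp _ _ _ cos _ 1); [exact: continuous_cos|exact: cos_max|].
  apply: measurable_funD; first exact: measurable_fst.
  apply: (measurableT_comp (f := trig_term A B n : V -> V)); last exact: measurable_snd.
  exact: continuous_measurable_fun (@continuous_trig_term A B n).
transitivity (Ex P (fun w => h (trig_sum A B n w, theta n w))).
  by congr Ex; apply/funext => w; rewrite /trig_sum big_ord_recr.
rewrite (freeze theta_indep theta_unif (@continuous_trig_term A B) n bh).
rewrite -ExZr; last exact: bmf_cos (trig_sum_measurable A B n).
congr Ex; apply/funext => w; rewrite /h /= -/(trig_sum A B n w).
under eq_fun do rewrite cosD.
rewrite ExB; last 2 first.
- by apply: bmfZ; exact: bmf_cos_term.
- by apply: bmfZ; exact: bmf_sin_term.
rewrite !ExZ; [|exact: bmf_sin_term|exact: bmf_cos_term].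
by rewrite Ex_cos_term Ex_sin_term mulr0 subr0.
Qed.

(** The linear term has mean zero for a cosine with random phase, which leaves a subgaussian
    factor. *)
Lemma expR_le_quad (x : R) : expR x <= x + expR (2 * x ^+ 2).
Proof.
have h2 : 1 + 2 * x ^+ 2 <= expR (2 * x ^+ 2) by exact: expR_ge1Dx.
have [x0|x0] := leP x 0.
  have : expR x <= 1 / (1 - x).
    rewrite ler_pdivlMr; last by lra.
    have := expR_ge1Dx (- x) => h; apply: (@le_trans _ _ (expR x * expR (- x))).
      by rewrite ler_wpM2l// ltW// expR_gt0.
    by rewrite expRxMexpNx_1.
  have : 1 / (1 - x) <= 1 + x + x ^+ 2.
    rewrite ler_pdivrMr; last by lra.
    have : 0 <= - x * x ^+ 2 by rewrite mulr_ge0 ?sqr_ge0 ?oppr_ge0.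
    by lra.
  by have := sqr_ge0 x; lra.
have [x1|x1] := leP x 1; last first.
  have : expR x <= expR (2 * x ^+ 2) by rewrite ler_expR; nra.
  lra.
have hx : expR (x / 2) <= 1 / (1 - x / 2).
  rewrite ler_pdivlMr; last by lra.
  have := expR_ge1Dx (- (x / 2)) => h; apply: (@le_trans _ _ (expR (x / 2) * expR (- (x / 2)))).
    by rewrite ler_wpM2l// ?ltW ?expR_gt0//; lra.
  by rewrite expRxMexpNx_1.
have e0 : 0 <= expR (x / 2) by rewrite ltW// expR_gt0.
have : expR x <= (1 / (1 - x / 2)) ^+ 2.
  rewrite (_ : expR x = expR (x / 2) ^+ 2); last first.
    by rewrite expr2 -expRD; congr expR; lra.
  by rewrite ler_pXn2r// nnegrE//; apply: le_trans hx.
have : (1 / (1 - x / 2)) ^+ 2 <= 1 + x + 2 * x ^+ 2.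
  rewrite expr_div_n expr1n ler_pdivrMr; last by rewrite exprn_gt0//; lra.
  have : 0 <= x ^+ 2 * ((1 - x) * (5 / 2 - x)) by rewrite mulr_ge0 ?sqr_ge0// mulr_ge0//; lra.
  lra.
lra.
Qed.

Lemma Ex_cos_phase (b : R) : `|b| <= 50 -> Ex U (fun t => cos (2 * pi * t + b)) = 0.
Proof.
move=> b50; apply: (@Ex_antiperiodic R cos sin) => //.
- exact: continuous_cos.
- exact: cos_max.
- by move=> x; rewrite (_ : 2 * pi = pi *+ 2 :> R) ?cosD2pi//; ring.
- by move=> x; exact: cosDpi.
Qed.

Lemma continuous_exp_term A B i : continuous (fun t => expR (trig_term A B i t)).
Proof.
move=> x; apply: (@continuous_comp _ _ _ (trig_term A B i) (@expR R)); last exact: continuous_expR.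
exact: continuous_trig_term.
Qed.

Lemma trig_term_le A B i t : `|trig_term A B i t| <= amp A B i.
Proof.
have [b b50 h] := trig_term_polar A B i; rewrite h normrM (ger0_norm (sqrtr_ge0 _)).
by rewrite ler_piMr ?cos_max ?sqrtr_ge0.
Qed.

Lemma Ex_exp_term A B i : Ex U (fun t => expR (trig_term A B i t)) <= expR (2 * amp A B i ^+ 2).
Proof.
have [b b50 h] := trig_term_polar A B i; set r := amp A B i.
have bc : bmf ((fun t => cos (2 * pi * t + b)) : V -> R).
  apply: (@bmf_continuous _ _ 1); last by move=> x; exact: cos_max.
  have := @continuous_trig R id cos 1 b (fun x => @cvg_id _ _) (@continuous_cos R).
  by under eq_fun do rewrite mul1r.
have be : bmf ((fun t => expR (trig_term A B i t)) : V -> R).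
  apply: (@bmf_continuous _ _ (expR r)); first exact: continuous_exp_term.
  move=> x; rewrite ger0_norm ?expR_ge0// ler_expR.
  by apply: le_trans (trig_term_le A B i x); exact: ler_norm.
have b1 := bmf_cst (T := V) (expR (2 * r ^+ 2)).
have -> : expR (2 * r ^+ 2) = Ex U (fun t => r * cos (2 * pi * t + b) + expR (2 * r ^+ 2)).
  rewrite ExD//; last exact: bmfZ.
  by rewrite ExZ// Ex_cos_phase// mulr0 add0r Ex_cst.
apply: Ex_le => //; first by apply: bmfD => //; exact: bmfZ.
move=> t; rewrite h; apply: (le_trans (expR_le_quad _)).
rewrite lerD2l ler_expR ler_wpM2l// -(real_normK (num_real (_ * _))) ler_pXn2r ?nnegrE ?sqrtr_ge0//.
by rewrite -/r -h; exact: trig_term_le.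
Qed.

Definition amp_sum A B n : R := \sum_(i < n) amp A B i.

Lemma trig_sum_le A B n w : `|trig_sum A B n w| <= amp_sum A B n.
Proof.
apply: le_trans (ler_norm_sum _ _ _) _; apply: ler_sum => i _; exact: trig_term_le.
Qed.

Lemma bmf_exp_trig_sum A B n : bmf (fun w => expR (trig_sum A B n w)).
Proof.
split.
  apply: (measurableT_comp (f := @expR R : R -> R)); last exact: trig_sum_measurable.
  by apply: continuous_measurable_fun; exact: continuous_expR.
exists (expR (amp_sum A B n)) => w; rewrite ger0_norm ?expR_ge0// ler_expR.
by apply: le_trans (trig_sum_le A B n w); exact: ler_norm.
Qed.

Lemma Ex_exp_trig_sum A B n : Ex P (fun w => expR (trig_sum A B n w)) <=
  expR (2 * \sum_(i < n) amp A B i ^+ 2).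
Proof.
elim: n => [|n IH].
  rewrite big_ord0 mulr0 expR0 -[leRHS](Ex_cst P 1) le_eqVlt; apply/orP; left; apply/eqP.
  by congr Ex; apply/funext => w; rewrite /trig_sum big_ord0 expR0.
set M := amp_sum A B n.
(* [freeze] requires a bounded function. Truncating the first coordinate at the deterministic bound
   of the partial sum does not change its values along that sum. *)
pose h (z : V * V) : R := expR (Num.max (- M) (Num.min M z.1)) * expR (trig_term A B n z.2).
have clip (y : R) : `|y| <= M -> Num.max (- M) (Num.min M y) = y.
  by rewrite ler_norml => /andP[h1 h2]; rewrite (min_idPr h2) (max_idPr h1).
have bh : bmf h.
  apply: bmfM.
    split.
      apply: (measurableT_comp (f := @expR R : V -> V)).
        by apply: continuous_measurable_fun; exact: continuous_expR.
      apply: measurable_maxr; first exact: measurable_cst.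
      by apply: measurable_minr; [exact: measurable_cst|exact: measurable_fst].
    exists (expR M) => z; rewrite ger0_norm ?expR_ge0// ler_expR ge_max ge_min lexx andbT.
    by rewrite -subr_ge0 opprK addr_ge0// /M /amp_sum sumr_ge0// => i _; exact: sqrtr_ge0.
  split.
    apply: (measurableT_comp (f := (fun t => expR (trig_term A B n t)) : V -> V)); last exact: measurable_snd.
    exact: continuous_measurable_fun (@continuous_exp_term A B n).
  exists (expR (amp A B n)) => z; rewrite ger0_norm ?expR_ge0// ler_expR.
  by apply: le_trans (trig_term_le A B n z.2); exact: ler_norm.
have -> : Ex P (fun w => expR (trig_sum A B n.+1 w)) = Ex P (fun w => h (trig_sum A B n w, theta n w)).
  congr Ex; apply/funext => w; rewrite /h /= clip ?trig_sum_le//.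
  by rewrite -expRD /trig_sum big_ord_recr.
rewrite (freeze theta_indep theta_unif (@continuous_trig_term A B) n bh).
have be : bmf ((fun t => expR (trig_term A B n t)) : V -> R).
  apply: (@bmf_continuous _ _ (expR (amp A B n))); first exact: continuous_exp_term.
  move=> x; rewrite ger0_norm ?expR_ge0// ler_expR.
  by apply: le_trans (trig_term_le A B n x); exact: ler_norm.
have -> : (fun w => Ex U (fun v => h (indep_partial_sum theta (trig_term A B) n w, v))) =
   (fun w => expR (trig_sum A B n w) * Ex U (fun v => expR (trig_term A B n v))).
  by apply/funext => w; rewrite /h /= clip ?trig_sum_le// ExZ.
rewrite ExZr; last exact: bmf_exp_trig_sum.
rewrite big_ord_recr /= mulrDr expRD; apply: ler_pM => //.
- by apply: Ex_ge0 => w; exact: expR_ge0.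
- by apply: Ex_ge0 => w; exact: expR_ge0.
- exact: Ex_exp_term.
Qed.

Lemma trig_sum_tail A B n (W v : R) : 0 < W -> 0 <= v -> \sum_(i < n) amp A B i ^+ 2 <= W ->
  (P [set w | (v <= trig_sum A B n w)%R] <= (expR (- (v ^+ 2 / (8 * W))))%:E)%E.
Proof.
(* The minimiser of 2 l^2 W - l v, the exponent in Chernoff's bound. *)
move=> W0 v0 sW; pose l := v / (4 * W).
have l0 : 0 <= l by rewrite divr_ge0// mulr_ge0// ltW.
pose A' i := l * A i; pose B' i := l * B i.
have sE w : trig_sum A' B' n w = l * trig_sum A B n w.
  rewrite /trig_sum mulr_sumr; apply: eq_bigr => i _; rewrite /trig_term /A' /B'; ring.
have aE i : amp A' B' i ^+ 2 = l ^+ 2 * amp A B i ^+ 2.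
  rewrite !sqr_sqrtr ?addr_ge0 ?sqr_ge0// /A' /B'; ring.
have mA : measurable [set w | v <= trig_sum A B n w].
  rewrite (_ : [set w | _] = trig_sum A B n @^-1` `[v, +oo[); last first.
    by apply/seteqP; split=> w /=; rewrite in_itv /= andbT.
  by rewrite -[X in measurable X]setTI; apply: trig_sum_measurable => //; exact: measurable_itv.
pose f w := expR (- (l * v)) * expR (trig_sum A' B' n w).
have bf : bmf f by apply: bmfZ; exact: bmf_exp_trig_sum.
apply: le_trans (Ex_markov P mA bf _ _) _.
- by move=> w; rewrite mulr_ge0 ?expR_ge0.
- move=> w /= vw; rewrite /f -expRD sE -[leLHS]expR0 ler_expR.
  by rewrite -mulrN -mulrDr mulr_ge0// addrC subr_ge0.
rewrite lee_fin /f ExZ; last exact: bmf_exp_trig_sum.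
apply: (@le_trans _ _ (expR (- (l * v)) * expR (2 * \sum_(i < n) amp A' B' i ^+ 2))).
  by rewrite ler_wpM2l ?expR_ge0// Ex_exp_trig_sum.
rewrite -expRD ler_expR; under eq_bigr do rewrite aE.
rewrite -mulr_sumr.
have : l ^+ 2 * \sum_(i < n) amp A B i ^+ 2 <= l ^+ 2 * W by rewrite ler_wpM2l// sqr_ge0.
have -> : l ^+ 2 * W = v ^+ 2 / (16 * W) by rewrite /l; field; rewrite gt_eqF.
have -> : l * v = v ^+ 2 / (4 * W) by rewrite /l; field; rewrite gt_eqF.
have -> : v ^+ 2 / (8 * W) = 2 * (v ^+ 2 / (16 * W)) by field; rewrite gt_eqF.
have -> : v ^+ 2 / (4 * W) = 4 * (v ^+ 2 / (16 * W)) by field; rewrite gt_eqF.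
lra.
Qed.
End trig_sums.

(** * Anticoncentration *)

Section uniform_kernel.
Context {R : realType}.
Local Notation V := (measurableTypeR R).
Local Notation U := (@unif R).
Local Notation U2 := (U \x U)%E.

Lemma Ex_prod d1 d2 (T1 : measurableType d1) (T2 : measurableType d2)
    (P : probability T1 R) (Q : probability T2 R) (f : T1 * T2 -> R) : bmf f ->
  Ex (P \x Q)%E f = Ex P (fun x => Ex Q (fun y => f (x, y))).
Proof.
move=> bf; have [mf [M fM]] := bf.
have b2 : bmf (fun z => f z + M) by apply: bmfD => //; exact: bmf_cst.
suff : Ex (P \x Q)%E (fun z => f z + M) = Ex P (fun x => Ex Q (fun y => f (x, y) + M)).
  rewrite ExD//; last exact: bmf_cst.
  have -> : (fun x => Ex Q (fun y => f (x, y) + M)) = (fun x => Ex Q (fun y => f (x, y)) + M).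
    by apply/funext => x; rewrite ExD ?Ex_cst//; [exact: bmf_pair1|exact: bmf_cst].
  rewrite ExD//; [|exact: bmf_Ex2|exact: bmf_cst].
  by rewrite !Ex_cst; exact: addIr.
apply: EFin_inj; rewrite (EFin_Ex _ b2) (EFin_Ex P (bmf_Ex2 Q b2)).
rewrite (fubini_tonelli1 (fun z => (f z + M)%:E)).
- by apply: eq_integral => x _; rewrite (EFin_Ex Q (bmf_pair1 x b2)).
- by apply/measurable_EFinP; exact: b2.1.
- by move=> z; rewrite lee_fin; have := fM z; rewrite ler_norml; lra.
Qed.

Lemma Ex_unif_le (f g : V -> R) : bmf f -> bmf g -> (forall x : R, 0 <= x <= 1 -> f x <= g x) ->
  Ex U f <= Ex U g.
Proof.
move=> bf bg fg; have [mf [M fM]] := bf; have [mg [N gN]] := bg.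
have bfK : bmf (fun x => f x + (M + N)) by apply: bmfD => //; exact: bmf_cst.
have bgK : bmf (fun x => g x + (M + N)) by apply: bmfD => //; exact: bmf_cst.
have M0 : 0 <= M by apply: le_trans (fM 0); exact: normr_ge0.
have N0 : 0 <= N by apply: le_trans (gN 0); exact: normr_ge0.
have f0 x : 0 <= f x + (M + N) by have := fM x; rewrite ler_norml; lra.
have g0 x : 0 <= g x + (M + N) by have := gN x; rewrite ler_norml; lra.
suff : Ex U (fun x => f x + (M + N)) <= Ex U (fun x => g x + (M + N)).
  by rewrite !ExD//; try exact: bmf_cst; rewrite lerD2r.
rewrite -lee_fin (EFin_Ex U bfK) (EFin_Ex U bgK) !integral_uniform; last 4 first.
- by apply/measurable_EFinP; exact: bgK.1.
- by move=> x; rewrite lee_fin.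
- by apply/measurable_EFinP; exact: bfK.1.
- by move=> x; rewrite lee_fin.
rewrite subr0 invr1 !mul1e; apply: ge0_le_integral => //.
- by move=> x _; rewrite lee_fin.
- by apply/measurable_EFinP; apply: measurable_funTS; exact: bfK.1.
- by apply/measurable_EFinP; apply: measurable_funTS; exact: bgK.1.
- by move=> x; rewrite /= in_itv /= => x01; rewrite lee_fin lerD2r fg.
Qed.

(* A Fejer kernel, written as an expectation so that Fubini applies. *)
Definition kern (x : R) : R := Ex U2 (fun z => cos ((z.1 - z.2) * x)).

Lemma measurable_diff : measurable_fun [set: V * V] (fun z : V * V => z.1 - z.2 : R).
Proof. by apply: measurable_funB; [exact: measurable_fst|exact: measurable_snd]. Qed.

Lemma bmf_kern x : bmf (fun z : V * V => cos ((z.1 - z.2) * x)).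
Proof.
apply: (@bmf_comp _ _ _ cos _ 1); [exact: continuous_cos|exact: cos_max|].
by apply: measurable_funM; [exact: measurable_diff|exact: measurable_cst].
Qed.

Let bmfc x : bmf ((fun v => cos (v * x)) : V -> R).
Proof.
apply: (@bmf_comp _ _ _ cos _ 1); [exact: continuous_cos|exact: cos_max|].
by apply: measurable_funM; [exact: measurable_id|exact: measurable_cst].
Qed.

Let bmfs x : bmf ((fun v => sin (v * x)) : V -> R).
Proof.
apply: (@bmf_comp _ _ _ sin _ 1); [exact: continuous_sin|exact: sin_max|].
by apply: measurable_funM; [exact: measurable_id|exact: measurable_cst].
Qed.

(** The squared modulus of the characteristic function of the uniform law, which gives nonnegativity
    and a lower bound near 0. *)
Lemma kernE x : kern x = (Ex U (fun v => cos (v * x))) ^+ 2 + (Ex U (fun v => sin (v * x))) ^+ 2.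
Proof.
rewrite /kern Ex_prod; last exact: bmf_kern.
set c := Ex U (fun v => cos (v * x)); set s := Ex U (fun v => sin (v * x)).
transitivity (Ex U (fun v => cos (v * x) * c + sin (v * x) * s)).
  congr Ex; apply/funext => v /=.
  under eq_fun do rewrite mulrBl cosB.
  rewrite ExD; [|apply: bmfZ; exact: bmfc|apply: bmfZ; exact: bmfs].
  by rewrite !ExZ; [|exact: bmfs|exact: bmfc].
rewrite ExD; [|by apply: bmfM; [exact: bmfc|exact: bmf_cst]|by apply: bmfM; [exact: bmfs|exact: bmf_cst]].
by rewrite !ExZr; [rewrite !expr2|exact: bmfs|exact: bmfc].
Qed.

Lemma kern_ge0 x : 0 <= kern x.
Proof. by rewrite kernE addr_ge0 ?sqr_ge0. Qed.

Lemma cos_ge_sub (y : R) : 1 - `|y| <= cos y.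
Proof.
rewrite -(cos_norm y); move: `|y| (normr_ge0 y) => {}y y0.
suff : cos 0 + 0 <= cos y + y by rewrite cos0; lra.
by apply: (@der_mono R (fun y => cos y + y) (fun y => - sin y + 1)).
Qed.

Lemma kern_ge x : `|x| <= 1 / 2 -> 1 / 4 <= kern x.
Proof.
move=> x2; rewrite kernE.
have : 1 / 2 <= Ex U (fun v => cos (v * x)).
  rewrite -(Ex_cst U (1 / 2)); apply: Ex_unif_le => //; first exact: bmf_cst.
  move=> v /andP[v0 v1]; apply: le_trans (cos_ge_sub _).
  by rewrite normrM (ger0_norm v0); have := normr_ge0 x; nra.
by have := sqr_ge0 (Ex U (fun v => sin (v * x))); nra.
Qed.

(** The profile that dominates the characteristic function in each of the two frequencies. It is
    integrable, with an explicit antiderivative. *)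
Definition cauchyk (a y : R) : R := (1 + a ^+ 2 * y ^+ 2)^-1.

Lemma cauchyk_ge0 a y : 0 <= cauchyk a y.
Proof. by rewrite invr_ge0 addr_ge0// mulr_ge0 ?sqr_ge0. Qed.

Lemma cauchyk_le1 a y : cauchyk a y <= 1.
Proof.
have h : 0 <= a ^+ 2 * y ^+ 2 by rewrite mulr_ge0 ?sqr_ge0.
by rewrite invf_le1 ?lerDl// ltr_wpDr.
Qed.

Lemma bmf_cauchyk a : bmf (fun z : V * V => cauchyk a (z.1 - z.2)).
Proof.
split; last by exists 1 => z; rewrite ger0_norm ?cauchyk_ge0 ?cauchyk_le1.
apply: (measurableT_comp (f := cauchyk a : V -> V)); last exact: measurable_diff.
apply: continuous_measurable_fun => y; rewrite /cauchyk.
have d : is_derive y 1 (fun y => 1 + a ^+ 2 * y ^+ 2) (0 + a ^+ 2 * (y * 1 + y * 1)).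
  exact: (derD (der_cst 1 y) (derZ (a ^+ 2) (derM (der_id y) (der_id y)))).
apply: der_continuous (@der_inv R _ y _ _ d).
by rewrite gt_eqF// ltr_wpDr// mulr_ge0 ?sqr_ge0.
Qed.

(** Over the whole line the inner integral would be pi / a. *)
Lemma Ex_cauchyk a : 0 < a -> Ex U2 (fun z => cauchyk a (z.1 - z.2)) <= 4 / a.
Proof.
move=> a0; rewrite Ex_prod; last exact: bmf_cauchyk.
rewrite -[leRHS](Ex_cst U); apply: Ex_le; [exact: bmf_Ex2 (bmf_cauchyk a)|exact: bmf_cst|].
move=> s /=.
have cty (y : R) : is_derive y 1 (fun y => 1 + a ^+ 2 * (s - y) ^+ 2) (0 + a ^+ 2 * ((s - y) * (0 - 1) + (s - y) * (0 - 1))).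
  have dd : is_derive y 1 (fun y => s - y) (0 - 1) by exact: (derB (der_cst s y) (der_id y)).
  exact: (derD (der_cst 1 y) (derZ (a ^+ 2) (derM dd dd))).
have h1 : continuous (fun t => cauchyk a (s - t)).
  move=> y; rewrite /cauchyk; apply: der_continuous (@der_inv R _ y _ _ (cty y)).
  by rewrite gt_eqF// ltr_wpDr// mulr_ge0 ?sqr_ge0.
have h2 t : `|cauchyk a (s - t)| <= 1 by rewrite ger0_norm ?cauchyk_ge0 ?cauchyk_le1.
have h3 (t : R) : -1 < t -> is_derive t 1 (fun t => - a^-1 * atan (a * (s - t))) (cauchyk a (s - t)).
  move=> _; have dd : is_derive t 1 (fun y => a * (s - y)) (a * (0 - 1)).
    exact: (derZ a (derB (der_cst s t) (der_id t))).
  have da := @der_comp R (@atan R) (fun y => a * (s - y)) t _ _ (is_derive1_atan _) dd.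
  apply: der_eq (derZ (- a^-1) da) _.
  have D0 : 0 < 1 + a ^+ 2 * (s - t) ^+ 2 by rewrite ltr_wpDr// mulr_ge0 ?sqr_ge0.
  rewrite /cauchyk exprMn; move: D0; move: (1 + _) => D D0; field.
  by rewrite !gt_eqF.
have -> := @Ex_unif R _ _ 1 h1 h2 h3.
rewrite -mulrBr mulNr -mulrN opprB mulrC ler_wpM2r ?invr_ge0 ?(ltW a0)//.
have := atan_gtNpi2 (a * (s - 1)); have := atan_ltpi2 (a * (s - 0)); have := @pi_lt4 R.
by move: (atan _) (atan _) => u v; lra.
Qed.
End uniform_kernel.

Section anticoncentration.
Context d {T : measurableType d} {R : realType} (P : probability T R).
Variable theta : nat -> {RV P >-> R}.
Hypothesis theta_indep : mutually_independent theta.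
Hypothesis theta_unif : forall n, uniform01 (theta n).
Local Notation V := (measurableTypeR R).
Local Notation U := (@unif R).
Local Notation U2 := (U \x U)%E.
Local Notation U4 := (U2 \x U2)%E.

(* Real and imaginary parts of the sum of (p i + i q i) * exp(2 i pi theta i). *)
Definition re_sum (p q : nat -> R) := trig_sum theta p (fun i => - q i).
Definition im_sum (p q : nat -> R) := trig_sum theta q p.

Lemma Ex_cos_linear p q n (s t : R) :
  Ex P (fun w => cos (s * re_sum p q n w + t * im_sum p q n w)) =
  \prod_(i < n) bessel (Num.sqrt ((s ^+ 2 + t ^+ 2) * (p i ^+ 2 + q i ^+ 2))).
Proof.
pose A i := s * p i + t * q i; pose B i := - s * q i + t * p i.
transitivity (Ex P (fun w => cos (trig_sum theta A B n w))).
  congr Ex; apply/funext => w; congr cos.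
  rewrite /re_sum /im_sum /trig_sum !mulr_sumr -big_split /=; apply: eq_bigr => i _.
  by rewrite /trig_term /A /B; ring.
rewrite (Ex_cos_trig_sum theta_indep theta_unif).
apply: eq_bigr => i _; rewrite /amp /A /B; congr (bessel (Num.sqrt _)); ring.
Qed.

Definition block_mass (p q : nat -> R) n (blk : nat -> nat) j : R :=
  \sum_(i < n | blk i == j) (p i ^+ 2 + q i ^+ 2).

Lemma prod_ge_sum (I : Type) (r : seq I) (Q : pred I) (f : I -> R) :
  (forall i, 0 <= f i) -> 1 + \sum_(i <- r | Q i) f i <= \prod_(i <- r | Q i) (1 + f i).
Proof.
move=> f0; elim: r => [|i r IH]; first by rewrite !big_nil addr0.
rewrite !big_cons; case: ifP => // _.
have := f0 i; have : 0 <= \sum_(j <- r | Q j) f j by apply: sumr_ge0 => j _.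
move: IH; move: (\sum_(_ <- _ | _) _) (\prod_(_ <- _ | _) _) => S Pr; nra.
Qed.

Lemma prod_blocks n J (blk : nat -> nat) (f : nat -> R) : (forall i, 1 <= f i) ->
  \prod_(j < J) \prod_(i < n | blk i == j) f i <= \prod_(i < n) f i.
Proof.
move=> f1; under eq_bigr do rewrite big_mkcond.
rewrite exchange_big /=; apply: ler_prod => i _.
apply/andP; split.
  by apply: prodr_ge0 => j _; case: ifP => // _; apply: le_trans (f1 i).
have [lt|ge] := ltnP (blk i) J.
  rewrite (bigD1 (Ordinal lt)) //= eqxx big1 ?mulr1// => j /negbTE jN.
  rewrite ifF//; apply/negbTE; apply: contraFneq jN => e; apply/eqP/val_inj; by rewrite /= -e.
rewrite big1 ?f1// => j _; rewrite ifF//; apply/negbTE.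
by rewrite neq_ltn (leq_trans (ltn_ord j) ge) orbT.
Qed.

(* Eight blocks yield one factor [1 / (1 + x)]; two such factors are needed,
   one for [s] and one for [t]. *)
Lemma Ex_cos_linear_le (k : R) p q n (rho s t : R) (blk : nat -> nat) :
  0 < k -> (forall u : R, 0 <= u -> bessel u ^+ 8 * (1 + k * u ^+ 2) <= 1) ->
  0 <= rho -> (forall j, (j < 16)%N -> rho ^+ 2 <= block_mass p q n blk j) ->
  `|Ex P (fun w => cos (s * re_sum p q n w + t * im_sum p q n w))| <=
  cauchyk (Num.sqrt k * rho) s * cauchyk (Num.sqrt k * rho) t.
Proof.
move=> k0 hk r0 hb; rewrite Ex_cos_linear.
set b := \prod_(_ < _) _; set tt := s ^+ 2 + t ^+ 2.
have tt0 : 0 <= tt by rewrite addr_ge0 ?sqr_ge0.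
have c0 i : 0 <= p i ^+ 2 + q i ^+ 2 by rewrite addr_ge0 ?sqr_ge0.
pose x := k * rho ^+ 2 * tt.
have x0 : 0 <= x by rewrite mulr_ge0// mulr_ge0 ?sqr_ge0// ltW.
have step1 : b ^+ 8 * \prod_(i < n) (1 + k * (tt * (p i ^+ 2 + q i ^+ 2))) <= 1.
  rewrite /b -prodrXl -big_split /=; apply: prodr_ile1 => i _.
  set v := Num.sqrt _; have v2 : v ^+ 2 = tt * (p i ^+ 2 + q i ^+ 2) by rewrite sqr_sqrtr// mulr_ge0.
  rewrite -v2 hk ?sqrtr_ge0// andbT mulr_ge0 ?exprn_even_ge0//.
  by rewrite addr_ge0// mulr_ge0 ?sqr_ge0// ltW.
have step2 : (1 + x) ^+ 16 <= \prod_(i < n) (1 + k * (tt * (p i ^+ 2 + q i ^+ 2))).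
  apply: le_trans (@prod_blocks n 16 blk (fun i => 1 + k * (tt * (p i ^+ 2 + q i ^+ 2))) _); last first.
    by move=> i; rewrite lerDl mulr_ge0 ?(ltW k0)// mulr_ge0.
  rewrite -[X in _ ^+ X]card_ord -prodr_const; apply: ler_prod => j _.
  rewrite addr_ge0//=; apply: le_trans (prod_ge_sum _ _ _); last first.
    by move=> i; rewrite mulr_ge0 ?(ltW k0)// mulr_ge0.
  rewrite lerD2l -!mulr_sumr /x -mulrA ler_pM2l// mulrC ler_wpM2l//.
  exact: hb.
have b8 : 0 <= b ^+ 8 by rewrite exprn_even_ge0.
(* The eighth root of the two previous steps. *)
have step3 : `|b| * (1 + x) ^+ 2 <= 1.
  have y0 : 0 <= `|b| * (1 + x) ^+ 2 by rewrite mulr_ge0 ?sqr_ge0.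
  rewrite -(@ler_pXn2r _ 8) ?nnegrE// expr1n exprMn -exprM -normrX ger0_norm//.
  by apply: le_trans step1; rewrite ler_wpM2l.
set a := Num.sqrt k * rho; have a2 : a ^+ 2 = k * rho ^+ 2 by rewrite exprMn sqr_sqrtr// ltW.
have s0 : 0 <= a ^+ 2 * s ^+ 2 by rewrite mulr_ge0 ?sqr_ge0.
have t0 : 0 <= a ^+ 2 * t ^+ 2 by rewrite mulr_ge0 ?sqr_ge0.
rewrite /cauchyk -invfM -[leRHS]mul1r ler_pdivlMr; last by rewrite mulr_gt0// ltr_wpDr.
(* With S and T the contributions of s and t, (1 + S) (1 + T) <= (1 + S + T)^2: the square is shared
   between the two frequencies. *)
apply: le_trans step3; rewrite ler_wpM2l// /x /tt -a2 [a ^+ 2 * (_ + _)]mulrDr.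
move: s0 t0; move: (a ^+ 2 * s ^+ 2) (a ^+ 2 * t ^+ 2) => S1 T1 hS hT; nra.
Qed.

(** The indicator of the square of half-side r is at most 16 times a product of two kernels at scale
    1 / (2 r). The kernels being averages of cosines, Fubini's theorem turns their expectation into
    an average of the characteristic function, and each frequency contributes a factor of order r /
    rho. *)
Theorem anticoncentration : exists2 C : R, 0 < C & forall p q n (rho r : R) (blk : nat -> nat),
  0 < rho -> 0 < r -> (forall j, (j < 16)%N -> rho ^+ 2 <= block_mass p q n blk j) ->
  (P [set w | (`|re_sum p q n w| <= r)%R /\ (`|im_sum p q n w| <= r)%R] <= (C * (r / rho) ^+ 2)%:E)%E.
Proof.
have [k k0 hk] := @bessel_bound_ex R.
have sk0 : 0 < Num.sqrt k by rewrite sqrtr_gt0.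
exists (16 * (8 / Num.sqrt k) ^+ 2); first by rewrite mulr_gt0// exprn_gt0// divr_gt0.
move=> p q n rho r blk rho0 r0 hb.
set X := re_sum p q n; set Y := im_sum p q n.
have mX : measurable_fun setT X by exact: trig_sum_measurable.
have mY : measurable_fun setT Y by exact: trig_sum_measurable.
pose e := (2 * r)^-1; have e0 : 0 < e by rewrite invr_gt0 mulr_gt0.
pose g (z : T * ((V * V) * (V * V))) : R :=
  cos ((z.2.1.1 - z.2.1.2) * (e * X z.1)) * cos ((z.2.2.1 - z.2.2.2) * (e * Y z.1)).
have mcos (f h : T * ((V * V) * (V * V)) -> R) : measurable_fun setT f -> measurable_fun setT h ->
    bmf (fun z => cos (f z * (e * h z))).
  move=> mf mh; apply: (@bmf_comp _ _ _ cos _ 1); [exact: continuous_cos|exact: cos_max|].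
  by apply: measurable_funM => //; apply: measurable_funM => //; exact: measurable_cst.
have m21 : measurable_fun setT (fun z : T * ((V * V) * (V * V)) => z.2.1.1 - z.2.1.2 : R).
  apply: (measurableT_comp (f := fun z : V * V => z.1 - z.2 : R)); first exact: measurable_diff.
  exact: (measurableT_comp measurable_fst measurable_snd).
have m22 : measurable_fun setT (fun z : T * ((V * V) * (V * V)) => z.2.2.1 - z.2.2.2 : R).
  apply: (measurableT_comp (f := fun z : V * V => z.1 - z.2 : R)); first exact: measurable_diff.
  exact: (measurableT_comp measurable_snd measurable_snd).
have bg : bmf g.
  apply: bmfM; apply: mcos => //.
    exact: (measurableT_comp mX measurable_fst).
  exact: (measurableT_comp mY measurable_fst).
pose K w := kern (e * X w) * kern (e * Y w).
have KE w : K w = Ex U4 (fun u => g (w, u)).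
  rewrite Ex_prod; last exact: (bmf_pair1 w bg).
  rewrite /K {1}/kern -ExZr; last exact: bmf_kern.
  congr Ex; apply/funext => z; rewrite /g /= ExZ//; exact: bmf_kern.
have bK : bmf K by rewrite (_ : K = fun w => Ex U4 (fun u => g (w, u))); [exact: bmf_Ex2|apply/funext].
have mE : measurable [set w | `|X w| <= r /\ `|Y w| <= r].
  by apply: measurableI; exact: measurable_norm_le.
apply: (@le_trans _ _ (Ex P (fun w => 16 * K w))%:E).
  apply: Ex_markov => //; first exact: bmfZ.
    by move=> w; rewrite mulr_ge0// mulr_ge0 ?kern_ge0.
  move=> w [/= hX hY].
  have h f : `|f| <= r -> 1 / 4 <= kern (e * f).
    move=> fr; apply: kern_ge; rewrite normrM (gtr0_norm e0) /e invfM -mulrA div1r.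
    by rewrite ler_piMr// mulrC ler_pdivrMr// mul1r.
  have := h _ hX; have := h _ hY; rewrite /K; move: (kern _) (kern _) => u v; nra.
rewrite lee_fin ExZ// -[leRHS]mulrA ler_wpM2l//.
rewrite (_ : K = fun w => Ex U4 (fun u => g (w, u))); last by apply/funext.
rewrite Ex_fubini//.
set a := Num.sqrt k * rho * e; have a0 : 0 < a by rewrite !mulr_gt0.
pose f (z : V * V) := cauchyk a (z.1 - z.2).
have bf : bmf f by exact: bmf_cauchyk.
have mu1 : bmf (fun u : (V * V) * (V * V) => f u.1).
  have [mf [M hM]] := bf; split; last by exists M => u.
  exact: (measurableT_comp mf measurable_fst).
have mu2 : bmf (fun u : (V * V) * (V * V) => f u.2).
  have [mf [M hM]] := bf; split; last by exists M => u.
  exact: (measurableT_comp mf measurable_snd).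
apply: (@le_trans _ _ (Ex U4 (fun u => f u.1 * f u.2))).
  apply: Ex_le; [exact: bmf_Ex1|exact: bmfM|move=> u].
  pose s := (u.1.1 - u.1.2) * e; pose t := (u.2.1 - u.2.2) * e.
  (* A product of cosines is a mean of cosines of linear combinations, and the bound is the same for
     t and -t. *)
  have -> : (fun x => g (x, u)) = (fun w => 2^-1 * (cos (s * X w + t * Y w) + cos (s * X w + (- t) * Y w))).
    apply/funext => w; rewrite /g /= /s /t !mulrA mulNr (cosD _ (- _)) sinN cosN cosD; by field.
  have bc (t' : R) : bmf (fun w => cos (s * X w + t' * Y w)).
    apply: bmf_cos; apply: measurable_funD; apply: measurable_funM => //; exact: measurable_cst.
  rewrite ExZ; last exact: bmfD.
  rewrite ExD//.
  have ck (y : R) : cauchyk (Num.sqrt k * rho) (y * e) = cauchyk a y.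
    by rewrite /cauchyk /a !exprMn; congr (_^-1); ring.
  have := Ex_cos_linear_le s t k0 hk (ltW rho0) hb.
  have := Ex_cos_linear_le s (- t) k0 hk (ltW rho0) hb.
  have cN b y : cauchyk b (- y) = cauchyk b y :> R by rewrite /cauchyk sqrrN.
  rewrite cN /s /t !ck -/(f u.1) -/(f u.2).
  rewrite !ler_norml => /andP[_ h1] /andP[_ h2].
  by move: h1 h2; rewrite /s /t; lra.
rewrite Ex_prod; last exact: bmfM.
have -> : (fun x : V * V => Ex U2 (fun y => f (x, y).1 * f (x, y).2)) = (fun x => f x * Ex U2 f).
  by apply/funext => x /=; rewrite ExZ.
rewrite ExZr// -expr2.
have -> : (8 / Num.sqrt k) ^+ 2 * (r / rho) ^+ 2 = (4 / a) ^+ 2.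
  rewrite -exprMn; congr (_ ^+ 2); rewrite /a /e; field.
  by rewrite !gt_eqF.
rewrite ler_pXn2r ?nnegrE//.
- exact: Ex_cauchyk.
- by apply: Ex_ge0 => z; exact: cauchyk_ge0.
- by rewrite divr_ge0// ltW.
Qed.
End anticoncentration.

(** * The random series *)

Section dominated_series.
Context {R : realType}.
Variable b : nat -> R.
Hypothesis b0 : forall n, 0 <= b n.
Hypothesis bsum : (\sum_(0 <= n <oo) (b n)%:E < +oo)%E.

Definition tail (N : nat) : R := fine (\sum_(0 <= n <oo) (b n)%:E)%E - \sum_(0 <= n < N) b n.

Lemma tail_cvg : series b @ \oo --> fine (\sum_(0 <= n <oo) (b n)%:E)%E.
Proof.
have fin : (\sum_(0 <= n <oo) (b n)%:E)%E \is a fin_num.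
  by rewrite ge0_fin_numE// nneseries_ge0// => n _ _; rewrite lee_fin.
have h : (fun n => (\sum_(0 <= k < n) (b k)%:E)%E) @ \oo --> (\sum_(0 <= n <oo) (b n)%:E)%E.
  by apply: is_cvg_nneseries => n _ _; rewrite lee_fin.
move: h; rewrite -[X in _ --> X](fineK fin) => /fine_cvg.
rewrite (_ : fine \o _ = series b)//.
by apply/funext => n /=; rewrite sumEFin.
Qed.

Lemma tail_decr N m : (N <= m)%N -> \sum_(N <= n < m) b n = tail N - tail m.
Proof.
move=> Nm; rewrite /tail [in RHS](big_cat_nat (n := N) (p := m))//=; ring.
Qed.

Lemma tail_ge0 N : 0 <= tail N.
Proof.
rewrite subr_ge0; have := nondecreasing_cvgn_le _ (cvgP _ tail_cvg) N.
rewrite (cvg_lim _ tail_cvg)//; apply.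
by apply: nondecreasing_series => n _ _.
Qed.

Lemma tail_small (e : R) : 0 < e -> exists N, forall m, (N <= m)%N -> tail m < e.
Proof.
move=> e0; have /cvgrPdist_lt/(_ e e0)[N _ h] := tail_cvg.
exists N => m Nm; have := h m Nm; apply: le_lt_trans; exact: ler_norm.
Qed.

Lemma dominated_series (u : nat -> R) : (forall n, `|u n| <= b n) ->
  exists2 l : R, series u @ \oo --> l & forall N, `|l - \sum_(0 <= n < N) u n| <= tail N.
Proof.
move=> ub.
have cu : cvgn (series u).
  apply: normed_cvg; apply: (series_le_cvg (v_ := b)) => //.
    by move=> n; exact: normr_ge0.
  exact: (cvgP _ tail_cvg).
exists (limn (series u)); first exact: cu.
move=> N; rewrite leNgt; apply/negP; rewrite -subr_gt0 => e0.
have /cvgrPdist_lt/(_ _ e0)[m _ h] : series u @ \oo --> limn (series u) by exact: cu.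
have := h (maxn m N) (leq_maxl _ _); set k := maxn m N.
have Nk : (N <= k)%N by exact: leq_maxr.
have h2 : `|\sum_(0 <= n < k) u n - \sum_(0 <= n < N) u n| <= tail N.
  rewrite (big_cat_nat (n := N) (p := k))//= addrAC subrr add0r.
  apply: le_trans (ler_norm_sum _ _ _) _; apply: le_trans (ler_sum _ (fun i _ => ub i)) _.
  by rewrite tail_decr// gerBl tail_ge0.
have := ler_distD (\sum_(0 <= n < k) u n) (limn (series u)) (\sum_(0 <= n < N) u n).
rewrite /series /=; lra.
Qed.
End dominated_series.

Section random_series_limit.
Context {R : realType}.
Variables (a : nat -> R[i]) (phi : nat -> R -> R[i]) (lam : nat -> R) (M : R).
Hypothesis phiM : forall n x, modulus (phi n x) <= M.
Hypothesis asum : (\sum_(0 <= n <oo) (modulus (a n))%:E < +oo)%E.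

Lemma modulus_ge0 (z : R[i]) : 0 <= modulus z.
Proof. by case: z => x y; exact: sqrtr_ge0. Qed.

Lemma modulus_sqr (z : R[i]) : modulus z ^+ 2 = complex.Re z ^+ 2 + complex.Im z ^+ 2.
Proof. by case: z => x y /=; rewrite sqr_sqrtr// addr_ge0 ?sqr_ge0. Qed.

Lemma Re_le_modulus (z : R[i]) : `|complex.Re z| <= modulus z.
Proof.
rewrite -(@ler_pXn2r _ 2) ?nnegrE ?modulus_ge0// modulus_sqr real_normK ?num_real//.
by rewrite lerDl sqr_ge0.
Qed.

Lemma Im_le_modulus (z : R[i]) : `|complex.Im z| <= modulus z.
Proof.
rewrite -(@ler_pXn2r _ 2) ?nnegrE ?modulus_ge0// modulus_sqr real_normK ?num_real//.
by rewrite lerDr sqr_ge0.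
Qed.

Lemma modulusM (z w : R[i]) : modulus (z * w) = modulus z * modulus w.
Proof. exact: ComplexField.Normc.normcM. Qed.

Lemma modulus_expi (t : R) : modulus (expi t) = 1.
Proof. by rewrite /expi /modulus /= cos2Dsin2 sqrtr1. Qed.

Definition coef n x : R[i] := a n * phi n (lam n * x).
Definition re_coef x n := complex.Re (coef n x).
Definition im_coef x n := complex.Im (coef n x).

Definition re_term (t : R) x n := re_coef x n * cos (2 * pi * t) - im_coef x n * sin (2 * pi * t).
Definition im_term (t : R) x n := im_coef x n * cos (2 * pi * t) + re_coef x n * sin (2 * pi * t).

Lemma term_re (t : R) x n : complex.Re (a n * expi (2 * pi * t) * phi n (lam n * x)) = re_term t x n.
Proof.
rewrite /re_term /re_coef /im_coef /coef /expi.
by case: (a n) => a1 a2; case: (phi n _) => p1 p2 /=; ring.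
Qed.

Lemma term_im (t : R) x n : complex.Im (a n * expi (2 * pi * t) * phi n (lam n * x)) = im_term t x n.
Proof.
rewrite /im_term /re_coef /im_coef /coef /expi.
by case: (a n) => a1 a2; case: (phi n _) => p1 p2 /=; ring.
Qed.

Let b n := M * modulus (a n).

Let M0 : 0 <= M.
Proof. by apply: le_trans (phiM 0%N 0); exact: modulus_ge0. Qed.

Let b0 n : 0 <= b n. Proof. by rewrite mulr_ge0 ?modulus_ge0. Qed.

Let bsum : (\sum_(0 <= n <oo) (b n)%:E < +oo)%E.
Proof.
rewrite /b; under eq_eseriesr do rewrite EFinM.
rewrite nneseriesZl; last by move=> n _; rewrite lee_fin modulus_ge0.
rewrite lte_mul_pinfty ?lee_fin//.
Qed.

Definition rtail := tail b.

Lemma term_bound (t : R) x n : modulus (a n * expi (2 * pi * t) * phi n (lam n * x)) <= b n.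
Proof. by rewrite !modulusM modulus_expi mulr1 /b mulrC ler_wpM2r ?modulus_ge0. Qed.

Lemma complex_lim (u : nat -> R[i]) (x y : R) :
  (fun n => complex.Re (u n)) @ \oo --> x -> (fun n => complex.Im (u n)) @ \oo --> y ->
  limn (u : nat -> R[i]^o) = (x +i* y)%C.
Proof.
move=> ux uy; apply: cvg_lim; first exact: norm_hausdorff.
(* The tolerance is itself a complex number; being positive means that its imaginary part vanishes
   and its real part is positive. *)
apply/cvgrPdist_lt => -[e1 e2]; rewrite ltcE /= => /andP[/eqP e20 e10].
have e2' : 0 < e1 / 2 by rewrite divr_gt0.
move/cvgrPdist_lt : ux => /(_ _ e2') ux; move/cvgrPdist_lt : uy => /(_ _ e2') uy.
near=> n.
have h1 : `|x - complex.Re (u n)| < e1 / 2 by near: n.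
have h2 : `|y - complex.Im (u n)| < e1 / 2 by near: n.
rewrite normc_def ltcE /= e20 eqxx /=.
apply: (@le_lt_trans _ _ (`|x - complex.Re (u n)| + `|y - complex.Im (u n)|)); last by lra.
case: (u n) h1 h2 => v1 v2 /= _ _.
rewrite -[leRHS]ger0_norm ?addr_ge0// -sqrtr_sqr; apply: ler_wsqrtr.
rewrite -(real_normK (num_real (x - v1))) -(real_normK (num_real (y - v2))).
have := normr_ge0 (x - v1); have := normr_ge0 (y - v2).
move: `|_| `|_| => r1 r2; nra.
Unshelve. all: by end_near. Qed.

Lemma rseries_approx (th : nat -> R) x N :
  `|complex.Re (rseries a phi lam th x) - \sum_(n < N) re_term (th n) x n| <= rtail N /\
  `|complex.Im (rseries a phi lam th x) - \sum_(n < N) im_term (th n) x n| <= rtail N.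
Proof.
have [l1 c1 h1] := dominated_series b0 bsum (fun n => le_trans (Re_le_modulus _) (term_bound (th n) x n)).
have [l2 c2 h2] := dominated_series b0 bsum (fun n => le_trans (Im_le_modulus _) (term_bound (th n) x n)).
have -> : rseries a phi lam th x = (l1 +i* l2)%C.
  apply: complex_lim.
    suff -> : (fun n => complex.Re (series (fun n => a n * expi (2 * pi * th n) * phi n (lam n * x)) n)) =
      series (fun n => complex.Re (a n * expi (2 * pi * th n) * phi n (lam n * x))) by [].
    by apply/funext => n; rewrite /series /= raddf_sum.
  suff -> : (fun n => complex.Im (series (fun n => a n * expi (2 * pi * th n) * phi n (lam n * x)) n)) =
    series (fun n => complex.Im (a n * expi (2 * pi * th n) * phi n (lam n * x))) by [].
  by apply/funext => n; rewrite /series /= raddf_sum.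
move: (h1 N) (h2 N); rewrite !big_mkord.
under eq_bigr do rewrite term_re; move=> hr.
by under eq_bigr do rewrite term_im.
Qed.

Lemma rtail_ge0 N : 0 <= rtail N. Proof. exact: tail_ge0. Qed.

Lemma rtail_small (e : R) : 0 < e -> exists N, forall m, (N <= m)%N -> rtail m < e.
Proof. exact: tail_small. Qed.

Lemma rseries_bounded (th : nat -> R) x :
  `|complex.Re (rseries a phi lam th x)| <= rtail 0 /\
  `|complex.Im (rseries a phi lam th x)| <= rtail 0.
Proof. by have [] := rseries_approx th x 0; rewrite !big_ord0 !subr0. Qed.
End random_series_limit.

(** * Blocks of frequencies and the exponents sigma and tau *)

Section blocks.
Context {R : realType}.
Variables (a : nat -> R[i]) (lam : nat -> R) (q : R).
Hypothesis q1 : 1 < q.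
Hypothesis lam1 : forall n, 1 <= lam n.
Hypothesis asum : (\sum_(0 <= n <oo) (modulus (a n))%:E < +oo)%E.

Definition in_block k n := q ^+ k <= lam n < q ^+ k.+1.

Lemma block_ex n : exists k, in_block k n.
Proof.
have ex : exists m, lam n < q ^+ m.
  have l0 : 0 < (lam n)^-1 by rewrite invr_gt0 (lt_le_trans ltr01).
  have q0 : 0 < q by apply: lt_trans q1.
  have /cvgrPdist_lt/(_ _ l0)[m _ /(_ m (leqnn m))] : ((fun n => (q^-1 : R) ^+ n) @ \oo --> (0 : R)).
    by apply: cvg_expr; rewrite ger0_norm ?invf_lt1// invr_ge0 ltW.
  rewrite sub0r normrN ger0_norm ?exprn_ge0 ?invr_ge0 ?ltW// exprVn => h.
  by exists m; rewrite -ltf_pV2// posrE ?exprn_gt0// (lt_le_trans ltr01).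
case: (ex_minnP ex) => -[|m] nm mmin; first by move: nm; rewrite expr0 ltNge lam1.
exists m; rewrite /in_block nm andbT leNgt; apply/negP => /mmin; by rewrite ltnn.
Qed.

Lemma block_uniq k l n : in_block k n -> in_block l n -> k = l.
Proof.
move=> /andP[k1 k2] /andP[l1 l2]; apply/eqP; rewrite eqn_leq.
have h i j : q ^+ i <= lam n -> lam n < q ^+ j -> (i < j)%N.
  by move=> hi hj; have := le_lt_trans hi hj; rewrite ltr_eXn2l.
by apply/andP; split; rewrite -ltnS; [exact: h k1 l2|exact: h l1 k2].
Qed.

Let sq n : R := modulus (a n) ^+ 2.

Lemma block_norm_le k (x : R) : 0 < x ->
  (\esum_(n in [set n | in_block k n]) (sq n)%:E <= (x ^+ 2)%:E)%E ->
  (block_norm a lam q k <= x%:E)%E.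
Proof.
move=> x0 h; rewrite /block_norm.
have -> : x%:E = ((x ^+ 2)%:E `^ 2^-1)%E.
  by rewrite poweR_EFin -powR_mulrn ?(ltW x0)// -powRrM mulfV// powRr1// ltW.
apply: gt0_ler_poweR => //.
- by rewrite in_itv /= leey andbT esum_ge0// => n _; rewrite lee_fin sqr_ge0.
- by rewrite in_itv /= leey andbT lee_fin sqr_ge0.
Qed.

Lemma block_norm_ge k (x : R) : 0 < x ->
  ((x ^+ 2)%:E <= \esum_(n in [set n | in_block k n]) (sq n)%:E)%E ->
  (x%:E <= block_norm a lam q k)%E.
Proof.
move=> x0 h; rewrite /block_norm.
have -> : x%:E = ((x ^+ 2)%:E `^ 2^-1)%E.
  by rewrite poweR_EFin -powR_mulrn ?(ltW x0)// -powRrM mulfV// powRr1// ltW.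
apply: gt0_ler_poweR => //.
- by rewrite in_itv /= leey andbT lee_fin sqr_ge0.
- by rewrite in_itv /= leey andbT esum_ge0// => n _; rewrite lee_fin sqr_ge0.
Qed.

Lemma block_norm_ge0 k : (0 <= block_norm a lam q k)%E.
Proof. exact: poweR_ge0. Qed.

Let lq : 0 < ln q. Proof. exact: ln_gt0. Qed.

Lemma block_exponent_ge k (t : R) : (0 < k)%N ->
  (\esum_(n in [set n | in_block k n]) (sq n)%:E <= (expR (- (t * (k%:R * ln q))) ^+ 2)%:E)%E ->
  (t%:E <= block_exponent a lam q k)%E.
Proof.
move=> k0 /block_norm_le => /(_ (expR_gt0 _)) h.
have c0 : 0 < k%:R * ln q by rewrite mulr_gt0// ltr0n.
rewrite /block_exponent inver gt_eqF// lee_pdivlMr// -EFinM leeNr.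
have := h; rewrite -lee_lne; last 2 first.
- by rewrite in_itv /= leey block_norm_ge0.
- by rewrite in_itv /= leey lee_fin expR_ge0.
by rewrite lne_EFin ?expR_gt0// expRK EFinN.
Qed.

Lemma block_exponent_le k (t : R) : (0 < k)%N ->
  ((expR (- (t * (k%:R * ln q))) ^+ 2)%:E <= \esum_(n in [set n | in_block k n]) (sq n)%:E)%E ->
  (block_exponent a lam q k <= t%:E)%E.
Proof.
move=> k0 /block_norm_ge => /(_ (expR_gt0 _)) h.
have c0 : 0 < k%:R * ln q by rewrite mulr_gt0// ltr0n.
rewrite /block_exponent inver gt_eqF// lee_pdivrMr// -EFinM leeNl.
have := h; rewrite -lee_lne; last 2 first.
- by rewrite in_itv /= leey lee_fin expR_ge0.
- by rewrite in_itv /= leey block_norm_ge0.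
by rewrite lne_EFin ?expR_gt0// expRK EFinN.
Qed.

Lemma block_sumE k : (\esum_(n in [set n | in_block k n]) (sq n)%:E =
  \sum_(0 <= n <oo | in_block k n) (sq n)%:E)%E.
Proof. by rewrite nneseries_esum// => n _; rewrite lee_fin sqr_ge0. Qed.

(** The mass of a block is defined as a possibly infinite sum. Since the inequality on the exponent
    is strict, finitely many terms already exceed the bound: otherwise the whole sum would satisfy
    the opposite inequality. *)
Lemma tau_block (t : R) : (tau_exp a lam q < t%:E)%E -> exists k0, forall k, (k0 <= k)%N ->
  exists N, forall m, (N <= m)%N ->
    expR (- (t * (k%:R * ln q))) ^+ 2 <= \sum_(n < m | in_block k n) sq n.
Proof.
rewrite /tau_exp limn_esup_lim (cvg_lim _ (@cvg_esups_inf R _))//.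
move=> /ereal_inf_lt[_ [k0 _ <-] lt].
exists k0.+1 => k kk0.
have uk : (block_exponent a lam q k < t%:E)%E.
  by apply: le_lt_trans lt; apply: ereal_sup_ubound; exists k => //=; exact: ltnW.
apply: contrapT => /forallNP h.
have : (t%:E <= block_exponent a lam q k)%E; last by rewrite leNgt uk.
apply: block_exponent_ge; first exact: leq_ltn_trans kk0.
rewrite block_sumE; apply: lime_le.
  by apply: is_cvg_nneseries => n _ _; rewrite lee_fin sqr_ge0.
apply: nearW => N; have /existsNP[m /not_implyP[Nm /negP]] := h N.
rewrite -ltNge => /ltW lt2; rewrite sumEFin lee_fin; apply: le_trans lt2.
rewrite big_mkord big_mkcond [leRHS]big_mkcond /=.
rewrite -!(big_mkord xpredT (fun n => if in_block k n then sq n else 0)).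
rewrite [leRHS](big_cat_nat (n := N))//= lerDl sumr_ge0// => i _.
by case: ifP => // _; exact: sqr_ge0.
Qed.

Lemma sigma_block (t : R) : (t%:E < sigma_exp a lam q)%E -> exists k0, forall k, (k0 <= k)%N ->
  forall m, \sum_(n < m | in_block k n) sq n <= expR (- (t * (k%:R * ln q))) ^+ 2.
Proof.
rewrite /sigma_exp limn_einf_lim.
have h := @nonincreasing_esups R (\- block_exponent a lam q)%E.
have hd : nondecreasing_seq (einfs (block_exponent a lam q)) by exact: nondecreasing_einfs.
rewrite (cvg_lim _ (ereal_nondecreasing_cvgn hd))//.
move=> /ereal_sup_gt[_ [k0 _ <-] lt].
exists k0.+1 => k kk0 m.
have uk : (t%:E < block_exponent a lam q k)%E.
  by apply: lt_le_trans lt _; apply: ereal_inf_lbound; exists k => //=; exact: ltnW.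
rewrite leNgt; apply/negP => lt2.
have : (block_exponent a lam q k <= t%:E)%E; last by rewrite leNgt uk.
apply: block_exponent_le; first exact: leq_ltn_trans kk0.
rewrite block_sumE; apply: (@le_trans _ _ (\sum_(0 <= n < m | in_block k n) (sq n)%:E)%E).
  by rewrite sumEFin lee_fin big_mkord ltW.
by apply: nneseries_lim_ge => n _ _; rewrite lee_fin sqr_ge0.
Qed.

Lemma sq_sum_le m (Q : pred nat) : \sum_(n < m | Q n) sq n <= (tail (modulus \o a) 0) ^+ 2.
Proof.
have b0 n : 0 <= modulus (a n) by exact: modulus_ge0.
set S := tail _ 0.
have Sm : \sum_(n < m) modulus (a n) <= S.
  have := tail_decr (modulus \o a) (leq0n m); rewrite big_mkord => ->.
  by rewrite gerBl tail_ge0.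
have S0 : 0 <= S by exact: tail_ge0.
apply: (@le_trans _ _ (\sum_(n < m) sq n)).
  by rewrite big_mkcond /=; apply: ler_sum => i _; case: ifP => // _; exact: sqr_ge0.
apply: (@le_trans _ _ (\sum_(n < m) modulus (a n) * S)).
  apply: ler_sum => i _; rewrite /sq expr2 ler_wpM2l//; apply: le_trans Sm.
  by rewrite (bigD1 i) //= lerDl sumr_ge0.
by rewrite -mulr_suml expr2 ler_wpM2r.
Qed.

(** For g < t < sigma the k-th block has mass O(q^(-2 t k)) and its weights are at most q^(2 g (k +
    1)), so the blocks are summed by a geometric series. *)
Lemma sigma_weight (g : R) : 0 <= g -> (g%:E < sigma_exp a lam q)%E ->
  exists2 W, 0 < W & forall m, \sum_(n < m) sq n * lam n `^ (2 * g) <= W.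
Proof.
move=> g0 gs.
have [t gt ts] : exists2 t, g < t & (t%:E < sigma_exp a lam q)%E.
  case: (sigma_exp a lam q) gs => [r| |] //.
    by rewrite lte_fin => gr; exists ((g + r) / 2); rewrite ?lte_fin; lra.
  by move=> _; exists (g + 1); rewrite ?ltry//; lra.
have [k0 hk] := sigma_block ts.
have q0 : 0 < q by apply: lt_trans q1.
pose S2 := (tail (modulus \o a) 0) ^+ 2.
pose e (k : nat) := expR (- (t * (k%:R * ln q))) ^+ 2.
have eE k : e k = (expR (- (2 * (t * ln q)))) ^+ k.
  rewrite /e -expRM_natl -expRM_natl; congr expR; rewrite -[k%:R * (_)]mulrC; ring.
(* The quotient extends the block bound to the blocks before [k0], of which only the finite total
   mass is known. *)
pose D := 1 + S2 / e k0.
have e0 k : 0 < e k by rewrite exprn_gt0// expR_gt0.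
have t0 : 0 <= t by lra.
have ek k : (k <= k0)%N -> e k0 <= e k.
  move=> kk; rewrite /e ler_pXn2r ?nnegrE ?expR_ge0// ler_expR lerN2 ler_wpM2l// ler_wpM2r ?(ltW lq)//.
  by rewrite ler_nat.
have S20 : 0 <= S2 by exact: sqr_ge0.
have D0 : 0 < D by rewrite ltr_wpDr// divr_ge0// ltW.
have Zk k m : \sum_(n < m | in_block k n) sq n <= D * e k.
  have [kk|kk] := leqP k0 k.
    apply: (le_trans (hk k kk m)); rewrite -/(e k) ler_peMl ?(ltW (e0 k))// /D lerDl.
    by rewrite divr_ge0// ltW.
  apply: (le_trans (sq_sum_le m (in_block k))); rewrite -/S2 /D mulrDl mul1r.
  apply: (@le_trans _ _ (S2 / e k0 * e k)); last by rewrite lerDr ltW.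
  by rewrite -mulrA ler_peMr// ler_pdivlMl// mulr1 ek// ltnW.
have /choice[K KP] := block_ex.
pose rho := expR (- (2 * ((t - g) * ln q))).
have rho0 : 0 < rho by exact: expR_gt0.
have rho1 : rho < 1.
  by rewrite /rho -expR0 ltr_expR oppr_lt0 mulr_gt0// mulr_gt0// subr_gt0.
pose W := D * q `^ (2 * g) * (1 - rho)^-1.
have W0 : 0 < W by rewrite !mulr_gt0 ?powR_gt0// invr_gt0 subr_gt0.
exists W => // m.
pose B := (\max_(n < m) K n).+1.
have KB (n : 'I_m) : (K n < B)%N by rewrite ltnS; exact: (@leq_bigmax _ (fun n : 'I_m => K n)).
have -> : \sum_(n < m) sq n * lam n `^ (2 * g) =
    \sum_(k < B) \sum_(n < m | in_block k n) sq n * lam n `^ (2 * g).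
  under [RHS]eq_bigr do rewrite big_mkcond.
  rewrite exchange_big /=; apply: eq_bigr => n _.
  rewrite (bigD1 (Ordinal (KB n))) //= KP big1 ?addr0// => k kN.
  rewrite ifF//; apply/negbTE/negP => h; move/eqP: kN; apply; apply/val_inj => /=.
  exact: block_uniq h (KP n).
apply: (@le_trans _ _ (\sum_(k < B) D * q `^ (2 * g) * rho ^+ k)).
  apply: ler_sum => k _.
  apply: (@le_trans _ _ (\sum_(n < m | in_block k n) sq n * q `^ (2 * g * k.+1%:R))).
    apply: ler_sum => n /andP[_ h]; rewrite ler_wpM2l ?sqr_ge0//.
    have -> : q `^ (2 * g * k.+1%:R) = (q ^+ k.+1) `^ (2 * g).
      by rewrite -powR_mulrn ?(ltW q0)// -powRrM mulrC.
    apply: ge0_ler_powR; rewrite ?nnegrE ?mulr_ge0//.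
    - by apply: le_trans (lam1 n).
    - by rewrite exprn_ge0// ltW.
    - exact: ltW.
  rewrite -mulr_suml; apply: (@le_trans _ _ (D * e k * q `^ (2 * g * k.+1%:R))).
    by rewrite ler_wpM2r ?powR_ge0.
  rewrite le_eqVlt; apply/orP; left; apply/eqP; rewrite -(mulrA D) -(mulrA D); congr (D * _).
  rewrite eE /rho /powR gt_eqF// -!expRM_natl -!expRD; congr expR.
  rewrite -natr1; ring.
rewrite -mulr_sumr /W ler_wpM2l; first by [].
  by rewrite mulr_ge0 ?powR_ge0// ltW.
have := @geometric_le_lim R B 1 rho ler01 rho0; rewrite ger0_norm ?(ltW rho0)// => /(_ rho1).
rewrite mul1r /series /= big_mkord; apply: le_trans.
by apply: ler_sum => k _; rewrite mul1r.
Qed.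
End blocks.

(** * Increments of the series between two points *)

Section increments.
Context d {T : measurableType d} {R : realType} (P : probability T R).
Variable theta : nat -> {RV P >-> R}.
Hypothesis theta_indep : mutually_independent theta.
Hypothesis theta_unif : forall n, uniform01 (theta n).
Variables (a : nat -> R[i]) (phi : nat -> R -> R[i]) (lam : nat -> R) (q M L delta : R).
Hypothesis phiM : forall n x, modulus (phi n x) <= M.
Hypothesis L1 : 1 <= L.
Hypothesis delta0 : 0 < delta.
Hypothesis phiL : forall n x y, `|x - y| <= delta ->
  L^-1 * `|x - y| <= modulus (phi n x - phi n y) <= L * `|x - y|.
Hypothesis asum : (\sum_(0 <= n <oo) (modulus (a n))%:E < +oo)%E.
Hypothesis q1 : 1 < q.
Hypothesis lam1 : forall n, 1 <= lam n.
Local Notation V := (measurableTypeR R).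
Local Notation rtail := (rtail a M).

Definition Sr w x : R := complex.Re (rseries a phi lam (fun n => theta n w) x).
Definition Si w x : R := complex.Im (rseries a phi lam (fun n => theta n w) x).

Lemma L_gt0 : 0 < L. Proof. by apply: lt_le_trans L1. Qed.

Lemma coef_lip n x y : lam n * `|x - y| <= delta ->
  modulus (coef a phi lam n x - coef a phi lam n y) <= modulus (a n) * (L * (lam n * `|x - y|)).
Proof.
move=> h; have l0 : 0 <= lam n by apply: le_trans (lam1 n).
rewrite /coef -mulrBr modulusM ler_wpM2l ?modulus_ge0//.
have e : `|lam n * x - lam n * y| = lam n * `|x - y| by rewrite -mulrBr normrM ger0_norm.
by rewrite -e; have /andP[] := @phiL n (lam n * x) (lam n * y) (eq_ind_r (fun z => z <= delta) h e).
Qed.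

Lemma lip_continuous (f : R -> R) (c e : R) : 0 < e -> 0 <= c ->
  (forall x y, `|x - y| <= e -> `|f x - f y| <= c * `|x - y|) -> continuous f.
Proof.
move=> e0 c0 h x; apply/cvgrPdist_lt => eps eps0.
have m0 : 0 < Num.min e (eps / (c + 1)) by rewrite lt_min e0 divr_gt0// ltr_wpDl.
near=> y.
have xy : `|x - y| < Num.min e (eps / (c + 1)).
  by near: y; move: m0; move: (Num.min _ _) => m m0; exact: cvgr_dist_lt.
move: xy; rewrite lt_min => /andP[/ltW /h xy1]; rewrite ltr_pdivlMr ?ltr_wpDl// => xy2.
apply: le_lt_trans xy1 _; apply: le_lt_trans xy2.
by rewrite mulrC ler_wpM2l// lerDl.
Unshelve. all: by end_near. Qed.

Lemma coef_continuous n : continuous (fun x => re_coef a phi lam x n) /\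
  continuous (fun x => im_coef a phi lam x n).
Proof.
have l0 : 0 < lam n by apply: lt_le_trans (lam1 n).
have e0 : 0 < delta / lam n by rewrite divr_gt0.
have c0 : 0 <= modulus (a n) * (L * lam n).
  by rewrite mulr_ge0 ?modulus_ge0// mulr_ge0 ?(ltW l0)// ltW// L_gt0.
split; apply: (lip_continuous e0 c0) => x y; rewrite ler_pdivlMr// mulrC => /coef_lip h.
  apply: (@le_trans _ _ (modulus (coef a phi lam n x - coef a phi lam n y))).
    by apply: le_trans (Re_le_modulus _); rewrite raddfB.
  by rewrite -!mulrA.
apply: (@le_trans _ _ (modulus (coef a phi lam n x - coef a phi lam n y))).
  by apply: le_trans (Im_le_modulus _); rewrite raddfB.
by rewrite -!mulrA.
Qed.

Let partial_re (N : nat) (z : T * V) : R := \sum_(n < N) re_term a phi lam (theta n z.1) z.2 n.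
Let partial_im (N : nat) (z : T * V) : R := \sum_(n < N) im_term a phi lam (theta n z.1) z.2 n.

Lemma measurable_trig_theta (f : R -> R) n : continuous f ->
  measurable_fun [set: T * V] (fun z : T * V => f (2 * pi * theta n z.1)).
Proof.
move=> cf; apply: (measurableT_comp (f := fun t : R => f (2 * pi * t)) (T2 := V)).
  apply: continuous_measurable_fun.
  have := @continuous_trig R id f 1 0 (fun x => @cvg_id _ _) cf.
  by under eq_fun do rewrite addr0 mul1r.
exact: (measurableT_comp (theta_measurable theta n) measurable_fst).
Qed.

Lemma measurable_coef n : measurable_fun [set: T * V] (fun z : T * V => re_coef a phi lam z.2 n) /\
  measurable_fun [set: T * V] (fun z : T * V => im_coef a phi lam z.2 n).
Proof.
have [c1 c2] := coef_continuous n; split.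
  apply: (measurableT_comp (f := fun x : R => re_coef a phi lam x n) (T2 := V)); last exact: measurable_snd.
  exact: continuous_measurable_fun.
apply: (measurableT_comp (f := fun x : R => im_coef a phi lam x n) (T2 := V)); last exact: measurable_snd.
exact: continuous_measurable_fun.
Qed.

Let mpartial_re N : measurable_fun [set: T * V] (partial_re N).
Proof.
apply: measurable_sum => n; apply: measurable_funB; apply: measurable_funM.
- exact: (measurable_coef _).1.
- exact: (measurable_trig_theta _ (@continuous_cos R)).
- exact: (measurable_coef _).2.
- exact: (measurable_trig_theta _ (@continuous_sin R)).
Qed.

Let mpartial_im N : measurable_fun [set: T * V] (partial_im N).
Proof.
apply: measurable_sum => n; apply: measurable_funD; apply: measurable_funM.
- exact: (measurable_coef _).2.
- exact: (measurable_trig_theta _ (@continuous_cos R)).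
- exact: (measurable_coef _).1.
- exact: (measurable_trig_theta _ (@continuous_sin R)).
Qed.

Lemma measurable_Sr : measurable_fun [set: T * V] (fun z => Sr z.1 z.2).
Proof.
apply: (measurable_fun_cvg (h := partial_re)) => // -[w x] _.
apply/cvgrPdist_lt => e e0; have [N hN] := rtail_small phiM asum e0.
exists N => // m /= Nm; apply: le_lt_trans (hN m Nm).
exact: (rseries_approx _ phiM asum (fun n => theta n w) x m).1.
Qed.

Lemma measurable_Si : measurable_fun [set: T * V] (fun z => Si z.1 z.2).
Proof.
apply: (measurable_fun_cvg (h := partial_im)) => // -[w x] _.
apply/cvgrPdist_lt => e e0; have [N hN] := rtail_small phiM asum e0.
exists N => // m /= Nm; apply: le_lt_trans (hN m Nm).
exact: (rseries_approx _ phiM asum (fun n => theta n w) x m).2.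
Qed.

Lemma measurable_Sr_at x : measurable_fun [set: T] (fun w => Sr w x).
Proof.
apply: (measurableT_comp measurable_Sr (g := fun w => (w, x : V))).
by apply: measurable_fun_pair; [exact: measurable_id|exact: measurable_cst].
Qed.

Lemma measurable_Si_at x : measurable_fun [set: T] (fun w => Si w x).
Proof.
apply: (measurableT_comp measurable_Si (g := fun w => (w, x : V))).
by apply: measurable_fun_pair; [exact: measurable_id|exact: measurable_cst].
Qed.

Section two_points.
Variables (x y : R).

Definition dp n := re_coef a phi lam x n - re_coef a phi lam y n.
Definition dq n := im_coef a phi lam x n - im_coef a phi lam y n.

Lemma dpq_sqr n : dp n ^+ 2 + dq n ^+ 2 = modulus (coef a phi lam n x - coef a phi lam n y) ^+ 2.
Proof. by rewrite modulus_sqr !raddfB. Qed.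

Lemma re_sum_approx w N : `|(Sr w x - Sr w y) - re_sum theta dp dq N w| <= 2 * rtail N.
Proof.
have [h1 _] := rseries_approx lam phiM asum (fun n => theta n w) x N.
have [h2 _] := rseries_approx lam phiM asum (fun n => theta n w) y N.
have -> : re_sum theta dp dq N w = \sum_(n < N) re_term a phi lam (theta n w) x n -
    \sum_(n < N) re_term a phi lam (theta n w) y n.
  rewrite /re_sum /trig_sum -sumrB; apply: eq_bigr => n _.
  by rewrite /trig_term /re_term /dp /dq; ring.
move: h1 h2; rewrite /Sr !ler_norml => /andP[? ?] /andP[? ?].
by apply/andP; split; lra.
Qed.

Lemma im_sum_approx w N : `|(Si w x - Si w y) - im_sum theta dp dq N w| <= 2 * rtail N.
Proof.
have [_ h1] := rseries_approx lam phiM asum (fun n => theta n w) x N.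
have [_ h2] := rseries_approx lam phiM asum (fun n => theta n w) y N.
have -> : im_sum theta dp dq N w = \sum_(n < N) im_term a phi lam (theta n w) x n -
    \sum_(n < N) im_term a phi lam (theta n w) y n.
  rewrite /im_sum /trig_sum -sumrB; apply: eq_bigr => n _.
  by rewrite /trig_term /im_term /dp /dq; ring.
move: h1 h2; rewrite /Si !ler_norml => /andP[? ?] /andP[? ?].
by apply/andP; split; lra.
Qed.
End two_points.

Lemma measurable_small x y r : measurable [set w | `|Sr w x - Sr w y| <= r /\ `|Si w x - Si w y| <= r].
Proof.
apply: measurableI; apply: measurable_norm_le; apply: measurable_funB;
  by [exact: measurable_Sr_at|exact: measurable_Si_at].
Qed.

Lemma small_ball (t : R) : 0 <= t -> (tau_exp a lam q < t%:E)%E ->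
  exists C h0 : R, [/\ 0 < C, 0 < h0 <= 1 & forall x y r : R, 0 < `|x - y| <= h0 -> 0 < r ->
  (P [set w | (`|Sr w x - Sr w y| <= r)%R /\ (`|Si w x - Si w y| <= r)%R] <=
     (C * (r / `|x - y| `^ t) ^+ 2)%:E)%E].
Proof.
move=> t0 /(tau_block q1)[k0 hk].
have q0 : 0 < q by apply: lt_trans q1.
have lq : 0 < ln q by exact: ln_gt0.
have [C C0 hC] := anticoncentration theta_indep theta_unif.
(* In the blocks used, lam n * h lies between delta / q^17 and delta, so c1 * |a_n| bounds the
   coefficient of the increment from below. The exponent 17 is sixteen blocks plus one for the
   position of delta / h within its own block. *)
pose c1 := L^-1 * (delta / q ^+ 17).
have c10 : 0 < c1 by rewrite mulr_gt0 ?invr_gt0 ?L_gt0// divr_gt0// exprn_gt0.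
pose c2 := c1 / delta `^ t.
have c20 : 0 < c2 by rewrite divr_gt0// powR_gt0.
exists (C * (2 / c2) ^+ 2), (Num.min 1 (delta / q ^+ (k0 + 17))); split.
- by rewrite mulr_gt0// exprn_gt0// divr_gt0.
- by rewrite lt_min ltr01 divr_gt0 ?exprn_gt0//= ge_min lexx.
move=> x y r; set h := `|x - y| => /andP[h0]; rewrite le_min => /andP[h1 hd] r0.
have dh : q ^+ (k0 + 17) <= delta / h.
  by rewrite ler_pdivlMr// mulrC -ler_pdivlMr// exprn_gt0.
have dh1 : 1 <= delta / h by apply: le_trans dh; rewrite exprn_ege1// ltW.
(* The block lemma for a constant sequence locates delta / h between q^m and q^(m + 1). *)
have [m /andP[m1 m2]] := @block_ex R (fun=> delta / h) q q1 (fun=> dh1) 0%N.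
have mk : (k0 + 17 <= m)%N by rewrite -ltnS -(@ltr_eXn2l _ q)// (le_lt_trans dh).
pose rho := c2 * h `^ t.
have rho0 : 0 < rho by rewrite mulr_gt0// powR_gt0.
have /choice[K KP] := block_ex q1 lam1.
(* The blocks [k, k - 1, .., k - 15] contain the frequencies between
   [delta / (q ^+ 17 * h)] and [delta / h], where [phi n] is bilipschitz. *)
pose k := m.-1; pose blk n := (k - K n)%N.
have jk j : (j < 16)%N -> (k0 <= k - j)%N /\ (j <= k)%N.
  move=> j16; have mj : (k0 + j <= k)%N.
    rewrite /k -ltnS prednK; last by apply: leq_trans mk; rewrite addnS.
    by apply: leq_trans mk; rewrite addnS ltnS leq_add2l ltnW.
  by split; [rewrite leq_subRL ?(leq_trans (leq_addl _ _) mj)// addnC|exact: leq_trans (leq_addl _ _) mj].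
have cge n j : (j < 16)%N -> in_block lam q (k - j) n ->
    c1 * modulus (a n) <= modulus (coef a phi lam n x - coef a phi lam n y).
  move=> j16 /andP[l1 l2]; have [kj jk'] := jk j j16.
  have l0 : 0 < lam n by apply: lt_le_trans (lam1 n).
  have lh : lam n * h <= delta.
    rewrite -ler_pdivlMr//; apply/ltW/(lt_le_trans l2)/(le_trans _ m1).
    rewrite ler_eXn2l// /k; apply: leq_ltn_trans (leq_subr _ _) _.
    by rewrite prednK// (leq_trans _ mk)// addnS.
  have lh2 : delta / q ^+ 17 <= lam n * h.
    rewrite ler_pdivrMr ?exprn_gt0//.
    have -> : delta = delta / h * h by rewrite divfK// gt_eqF.
    rewrite (mulrAC (lam n)) ler_pM2r//; apply/ltW/(lt_le_trans m2).
    apply: (@le_trans _ _ (q ^+ (k - j) * q ^+ 17)); last by rewrite ler_pM2r// exprn_gt0.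
    rewrite -exprD ler_eXn2l// -(leq_add2r j) addnAC subnK//.
    have -> : (m.+1 = k + 2)%N by rewrite addn2 prednK// (leq_trans _ mk)// addnS.
    by rewrite -(addnA k) leq_add2l.
  rewrite /coef -mulrBr modulusM mulrC; apply: ler_wpM2l; first exact: modulus_ge0.
  have e : `|lam n * x - lam n * y| = lam n * h by rewrite -mulrBr normrM ger0_norm// ltW.
  have /andP[le1 _] := @phiL n (lam n * x) (lam n * y) (eq_ind_r (fun z => z <= delta) lh e).
  by apply: le_trans le1; rewrite e /c1 ler_wpM2l// invr_ge0 ltW// L_gt0.
have rE : rho <= c1 * expR (- (t * (k%:R * ln q))).
  rewrite /rho /c2 -mulrA; apply: ler_wpM2l; first exact: ltW.
  rewrite mulrC -ler_pdivlMr ?invr_gt0 ?powR_gt0// invrK.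
  have -> : expR (- (t * (k%:R * ln q))) = (q ^- k) `^ t.
    by rewrite /powR gt_eqF ?invr_gt0 ?exprn_gt0// lnV ?posrE ?exprn_gt0// lnXn// mulrN mulr_natl.
  rewrite -powRM ?invr_ge0 ?exprn_ge0 ?(ltW q0) ?(ltW delta0)//.
  apply: ge0_ler_powR; rewrite ?nnegrE ?mulr_ge0 ?invr_ge0 ?exprn_ge0 ?(ltW h0) ?(ltW q0) ?(ltW delta0)//.
  rewrite ler_pdivlMl ?exprn_gt0//.
  have : q ^+ k <= delta / h by apply: le_trans m1; rewrite ler_eXn2l// leq_pred.
  by rewrite ler_pdivlMr.
have /choice[Nj hNj] : forall j, exists N, (j < 16)%N -> forall n, (N <= n)%N ->
    expR (- (t * ((k - j)%:R * ln q))) ^+ 2 <= \sum_(i < n | in_block lam q (k - j) i) modulus (a i) ^+ 2.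
  move=> j; case: (ltnP j 16) => [j16|_]; last by exists 0%N.
  by have [N hN] := hk _ (jk j j16).1; exists N.
(* Remainders below r / 2 at both points change the increment by less than r; hence the radius 2 r
   for the finite sum. *)
have [N0 hN0] := rtail_small phiM asum (divr_gt0 r0 (ltr0Sn R 1)).
pose N := maxn N0 (\max_(j < 16) Nj j).
have NN (j : 'I_16) : (Nj j <= N)%N by rewrite leq_max (@leq_bigmax _ (fun j : 'I_16 => Nj j)) orbT.
(* Truncated subtraction also sends the blocks beyond [k] to class 0. This only adds mass, and a
   lower bound is wanted. *)
have mass j : (j < 16)%N -> rho ^+ 2 <= block_mass (dp x y) (dq x y) N blk j.
  move=> j16; apply: (@le_trans _ _ (c1 ^+ 2 * expR (- (t * ((k - j)%:R * ln q))) ^+ 2)).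
    rewrite -exprMn ler_pXn2r ?nnegrE ?(ltW rho0) ?(mulr_ge0 (ltW c10) (expR_ge0 _))//.
    apply: (le_trans rE); rewrite ler_wpM2l ?(ltW c10)// ler_expR lerN2 ler_wpM2l// ler_wpM2r ?(ltW lq)//.
    by rewrite ler_nat leq_subr.
  have hj := hNj j j16 N (NN (Ordinal j16)).
  move: hj; set E := expR _ ^+ 2; set Z := (\sum_(i < N | _) _) => hj.
  apply: (@le_trans _ _ (c1 ^+ 2 * Z)); first by rewrite ler_wpM2l// sqr_ge0.
  rewrite /Z.
  rewrite /block_mass mulr_sumr big_mkcond [leRHS]big_mkcond /=; apply: ler_sum => n _.
  case: ifP => [bl|_]; last by case: ifP => // _; rewrite addr_ge0 ?sqr_ge0.
  have -> : blk n = j.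
    by rewrite /blk -(block_uniq q1 bl (KP n)) subKn// (jk j j16).2.
  rewrite eqxx dpq_sqr -exprMn ler_pXn2r ?nnegrE ?modulus_ge0 ?(mulr_ge0 (ltW c10) (modulus_ge0 _))//.
  exact: cge bl.
have r20 : 0 < 2 * r by rewrite mulr_gt0.
apply: (@le_trans _ _ (P [set w | `|re_sum theta (dp x y) (dq x y) N w| <= 2 * r /\
    `|im_sum theta (dp x y) (dq x y) N w| <= 2 * r])).
  apply: le_measure; rewrite ?inE; first exact: measurable_small.
    by apply: measurableI; apply: measurable_norm_le; exact: trig_sum_measurable.
  move=> w /= [w1 w2]; have hr : rtail N < r / 2 by apply: hN0; rewrite leq_maxl.
  have := re_sum_approx x y w N; have := im_sum_approx x y w N.
  move: w1 w2; rewrite !ler_norml => /andP[? ?] /andP[? ?] /andP[? ?] /andP[? ?].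
  by split; apply/andP; split; lra.
apply: le_trans (hC _ _ N rho (2 * r) blk rho0 r20 mass) _.
rewrite lee_fin /rho le_eqVlt; apply/orP; left; apply/eqP.
have ht : h `^ t != 0 by rewrite gt_eqF// powR_gt0.
by field; rewrite ht gt_eqF.
Qed.

(** Interpolation: with v = lam n * |x - y| / delta, the Lipschitz bound applies for v <= 1, where v
    <= v^g, and the uniform bound 2 M for v > 1, where 1 <= v^g. *)
Lemma coef_increment (g : R) : 0 <= g <= 1 -> exists2 B, 0 < B & forall n x y,
  modulus (coef a phi lam n x - coef a phi lam n y) <= modulus (a n) * (B * (lam n * `|x - y|) `^ g).
Proof.
move=> /andP[g0 g1]; have M0 : 0 <= M by apply: le_trans (phiM 0%N 0); exact: modulus_ge0.
have Ld : 0 < L * delta by rewrite mulr_gt0// L_gt0.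
have dg : 0 < delta `^ g by exact: powR_gt0.
exists ((L * delta + 2 * M) / delta `^ g); first by rewrite divr_gt0// ltr_pwDl// mulr_ge0.
move=> n x y; have l0 : 0 <= lam n by apply: le_trans (lam1 n).
have u0 : 0 <= lam n * `|x - y| by rewrite mulr_ge0.
have -> : (L * delta + 2 * M) / delta `^ g * (lam n * `|x - y|) `^ g =
    (L * delta + 2 * M) * (lam n * `|x - y| / delta) `^ g.
  have -> : (lam n * `|x - y| / delta) `^ g = (lam n * `|x - y|) `^ g / delta `^ g.
    rewrite (powRM _ u0) ?invr_ge0 ?(ltW delta0)//; congr (_ * _).
    by rewrite /powR !gt_eqF ?invr_gt0// lnV ?posrE// mulrN expRN.
  by rewrite mulrA mulrAC.
have [ud|ud] := leP (lam n * `|x - y|) delta.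
  apply: (le_trans (coef_lip ud)); rewrite ler_wpM2l ?modulus_ge0//.
  move: u0; rewrite le_eqVlt => /predU1P[<-|u0].
    by rewrite mulr0 mulr_ge0 ?powR_ge0// addr_ge0 ?(ltW Ld)// mulr_ge0.
  have v01 : 0 < lam n * `|x - y| / delta <= 1 by rewrite divr_gt0//= ler_pdivrMr// mul1r.
  have := ger1_powR v01 g1; move: (lam n * _) u0 v01 ud => u u0 /andP[v0 v1] ud hv.
  rewrite mulrDl; apply: ler_wpDr; first by rewrite mulr_ge0 ?powR_ge0// mulr_ge0.
  have -> : L * u = L * delta * (u / delta) by field; rewrite gt_eqF.
  by rewrite ler_wpM2l// ltW.
rewrite /coef -mulrBr modulusM ler_wpM2l ?modulus_ge0//.
apply: (@le_trans _ _ (2 * M)).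
  apply: le_trans (le_normcD _ _) _; rewrite normcN.
  by have := phiM n (lam n * x); have := phiM n (lam n * y); rewrite /modulus; lra.
apply: (@le_trans _ _ (2 * M * (lam n * `|x - y| / delta) `^ g)); last first.
  by rewrite ler_wpM2r ?powR_ge0// lerDr ltW.
rewrite ler_peMr ?mulr_ge0// -[leLHS](powRr0 (lam n * `|x - y| / delta)) ler_powR//.
by rewrite ler_pdivlMr// mul1r ltW.
Qed.

Lemma increment_mass (g : R) : 0 <= g <= 1 -> (g%:E < sigma_exp a lam q)%E ->
  exists2 W, 0 < W & forall x y N,
  \sum_(n < N) (dp x y n ^+ 2 + dq x y n ^+ 2) <= W * (`|x - y| `^ g) ^+ 2.
Proof.
move=> g01 gs; have [B B0 hB] := coef_increment g01; have /andP[g0 _] := g01.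
have [W W0 hW] := sigma_weight q1 lam1 asum g0 gs.
exists (B ^+ 2 * W); first by rewrite mulr_gt0// exprn_gt0.
move=> x y N; rewrite -mulrA (mulrC W) mulrA.
apply: (@le_trans _ _ (\sum_(n < N) B ^+ 2 * (`|x - y| `^ g) ^+ 2 * (modulus (a n) ^+ 2 * lam n `^ (2 * g)))).
  apply: ler_sum => n _; rewrite dpq_sqr.
  have l0 : 0 <= lam n by apply: le_trans (lam1 n).
  have -> : B ^+ 2 * (`|x - y| `^ g) ^+ 2 * (modulus (a n) ^+ 2 * lam n `^ (2 * g)) =
      (modulus (a n) * (B * (lam n * `|x - y|) `^ g)) ^+ 2.
    by rewrite (mulrC 2) powRrM powR_mulrn ?powR_ge0// powRM//; ring.
  by rewrite ler_pXn2r ?nnegrE ?modulus_ge0 ?(mulr_ge0 (modulus_ge0 _)) ?(mulr_ge0 (ltW B0)) ?powR_ge0//; exact: hB.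
by rewrite -mulr_sumr ler_wpM2l// mulr_ge0 ?sqr_ge0.
Qed.

Lemma increment_tail (g : R) : 0 <= g <= 1 -> (g%:E < sigma_exp a lam q)%E ->
  exists2 W, 0 < W & forall x y v, 0 < `|x - y| -> 0 < v ->
  (P [set w | (v < `|Sr w x - Sr w y|)%R] <= (2 * expR (- (v ^+ 2 / (W * (`|x - y| `^ g) ^+ 2))))%:E)%E /\
  (P [set w | (v < `|Si w x - Si w y|)%R] <= (2 * expR (- (v ^+ 2 / (W * (`|x - y| `^ g) ^+ 2))))%:E)%E.
Proof.
move=> g01 gs; have [W W0 hW] := increment_mass g01 gs.
(* The remainders take less than half of v, and the Chernoff exponent at v / 2 is v^2 / (32 W
   h^2). *)
exists (32 * W); first by rewrite mulr_gt0.
move=> x y v xy v0; set h := `|x - y| `^ g; have hh : 0 < h by exact: powR_gt0.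
have h0 : 0 < h ^+ 2 by exact: exprn_gt0.
have [N hN] := rtail_small phiM asum (divr_gt0 v0 (ltr0Sn R 3)); have {}hN := hN N (leqnn N).
have gen (f : T -> R) (A B : nat -> R) : measurable_fun setT f ->
    (forall w, `|f w - trig_sum theta A B N w| <= 2 * rtail N) ->
    (forall n, A n ^+ 2 + B n ^+ 2 = dp x y n ^+ 2 + dq x y n ^+ 2) ->
    (P [set w | (v < `|f w|)%R] <= (2 * expR (- (v ^+ 2 / (32 * W * h ^+ 2))))%:E)%E.
  move=> mf fA ABE.
  have half (A' B' : nat -> R) : (forall n, A' n ^+ 2 + B' n ^+ 2 = dp x y n ^+ 2 + dq x y n ^+ 2) ->
      (P [set w | (v / 2 <= trig_sum theta A' B' N w)%R] <= (expR (- (v ^+ 2 / (32 * W * h ^+ 2))))%:E)%E.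
    move=> E; have W20 : 0 < W * h ^+ 2 by rewrite mulr_gt0.
    have v20 : 0 <= v / 2 by lra.
    have s : \sum_(i < N) amp A' B' i ^+ 2 <= W * h ^+ 2.
      apply: le_trans (hW x y N); apply: ler_sum => n _.
      by rewrite /amp sqr_sqrtr ?addr_ge0 ?sqr_ge0// E.
    apply: le_trans (trig_sum_tail theta_indep theta_unif W20 v20 s) _.
    rewrite lee_fin ler_expR lerN2 le_eqVlt; apply/orP; left; apply/eqP.
    by field; rewrite !gt_eqF.
  have mT (A' B' : nat -> R) : measurable [set w | v / 2 <= trig_sum theta A' B' N w].
    rewrite (_ : [set w | _] = trig_sum theta A' B' N @^-1` `[v / 2, +oo[); last first.
      by apply/seteqP; split=> w /=; rewrite in_itv /= andbT.
    by rewrite -[X in measurable X]setTI; apply: trig_sum_measurable => //; exact: measurable_itv.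
  apply: (@le_trans _ _ (P ([set w | v / 2 <= trig_sum theta A B N w] `|`
      [set w | v / 2 <= trig_sum theta (fun n => - A n) (fun n => - B n) N w]))).
    apply: le_measure; rewrite ?inE; last 1 first.
    - move=> w /= vw; have e : trig_sum theta (fun n => - A n) (fun n => - B n) N w = - trig_sum theta A B N w.
        by rewrite /trig_sum -sumrN; apply: eq_bigr => n _; rewrite /trig_term; ring.
      rewrite e; have := fA w; move: vw; rewrite ltr_normr ler_norml => /orP[vw|vw] /andP[? ?].
        by left; lra.
      by right; lra.
    - rewrite (_ : [set w | _] = (fun w => `|f w|) @^-1` `]v, +oo[); last first.
        by apply/seteqP; split=> w /=; rewrite in_itv /= andbT.
      rewrite -[X in measurable X]setTI; apply: measurableT_comp => //; exact: measurable_itv.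
    - by apply: measurableU; exact: mT.
  apply: le_trans (measureU2 _ (mT _ _) (mT _ _)) _.
  rewrite (_ : 2 * _ = expR (- (v ^+ 2 / (32 * W * h ^+ 2))) + expR (- (v ^+ 2 / (32 * W * h ^+ 2)))); last by ring.
  by rewrite EFinD; apply: leeD; apply: half => // n; rewrite !sqrrN.
split.
  apply: (gen _ (dp x y) (fun i => - dq x y i)).
  - by apply: measurable_funB; exact: measurable_Sr_at.
  - by move=> w; exact: re_sum_approx.
  - by move=> n; rewrite sqrrN.
apply: (gen _ (dq x y) (dp x y)).
- by apply: measurable_funB; exact: measurable_Si_at.
- by move=> w; exact: im_sum_approx.
- by move=> n; rewrite addrC.
Qed.
End increments.

(** * Holder regularity *)

Section dyadic_chaining.
Context {R : realType}.
Variables (f : R -> R) (D : nat) (gam : R) (j0 : nat).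
Hypothesis gam0 : 0 < gam.
Hypothesis cf : continuous f.
Let be : R := 2 `^ (- gam).
Hypothesis inc : forall j k, (j0 <= j)%N -> (k < D * 2 ^ j)%N ->
  `|f (k.+1%:R * 2 ^- j) - f (k%:R * 2 ^- j)| <= be ^+ j.

Let be0 : 0 < be. Proof. exact: powR_gt0. Qed.

Let be1 : be < 1.
Proof. by rewrite /be /powR gt_eqF// mulNr expR_lt1 oppr_lt0 mulr_gt0// ln_gt0// ltr1n. Qed.

Let beX n : be ^+ n = (2 ^- n) `^ gam.
Proof.
rewrite /powR gt_eqF ?invr_gt0 ?exprn_gt0// lnV ?posrE ?exprn_gt0// lnXn// /be /powR gt_eqF//.
by rewrite -expRM_natl; congr expR; rewrite -mulr_natl; ring.
Qed.

Let K (u : R) j := Num.truncn (u * 2 ^+ j).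
Let pt (u : R) j : R := (K u j)%:R * 2 ^- j.

Let e0 j : 0 < 2 ^- j :> R. Proof. by rewrite invr_gt0 exprn_gt0. Qed.
Let p0 j : 0 < 2 ^+ j :> R. Proof. by rewrite exprn_gt0. Qed.

Let K_itv u j : 0 <= u -> (K u j)%:R <= u * 2 ^+ j < (K u j).+1%:R.
Proof. by move=> u0; rewrite truncn_itv// mulr_ge0// ltW. Qed.

Let K_lt u j : 0 <= u < D%:R -> (K u j < D * 2 ^ j)%N.
Proof.
move=> /andP[u0 uD]; have /andP[h _] := K_itv j u0; rewrite -(ltr_nat R); apply: le_lt_trans h _.
by rewrite natrM natrX ltr_pM2r.
Qed.

Let pt_step u j : 0 <= u < D%:R -> (j0 <= j)%N -> `|f (pt u j.+1) - f (pt u j)| <= be ^+ j.+1.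
Proof.
move=> uD jj; have /andP[u0 _] := uD; have /andP[k1 k2] := K_itv j u0.
have m0 : 0 <= u * 2 ^+ j.+1 by rewrite mulr_ge0// ltW.
have h1 : (2 * K u j <= K u j.+1)%N by rewrite /K truncn_ge_nat// natrM exprS mulrCA ler_pM2l.
have h2 : (K u j.+1 < 2 * (K u j).+1)%N by rewrite /K truncn_lt_nat// natrM exprS mulrCA ltr_pM2l.
have ptE : pt u j = (2 * K u j)%:R * 2 ^- j.+1.
  by rewrite /pt natrM exprS invfM mulrACA mulfV// mul1r.
have K2 : (2 * K u j < D * 2 ^ j.+1)%N := leq_ltn_trans h1 (K_lt j.+1 uD).
have : (K u j.+1 == 2 * K u j)%N || (K u j.+1 == (2 * K u j).+1)%N.
  by move: h1 h2; rewrite mulnS add2n ltnS leq_eqVlt => /predU1P[->|h]; rewrite ?eqxx//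
    [(_ <= _.+1)%N]leq_eqVlt ltnS leqNgt h orbF => ->; rewrite orbT.
rewrite ptE {1}/pt => /orP[]/eqP ->; first by rewrite subrr normr0 exprn_ge0// ltW.
by apply: inc => //; exact: leqW.
Qed.

Let pt_chain u n m : 0 <= u < D%:R -> (j0 <= n)%N ->
  `|f (pt u (n + m)) - f (pt u n)| <= (be ^+ n - be ^+ (n + m)) / (1 - be).
Proof.
move=> uD jn; elim: m => [|m IH]; first by rewrite addn0 !subrr normr0 mul0r.
have b1 : 1 - be != 0 by rewrite gt_eqF// subr_gt0.
have := pt_step uD (leq_trans jn (leq_addr m n)); rewrite addnS => h.
apply: le_trans (ler_distD (f (pt u (n + m))) _ _) _; apply: le_trans (lerD h IH) _.
have -> : (be ^+ n - be ^+ (n + m).+1) / (1 - be) = be ^+ (n + m) + (be ^+ n - be ^+ (n + m)) / (1 - be).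
  by rewrite exprS; field.
by rewrite lerD2r exprS ler_piMl ?exprn_ge0 ?(ltW be0)// ltW.
Qed.

Let pt_lim u n : 0 <= u < D%:R -> (j0 <= n)%N -> `|f u - f (pt u n)| <= be ^+ n / (1 - be).
Proof.
move=> uD jn; apply/ler_addgt0Pr => e epos.
have /cvgrPdist_lt/(_ _ epos) := cf (x := u); rewrite near_nbhs => /nbhs_ballP[dl /= dl0 hd].
have [m _ /(_ m (leqnn m))] : \forall m \near \oo, `|(0 : R) - (2^-1) ^+ m| < dl.
  have : (fun m => (2^-1 : R) ^+ m) @ \oo --> (0 : R).
    by apply: cvg_expr; rewrite ger0_norm// invf_lt1// ltr1n.
  by move/cvgrPdist_lt => /(_ _ dl0).
rewrite sub0r normrN ger0_norm ?exprn_ge0// exprVn => hm.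
have /andP[u0 _] := uD; have /andP[k1 k2] := K_itv (n + m) u0.
have hb : `|f u - f (pt u (n + m))| < e.
  apply: hd => /=; rewrite /ball /= ger0_norm; last first.
    by rewrite subr_ge0 /pt ler_pdivrMr.
  apply: le_lt_trans hm; apply: (@le_trans _ _ (2 ^- (n + m))).
    rewrite lerBlDl /pt -[X in _ + X]mul1r -mulrDl ler_pdivlMr// natr1; exact: ltW.
  by rewrite lef_pV2 ?posrE// ler_weXn2l ?ler1n// leq_addl.
have := pt_chain m uD jn; have := ler_distD (f (pt u (n + m))) (f u) (f (pt u n)).
have : (be ^+ n - be ^+ (n + m)) / (1 - be) <= be ^+ n / (1 - be).
  by rewrite ler_pM2r ?invr_gt0 ?subr_gt0// gerBl exprn_ge0// ltW.
move: hb; lra.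
Qed.

Let pt_near u v n : 0 <= u < D%:R -> 0 <= v < D%:R -> (j0 <= n)%N -> `|u - v| <= 2 ^- n ->
  `|f (pt u n) - f (pt v n)| <= be ^+ n.
Proof.
wlog uv : u v / u <= v.
  move=> H uD vD jn h; have [uv|/ltW uv] := leP u v; first exact: H.
  by rewrite distrC; apply: H => //; rewrite distrC.
move=> uD vD jn; rewrite distrC ger0_norm ?subr_ge0// => h.
have /andP[u0 _] := uD; have /andP[v0 _] := vD.
have /andP[k1 k2] := K_itv n u0; have /andP[l1 l2] := K_itv n v0.
have h1 : (K u n <= K v n)%N by rewrite /K le_truncn// ler_pM2r.
have h2 : (K v n < (K u n).+2)%N.
  rewrite {1}/K truncn_lt_nat; last by rewrite mulr_ge0// ltW.
  have : (v - u) * 2 ^+ n <= 1 by rewrite -ler_pdivlMr// mul1r.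
  by move: k2; rewrite -!natr1; lra.
have : (K v n == K u n) || (K v n == (K u n).+1).
  by move: h1 h2; rewrite ltnS leq_eqVlt => /predU1P[->|h1]; rewrite ?eqxx//
    [(_ <= _.+1)%N]leq_eqVlt ltnS leqNgt h1 orbF => ->; rewrite orbT.
rewrite distrC /pt => /orP[]/eqP ->; first by rewrite subrr normr0 exprn_ge0// ltW.
by apply: inc => //; exact: K_lt.
Qed.

(** The dyadic points of level n to the left of u and v are equal or adjacent. From each of them the
    finer dyadic approximations lead to u or v through steps that form a geometric series. *)
Lemma chaining u v n r : 0 <= u < D%:R -> 0 <= v < D%:R -> (j0 <= n)%N ->
  2 ^- n.+1 < r <= 2 ^- n -> `|u - v| <= r ->
  `|f u - f v| <= (1 + 2 / (1 - be)) * 2 `^ gam * r `^ gam.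
Proof.
move=> uD vD jn /andP[r1 r2] uv.
have h1 := pt_lim uD jn; have h2 := pt_lim vD jn; have h3 := pt_near uD vD jn (le_trans uv r2).
apply: (@le_trans _ _ (be ^+ n * (1 + 2 / (1 - be)))).
  rewrite distrC in h2.
  have := ler_distD (f (pt u n)) (f u) (f v); have := ler_distD (f (pt v n)) (f (pt u n)) (f v).
  have -> : be ^+ n * (1 + 2 / (1 - be)) = be ^+ n + 2 * (be ^+ n / (1 - be)) by ring.
  move: h1 h2 h3; move: (be ^+ n) (be ^+ n / _) => b z. lra.
rewrite mulrC -mulrA; apply: ler_wpM2l.
  by rewrite addr_ge0// divr_ge0// subr_ge0 ltW.
have r0 : 0 <= r by rewrite ltW// (lt_trans _ r1).
rewrite -powRM// beX; apply: ge0_ler_powR; rewrite ?nnegrE ?mulr_ge0 ?(ltW gam0) ?(ltW (e0 n))//.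
by apply/ltW; move: r1; rewrite exprS invfM mulrC ltr_pdivrMr// mulrC.
Qed.
End dyadic_chaining.

(** * Almost sure Holder continuity from subgaussian increments *)

Section kolmogorov.
Context d {T : measurableType d} {R : realType} (P : probability T R).
Variables (X : T -> R -> R) (K W g : R).
Hypothesis mX : forall x, measurable_fun [set: T] (X ^~ x).
Hypothesis XK : forall w x, `|X w x| <= K.
Hypothesis cX : forall w, continuous (X w).
Hypothesis W0 : 0 < W.
Hypothesis X_tail : forall x y v, 0 < `|x - y| -> 0 < v ->
  (P [set w | (v < `|X w x - X w y|)%R] <= (2 * expR (- (v ^+ 2 / (W * (`|x - y| `^ g) ^+ 2))))%:E)%E.

(** Polynomial decay of any order, enough to beat the number of dyadic nodes. *)
Lemma expRN_le (z : R) m : 0 < z -> expR (- z) <= (m.+1%:R / z) ^+ m.+1.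
Proof.
move=> z0; have zm : 0 < z / m.+1%:R by rewrite divr_gt0.
rewrite -[m.+1%:R / z]invrK invf_div exprVn expRN lef_pV2 ?posrE ?expR_gt0 ?exprn_gt0//.
have -> : expR z = expR (z / m.+1%:R) ^+ m.+1 by rewrite -expRM_natl mulrC divfK// pnatr_eq0.
rewrite ler_pXn2r ?nnegrE ?expR_ge0 ?(ltW zm)//.
by apply: le_trans (expR_ge1Dx _); rewrite lerDr.
Qed.

Variables (gam : R) (B : nat).
Hypothesis gam0 : 0 < gam.
Hypothesis gamg : gam < g.

(** Translation by B sends [-B, B] into [0, D), right end point included. *)
Let D := (2 * B.+1)%N.
Let be : R := 2 `^ (- gam).
Let node j k : R := k%:R * 2 ^- j - B%:R.
Let jump j k := [set w | be ^+ j < `|X w (node j k.+1) - X w (node j k)|].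
Let bad j := \big[setU/set0]_(k < D * 2 ^ j) jump j k.

Let mjump j k : measurable (jump j k).
Proof.
rewrite (_ : jump j k = (fun w => `|X w (node j k.+1) - X w (node j k)|) @^-1` `]be ^+ j, +oo[); last first.
  by apply/seteqP; split=> w /=; rewrite in_itv /= andbT.
have mh : measurable_fun [set: T] (fun w => `|X w (node j k.+1) - X w (node j k)|).
  by apply: measurableT_comp => //; apply: measurable_funB; exact: mX.
by rewrite -[X in measurable X]setTI; apply: mh => //; exact: measurable_itv.
Qed.

Let mbad j : measurable (bad j).
Proof. by apply: bigsetU_measurable => k _; exact: mjump. Qed.

Let bad_le : exists2 C : R, 0 <= C & forall j, (P (bad j) <= (C * 2 ^- j)%:E)%E.
Proof.
pose b : R := 2 `^ (2 * (g - gam)).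
have b1 : 1 < b by rewrite /b /powR gt_eqF// expR_gt1 mulr_gt0 ?ln_gt0 ?ltr1n// mulr_gt0// subr_gt0.
have b0 : 0 < b by apply: lt_trans b1.
(* A jump at level j then has probability O(4^-j), and there are of order 2^j nodes, which leaves a
   summable 2^-j. *)
have [m hm] : exists m, 4 <= b ^+ m.+1.
  have : (fun m => (b^-1 : R) ^+ m) @ \oo --> (0 : R).
    by apply: cvg_expr; rewrite ger0_norm ?invf_lt1// invr_ge0 ltW.
  have e : 0 < 4^-1 :> R by rewrite invr_gt0.
  move/cvgrPdist_lt => /(_ _ e)[m _ /(_ m.+1 (leqnSn m))].
  rewrite sub0r normrN ger0_norm ?exprn_ge0 ?invr_ge0 ?(ltW b0)// exprVn ltf_pV2 ?posrE ?exprn_gt0// => /ltW h.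
  by exists m.
pose c : R := (m.+1%:R * W) ^+ m.+1.
have c0 : 0 < c by rewrite exprn_gt0// mulr_gt0.
have jump_le j k : (P (jump j k) <= (2 * c * 4 ^- j)%:E)%E.
  have dE : `|node j k.+1 - node j k| = 2 ^- j.
    have -> : node j k.+1 - node j k = 2 ^- j by rewrite /node -natr1; ring.
    by rewrite ger0_norm// invr_ge0 exprn_ge0.
  have n0 : 0 < `|node j k.+1 - node j k| by rewrite dE invr_gt0 exprn_gt0.
  have v0 : 0 < be ^+ j by rewrite exprn_gt0// powR_gt0.
  apply: le_trans (X_tail n0 v0) _; rewrite lee_fin dE -mulrA ler_pM2l//.
  have -> : (be ^+ j) ^+ 2 / (W * ((2 ^- j) `^ g) ^+ 2) = b ^+ j / W.
    rewrite invfM mulrCA mulrC; congr (_ / _).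
    rewrite /b /be /powR !gt_eqF ?invr_gt0 ?exprn_gt0// lnV ?posrE ?exprn_gt0// lnXn//.
    by rewrite -!expRM_natl -expRN -expRD; congr expR; rewrite -mulr_natl; ring.
  have z0 : 0 < b ^+ j / W by rewrite divr_gt0// exprn_gt0.
  apply: le_trans (expRN_le m z0) _.
  rewrite invf_div mulrA exprMn -/c ler_pM2l// exprVn lef_pV2 ?posrE ?exprn_gt0//.
  by rewrite -exprM mulnC exprM lerXn2r ?nnegrE ?exprn_ge0 ?(ltW b0).
exists (D%:R * (2 * c)); first by rewrite mulr_ge0// mulr_ge0// ltW.
move=> j; apply: (@le_trans _ _ (\sum_(k < D * 2 ^ j) P (jump j k))%E).
  by apply: Boole_inequality => k _; exact: mjump.
apply: (@le_trans _ _ (\sum_(k < D * 2 ^ j) (2 * c * 4 ^- j)%:E)%E); first by apply: lee_sum => k _.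
rewrite sumEFin sumr_const card_ord lee_fin -[_ *+ (D * _)]mulr_natl (natrM _ D) natrX.
rewrite le_eqVlt; apply/orP; left; apply/eqP.
rewrite (_ : (4 : R) = 2 * 2) ?exprMn; last by ring.
by field; rewrite expf_eq0 pnatr_eq0 andbF.
Qed.

(** By Borel-Cantelli almost every path has no bad level from some random [j0] on, and chaining
    applies at the scales below 2^-j0. *)
Lemma kolmogorov_holder : {ae P, forall w, exists2 C, 0 <= C &
  holder_on [set x | `|x| <= B%:R] gam C (X w)}.
Proof.
have [C C0 hC] := bad_le.
have null : P (lim_sup_set bad) = 0%E.
  apply: lim_sup_set_cvg0 => //.
  apply: (@le_lt_trans _ _ (\sum_(0 <= j <oo) (C * 2 ^- j)%:E)%E).
    apply: lee_nneseries => [j _ _|j _]; first exact: measure_ge0.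
    exact: hC.
  apply: (@le_lt_trans _ _ (C * 2)%:E); last exact: ltry.
  apply: lime_le.
    by apply: is_cvg_nneseries => n _ _; rewrite lee_fin mulr_ge0// invr_ge0 exprn_ge0.
  apply: nearW => n; rewrite sumEFin lee_fin -mulr_sumr ler_wpM2l// big_mkord.
  have h2 : `|2^-1 : R| < 1 by rewrite ger0_norm// invf_lt1// ltr1n.
  have h3 : (0 : R) < 2^-1 by rewrite invr_gt0.
  have := @geometric_le_lim R n 1 2^-1 ler01 h3 h2.
  rewrite mul1r /series /= big_mkord (_ : (1 - 2^-1)^-1 = 2 :> R); last by field.
  apply: le_trans.
  by apply: ler_sum => k _; rewrite mul1r exprVn.
exists (lim_sup_set bad); split => //.
  by apply: bigcap_measurable => // n _; apply: bigcup_measurable.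
move=> w /= h; apply: contrapT => wb; apply: h.
have [j0 hj0] : exists j0, forall j, (j0 <= j)%N -> ~ bad j w.
  apply: contrapT => /forallNP hn; apply: wb => n _.
  by have /existsNP[j /not_implyP[nj /contrapT bj]] := hn n; exists j.
have K0 : 0 <= K by apply: le_trans (XK w 0).
pose f u := X w (u - B%:R).
have cf : continuous f.
  by move=> x; apply: continuous_comp; [apply: cvgB; [exact: cvg_id|exact: cvg_cst]|exact: cX].
have inc j k : (j0 <= j)%N -> (k < D * 2 ^ j)%N ->
    `|f (k.+1%:R * 2 ^- j) - f (k%:R * 2 ^- j)| <= be ^+ j.
  move=> jj kD; rewrite leNgt; apply/negP => lt; apply: (hj0 j jj).
  by rewrite /bad -bigcup_mkord; exists k.
pose C1 := (1 + 2 / (1 - be)) * 2 `^ gam.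
have be1 : be < 1.
  by rewrite /be /powR gt_eqF// mulNr expR_lt1 oppr_lt0 mulr_gt0// ln_gt0// ltr1n.
have C10 : 0 <= C1 by rewrite mulr_ge0 ?powR_ge0// addr_ge0// divr_ge0// subr_ge0 ltW.
(* Serves the scales above 2^-j0, where only the bound K on the path is used. *)
pose C2 := 2 * K * (2 ^+ j0) `^ gam.
have C20 : 0 <= C2 by rewrite mulr_ge0 ?powR_ge0// mulr_ge0.
exists (C1 + C2); first exact: addr_ge0.
move=> x y r xB yB r01 xy; have /andP[r0 r1] := r01.
have [n /andP[n1 n2]] := dyadic_scale r01; rewrite mulrDl.
have [jn|nj] := leqP j0 n.
  apply: ler_wpDr; first by rewrite mulr_ge0 ?powR_ge0.
  have inD (z : R) : `|z| <= B%:R -> 0 <= z + B%:R < D%:R.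
    rewrite ler_norml /D natrM -natr1 => /andP[? ?]; apply/andP; split; lra.
  have := @chaining R f D gam j0 gam0 cf inc (x + B%:R) (y + B%:R) n r (inD x xB) (inD y yB) jn.
  rewrite n1 n2 => /(_ isT); rewrite /f !addrK; apply.
  by rewrite opprD addrACA subrr addr0.
apply: ler_wpDl; first by rewrite mulr_ge0 ?powR_ge0.
apply: (@le_trans _ _ (2 * K)).
  have := XK w x; have := XK w y; have := ler_normB (X w x) (X w y); lra.
rewrite /C2 -mulrA ler_peMr ?mulr_ge0// -powRM ?exprn_ge0 ?(ltW r0)//.
apply: (@le_trans _ _ (1 `^ gam)); first by rewrite powR1.
apply: ge0_ler_powR; rewrite ?nnegrE ?(ltW gam0) ?mulr_ge0 ?exprn_ge0 ?(ltW r0)//.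
rewrite mulrC -ler_pdivrMr ?exprn_gt0// mul1r; apply/ltW/(le_lt_trans _ n1).
by rewrite lef_pV2 ?posrE ?exprn_gt0// ler_weXn2l ?ler1n.
Qed.
End kolmogorov.

Section regularity.
Context d {T : measurableType d} {R : realType} (P : probability T R).
Variable theta : nat -> {RV P >-> R}.
Hypothesis theta_indep : mutually_independent theta.
Hypothesis theta_unif : forall n, uniform01 (theta n).
Variables (a : nat -> R[i]) (phi : nat -> R -> R[i]) (lam : nat -> R) (q M L delta : R).
Hypothesis phiM : forall n x, modulus (phi n x) <= M.
Hypothesis L1 : 1 <= L.
Hypothesis delta0 : 0 < delta.
Hypothesis phiL : forall n x y, `|x - y| <= delta ->
  L^-1 * `|x - y| <= modulus (phi n x - phi n y) <= L * `|x - y|.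
Hypothesis asum : (\sum_(0 <= n <oo) (modulus (a n))%:E < +oo)%E.
Hypothesis q1 : 1 < q.
Hypothesis lam1 : forall n, 1 <= lam n.
Local Notation Sr := (Sr theta a phi lam).
Local Notation Si := (Si theta a phi lam).

Lemma continuous_uniform_limit (F : R -> R) (G : nat -> R -> R) (e : nat -> R) :
  (forall N, continuous (G N)) -> (forall x N, `|F x - G N x| <= e N) ->
  (forall v, 0 < v -> exists N, e N < v) -> continuous F.
Proof.
move=> cG FG e0 x; apply/cvgrPdist_lt => v v0.
have [N hN] := e0 _ (divr_gt0 v0 (ltr0Sn R 2)).
have v3 : 0 < v / 3 by rewrite divr_gt0.
have /cvgrPdist_lt/(_ _ v3) := cG N x; apply: filterS => y h.
have := FG x N; have := FG y N; move: hN h; rewrite !ltr_norml !ler_norml.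
by move=> ? /andP[? ?] /andP[? ?] /andP[? ?]; apply/andP; split; lra.
Qed.

Lemma continuous_Sr w : continuous (Sr w).
Proof.
apply: (@continuous_uniform_limit _ (fun N x => \sum_(n < N) re_term a phi lam (theta n w) x n) (rtail a M)).
- elim=> [|N IH] x; first by under eq_fun do rewrite big_ord0; exact: cvg_cst.
  have [c1 c2] := coef_continuous a L1 delta0 phiL lam1 N.
  under eq_fun do rewrite big_ord_recr.
  by apply: cvgD; [exact: IH|apply: cvgB; apply: cvgMl; [exact: c1|exact: c2]].
- by move=> x N; exact: (rseries_approx lam phiM asum (fun n => theta n w) x N).1.
- by move=> v v0; have [N hN] := rtail_small phiM asum v0; exists N; exact: hN.
Qed.

Lemma continuous_Si w : continuous (Si w).
Proof.
apply: (@continuous_uniform_limit _ (fun N x => \sum_(n < N) im_term a phi lam (theta n w) x n) (rtail a M)).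
- elim=> [|N IH] x; first by under eq_fun do rewrite big_ord0; exact: cvg_cst.
  have [c1 c2] := coef_continuous a L1 delta0 phiL lam1 N.
  under eq_fun do rewrite big_ord_recr.
  by apply: cvgD; [exact: IH|apply: cvgD; apply: cvgMl; [exact: c2|exact: c1]].
- by move=> x N; exact: (rseries_approx lam phiM asum (fun n => theta n w) x N).2.
- by move=> v v0; have [N hN] := rtail_small phiM asum v0; exists N; exact: hN.
Qed.

Lemma holder_ae (gam : R) : 0 < gam < 1 -> (gam%:E < sigma_exp a lam q)%E ->
  {ae P, forall w, forall B : nat, exists2 C, 0 <= C &
    holder_on [set x | `|x| <= B%:R] gam C (Sr w) /\ holder_on [set x | `|x| <= B%:R] gam C (Si w)}.
Proof.
move=> /andP[g0 g1] gs.
(* The tail estimate is used at an exponent strictly above gam, since chaining loses a little; it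
   stays below 1 even if sigma does not. *)
have [g [gg g01 gs']] : exists g, [/\ gam < g, 0 <= g <= 1 & (g%:E < sigma_exp a lam q)%E].
  case: (sigma_exp a lam q) gs => [r| |] //.
    rewrite lte_fin => gr; pose g := (gam + Num.min r 1) / 2; exists g.
    have : gam < Num.min r 1 by rewrite lt_min gr.
    have : Num.min r 1 <= 1 by rewrite ge_min lexx orbT.
    have : Num.min r 1 <= r by rewrite ge_min lexx.
    by rewrite /g lte_fin => *; split; [|apply/andP; split|]; lra.
  by move=> _; exists ((gam + 1) / 2); rewrite ltry; split=> //; [|apply/andP; split]; lra.
have [W W0 hW] := increment_tail theta_indep theta_unif phiM L1 delta0 phiL asum q1 lam1 g01 gs'.
have mr x : measurable_fun [set: T] (Sr ^~ x).
  exact: (@measurable_Sr_at _ _ _ _ theta a phi lam M L delta).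
have mi x : measurable_fun [set: T] (Si ^~ x).
  exact: (@measurable_Si_at _ _ _ _ theta a phi lam M L delta).
apply/ae_foralln => B.
have := kolmogorov_holder mr (fun w x => (rseries_bounded lam phiM asum (fun n => theta n w) x).1)
  continuous_Sr W0 (fun x y v xy v0 => (hW x y v xy v0).1) B g0 gg.
have := kolmogorov_holder mi (fun w x => (rseries_bounded lam phiM asum (fun n => theta n w) x).2)
  continuous_Si W0 (fun x y v xy v0 => (hW x y v xy v0).2) B g0 gg.
apply: filterS2 => w [C1 C10 h1] [C2 C20 h2].
exists (C1 + C2); first exact: addr_ge0.
have mono (f : R -> R) C C' : 0 <= C -> 0 <= C' -> holder_on [set x | `|x| <= B%:R] gam C f ->
    holder_on [set x | `|x| <= B%:R] gam (C + C') f.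
  move=> c c' h x y r xB yB r01 xy; apply: le_trans (h x y r xB yB r01 xy) _.
  by rewrite ler_wpM2r ?powR_ge0// lerDl.
by split; [rewrite addrC; exact: mono|exact: mono].
Qed.
End regularity.

(** * Energies and mass distribution *)

Section energy.
Context d {T : measurableType d} {R : realType} (P : probability T R).
Local Notation V := (measurableTypeR R).
Variable mu : probability V R.
Variables X1 X2 : T * V -> R.
Hypothesis mX1 : measurable_fun [set: T * V] X1.
Hypothesis mX2 : measurable_fun [set: T * V] X2.

Definition close (r : R) (w : T) (x y : V) : Prop :=
  [/\ `|x - y| <= r, `|X1 (w, x) - X1 (w, y)| <= r & `|X2 (w, x) - X2 (w, y)| <= r].

Let E (r : R) : set ((T * V) * V) := [set z | close r z.1.1 z.1.2 z.2].

Let mE r : measurable (E r).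
Proof.
have m1 : measurable_fun [set: (T * V) * V] (fun z : (T * V) * V => (z.1.1, z.2)).
  apply: measurable_fun_pair; last exact: measurable_snd.
  exact: (measurableT_comp measurable_fst measurable_fst).
have m2 : measurable_fun [set: (T * V) * V] (fun z : (T * V) * V => (z.1.2 : R) - z.2).
  apply: measurable_funB; last exact: measurable_snd.
  exact: (measurableT_comp measurable_snd measurable_fst).
have gen (X : T * V -> R) : measurable_fun setT X ->
    measurable_fun [set: (T * V) * V] (fun z : (T * V) * V => X z.1 - X (z.1.1, z.2)).
  move=> mX; apply: measurable_funB.
    exact: (measurableT_comp mX measurable_fst).
  exact: (measurableT_comp mX m1).
rewrite (_ : E r = [set z : (T * V) * V | `|(z.1.2 : R) - z.2| <= r] `&`
  [set z : (T * V) * V | `|X1 z.1 - X1 (z.1.1, z.2)| <= r] `&`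
  [set z : (T * V) * V | `|X2 z.1 - X2 (z.1.1, z.2)| <= r]); last first.
  apply/seteqP; split=> -[[w x] y] /=; first by case.
  by move=> [[? ?] ?]; split.
apply: measurableI; first apply: measurableI; apply: measurable_norm_le => //; exact: gen.
Qed.

Lemma measurable_close r w x : measurable [set y | close r w x y].
Proof.
have -> : [set y | close r w x y] = (fun y => ((w, x), y)) @^-1` E r by [].
by rewrite -[X in measurable X]setTI; apply: measurable_pair1.
Qed.

Lemma measurable_close_w r x y : measurable [set w | close r w x y].
Proof.
have -> : [set w | close r w x y] = (fun w => ((w, x), y)) @^-1` E r by [].
rewrite -[X in measurable X]setTI.
have mp : measurable_fun [set: T] (fun w => ((w, x), y) : (T * V) * V).
  apply: measurable_fun_pair; last exact: measurable_cst.
  by apply: measurable_fun_pair; [exact: measurable_id|exact: measurable_cst].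
exact: mp.
Qed.

Let e (r : R) (z : (T * V) * V) : \bar R := (\1_(E r) z)%:E.

Let me r : measurable_fun setT (e r).
Proof. by apply/measurable_EFinP; exact: measurable_indic. Qed.

Let e_ge0 r z : (0 <= e r z)%E. Proof. by rewrite lee_fin. Qed.

Let F (r : R) (z : T * V) : \bar R := (\int[mu]_y e r (z, y))%E.

Let mF r : measurable_fun setT (F r).
Proof. exact: (@measurable_fun_fubini_tonelli_F _ _ _ _ R mu _ (me r) (e_ge0 r)). Qed.

Let F_ge0 r z : (0 <= F r z)%E. Proof. by apply: integral_ge0. Qed.

Let FE r w x : F r (w, x) = mu [set y | close r w x y].
Proof.
by rewrite -[X in _ = mu X]setIT -integral_indic//; exact: measurable_close.
Qed.

Lemma energy_swap (r c : R) : 0 <= c -> (forall x, \int[mu]_y P [set w | close r w x y] <= c%:E)%E ->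
  (\int[P]_w \int[mu]_x F r (w, x) <= c%:E)%E.
Proof.
move=> c0 h; rewrite (@fubini_tonelli _ _ _ _ _ P mu (F r) (mF r) (F_ge0 r)).
apply: (@le_trans _ _ (\int[mu]_x c%:E)%E); last first.
  rewrite integral_cst// -[leRHS]mule1; apply: lee_wpmul2l; first by rewrite lee_fin.
  exact: (probability_le1 mu measurableT).
apply: ge0_le_integral => //.
- by move=> x _; apply: integral_ge0.
- exact: (@measurable_fun_fubini_tonelli_G _ _ _ _ R P _ (mF r) (F_ge0 r)).
move=> x _; apply: le_trans (h x).
have mpair : measurable_fun [set: T * V] (fun z : T * V => ((z.1, x), z.2)).
  apply: measurable_fun_pair; last exact: measurable_snd.
  by apply: measurable_fun_pair; [exact: measurable_fst|exact: measurable_cst].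
have := @fubini_tonelli _ _ _ _ _ P mu (fun z : T * V => e r ((z.1, x), z.2))
  (measurableT_comp (me r) mpair) (fun z => e_ge0 r _).
rewrite /= => ->; rewrite le_eqVlt; apply/orP; left; apply/eqP; apply: eq_integral => y _.
by rewrite -[X in _ = P X]setIT -integral_indic//; exact: measurable_close_w.
Qed.

Lemma measurable_close_prob r x : measurable_fun [set: V] (fun y => P [set w | close r w x y]).
Proof.
have mpair : measurable_fun [set: T * V] (fun z : T * V => ((z.1, x), z.2)).
  apply: measurable_fun_pair; last exact: measurable_snd.
  by apply: measurable_fun_pair; [exact: measurable_fst|exact: measurable_cst].
have mh := measurableT_comp (me r) mpair.
have := @measurable_fun_fubini_tonelli_G _ _ _ _ R P _ mh (fun z => e_ge0 r _).
rewrite (_ : fubini_G _ _ = (fun y => P [set w | close r w x y]))//.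
apply/funext => y.
by rewrite -[X in _ = P X]setIT -integral_indic//; exact: measurable_close_w.
Qed.

Variables (t t' C : R) (j0 : nat).
Hypothesis tt' : t < t'.
Hypothesis C0 : 0 <= C.
Hypothesis energyC : forall j x, (j0 <= j)%N ->
  (\int[mu]_y P [set w | close (2 ^- j) w x y] <= (C * (2 ^- j) `^ t')%:E)%E.

Let coeff i : R := (2 ^- (j0 + i)) `^ (- t).
(** A dyadic form of the potential of order t of the image of [mu] on the graph. The gap t < t'
    makes its expectation a convergent geometric series. *)
Let G (z : T * V) : \bar R := (\sum_(0 <= i <oo) (coeff i)%:E * F (2 ^- (j0 + i)) z)%E.

Let term_ge0 i z : (0 <= (coeff i)%:E * F (2 ^- (j0 + i)) z)%E.
Proof. by rewrite mule_ge0// lee_fin powR_ge0. Qed.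

Let mterm i : measurable_fun setT (fun z => (coeff i)%:E * F (2 ^- (j0 + i)) z)%E.
Proof. exact: measurable_funeM. Qed.

Let mG : measurable_fun setT G.
Proof. exact: (@ge0_emeasurable_sum _ _ _ _ _ xpredT). Qed.

Let G_ge0 z : (0 <= G z)%E. Proof. by apply: nneseries_ge0 => i _ _. Qed.

Let intG : (\int[P]_w \int[mu]_x G (w, x) < +oo)%E.
Proof.
have mp w : measurable_fun [set: V] (fun x : V => (w, x) : T * V) by exact: measurable_pair1.
have inner w : (\int[mu]_x G (w, x) =
    \sum_(0 <= i <oo) (coeff i)%:E * \int[mu]_x F (2 ^- (j0 + i)) (w, x))%E.
  rewrite /G integral_nneseries//; last by move=> i; exact: (measurableT_comp (mterm i) (mp w)).
  apply: eq_eseriesr => i _; rewrite ge0_integralZl ?lee_fin ?powR_ge0//.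
  exact: (measurableT_comp (mF _) (mp w)).
under eq_integral do rewrite inner.
have mI i : measurable_fun [set: T] (fun w => \int[mu]_x F (2 ^- (j0 + i)) (w, x))%E.
  exact: (@measurable_fun_fubini_tonelli_F _ _ _ _ R mu _ (mF _) (F_ge0 _)).
rewrite integral_nneseries//; last 2 first.
- by move=> i; exact: measurable_funeM.
- by move=> i w _; rewrite mule_ge0 ?lee_fin ?powR_ge0// integral_ge0.
pose b : R := 2 `^ (- (t' - t)).
have b0 : 0 < b by exact: powR_gt0.
have b1 : b < 1.
  by rewrite /b /powR gt_eqF// mulNr expR_lt1 oppr_lt0 mulr_gt0// ?subr_gt0// ln_gt0// ltr1n.
have term i : (\int[P]_w ((coeff i)%:E * \int[mu]_x F (2 ^- (j0 + i)) (w, x)) <= (C * b ^+ i)%:E)%E.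
  rewrite ge0_integralZl ?lee_fin ?powR_ge0//; last by move=> w _; apply: integral_ge0.
  have := energy_swap (mulr_ge0 C0 (powR_ge0 _ t')) (fun x => energyC x (leq_addr i j0)).
  move=> /(lee_wpmul2l (x := (coeff i)%:E)) h; apply: le_trans (h _) _; first by rewrite lee_fin powR_ge0.
  rewrite -EFinM lee_fin /coeff mulrCA ler_wpM2l// -powRD; last first.
    by rewrite (gt_eqF (_ : 0 < 2 ^- (j0 + i) :> R)) ?implybT// invr_gt0 exprn_gt0.
  rewrite addrC /b /powR !gt_eqF ?invr_gt0 ?exprn_gt0// lnV ?posrE ?exprn_gt0// lnXn// -expRM_natl ler_expR.
  rewrite -[_ *+ (j0 + i)]mulr_natl natrD.
  have : 0 <= j0%:R * ((t' - t) * ln 2) :> R by rewrite mulr_ge0// mulr_ge0 ?subr_ge0 ?ltW// ln_gt0// ltr1n.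
  lra.
apply: (@le_lt_trans _ _ (C * (1 - b)^-1)%:E); last exact: ltry.
apply: lime_le.
  apply: is_cvg_nneseries => i _ _; apply: integral_ge0 => w _.
  by rewrite mule_ge0 ?lee_fin ?powR_ge0// integral_ge0.
apply: nearW => n; apply: (@le_trans _ _ (\sum_(0 <= i < n) (C * b ^+ i)%:E)%E).
  by apply: lee_sum => i _; exact: term.
rewrite sumEFin lee_fin -mulr_sumr ler_wpM2l// big_mkord.
have hb : `|b| < 1 by rewrite ger0_norm// ltW.
have := @geometric_le_lim R n 1 b ler01 b0 hb.
rewrite mul1r /series /= big_mkord; apply: le_trans.
by apply: ler_sum => k _; rewrite mul1r.
Qed.

(** Almost surely the potential has a finite integral H. It cannot exceed H + 1 almost everywhere,
    so it is bounded on a set of positive measure, and each of its terms bounds the measure at one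
    scale. *)
Lemma energy_ae : {ae P, forall w, exists (B : set V) (M : R), [/\ measurable B, mu B <> 0%E, 0 <= M &
  forall x j, B x -> (j0 <= j)%N -> (mu [set y | close (2 ^- j) w x y] <= (M * (2 ^- j) `^ t)%:E)%E]}.
Proof.
have mIG : measurable_fun [set: T] (fun w => \int[mu]_x G (w, x))%E.
  exact: (@measurable_fun_fubini_tonelli_F _ _ _ _ R mu _ mG G_ge0).
have intble : P.-integrable setT (fun w => \int[mu]_x G (w, x))%E.
  apply/integrableP; split=> //; apply: le_lt_trans intG.
  apply: ge0_le_integral => //; first exact: measurableT_comp.
  by move=> w _; rewrite gee0_abs// integral_ge0.
have := integrable_ae measurableT intble; apply: filterS => w /(_ I) fin.
set H := (\int[mu]_x G (w, x))%E in fin.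
have H0 : (0 <= H)%E by exact: integral_ge0.
pose M := fine H + 1.
have fH0 : 0 <= fine H by exact: fine_ge0.
have mGw : measurable_fun [set: V] (fun x => G (w, x)).
  exact: (measurableT_comp mG (measurable_pair1 w)).
pose B := [set x : V | (G (w, x) <= M%:E)%E].
have mB : measurable B.
  have -> : B = setT `&` [set x : V | (G (w, x) <= M%:E)%E] by rewrite setTI.
  exact: emeasurable_fun_infty_c.
exists B, M; split=> //; last 1 first.
- move=> x j Bx jj; rewrite -FE.
  have -> : j = (j0 + (j - j0))%N by rewrite subnKC.
  set i := (j - j0)%N.
  have c0 : 0 < coeff i by rewrite powR_gt0// invr_gt0 exprn_gt0.
  have : ((coeff i)%:E * F (2 ^- (j0 + i)) (w, x) <= M%:E)%E.
    apply: le_trans Bx; apply: le_trans (nneseries_lim_ge i.+1 _) => //.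
    by rewrite big_nat_recr//= leeDr// sume_ge0.
  rewrite muleC -lee_pdivlMr// EFinM => h; apply: le_trans h _.
  rewrite -EFinM lee_fin ler_wpM2l ?addr_ge0// /coeff powRN invrK//.
- move=> B0; have : (M%:E <= H)%E; last first.
    by rewrite -(fineK fin) lee_fin /M gerDl ler10.
  apply: (@le_trans _ _ (\int[mu]_(x in ~` B) G (w, x))%E); last first.
    by apply: ge0_subset_integral => //; exact: measurableC.
  apply: (@le_trans _ _ (\int[mu]_(x in ~` B) M%:E)%E).
    rewrite integral_cst; last exact: measurableC.
    rewrite -[leLHS]mule1; apply: lee_wpmul2l; first by rewrite lee_fin addr_ge0.
    have := probability_setC mu mB; rewrite B0 sube0 => h.
    by rewrite le_eqVlt; apply/orP; left; apply/eqP; symmetry; exact: h.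
  apply: ge0_le_integral => //.
  + exact: measurableC.
  + by move=> x _; rewrite lee_fin addr_ge0.
  + exact: measurable_funTS.
  + by move=> x /= /negP; rewrite -ltNge => /ltW.
- by rewrite addr_ge0.
Qed.
End energy.

(** * Mass distribution principle and integrals of kernels against Frostman measures *)

Section mass_distribution.
Context {R : realType}.
Local Notation V := (measurableTypeR R).
Variable mu : probability V R.

Lemma maxr_powR (x y t : R) : 0 <= x -> 0 <= y -> (Num.max x y) `^ t <= x `^ t + y `^ t.
Proof.
by move=> x0 y0; case: (leP x y) => _; rewrite ?lerDl ?lerDr powR_ge0.
Qed.

Definition near_graph (f : R -> R[i]) (r : R) (x y : V) : Prop := [/\ `|x - y| <= r,
  `|complex.Re (f x) - complex.Re (f y)| <= r & `|complex.Im (f x) - complex.Im (f y)| <= r].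

Lemma mass_distribution (A B : set V) (f : R -> R[i]) (t M : R) (j0 : nat) :
  measurable A -> measurable B -> mu (~` A) = 0%E -> mu B <> 0%E -> 0 < t -> 0 <= M ->
  (forall r x, measurable [set y | near_graph f r x y]) ->
  (forall x j, B x -> (j0 <= j)%N -> (mu [set y | near_graph f (2 ^- j) x y] <= (M * (2 ^- j) `^ t)%:E)%E) ->
  hausdorff_measure eucl_dist t (graph f A) <> 0.
Proof.
move=> mA mB A0 B0 t0 M0 mS small /hmeas_eq0P H0.
pose D := A `&` B.
have mD : measurable D by exact: measurableI.
have D0 : mu D <> 0%E.
  move=> h; apply: B0; apply/eqP; rewrite eq_le measure_ge0 andbT.
  apply: (@le_trans _ _ (mu (D `|` ~` A))).
    apply: le_measure; rewrite ?inE//; first by apply: measurableU => //; exact: measurableC.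
    by move=> x Bx; have [Ax|Ax] := pselect (A x); [left|right].
  apply: le_trans (measureU2 _ mD (measurableC mA)) _.
  apply: (@le_trans _ _ (0 + 0)%E); last by rewrite adde0.
  by apply: leeD; rewrite le_eqVlt; apply/orP; left; apply/eqP; [exact: h|exact: A0].
have finD : mu D \is a fin_num.
  by apply: fin_num_measure.
pose m := fine (mu D).
have m0 : 0 < m.
  by rewrite /m fine_gt0// lt0e measure_ge0 ltey_eq finD !andbT; apply/eqP.
pose K := M * 2 `^ t.
have K0 : 0 <= K by rewrite mulr_ge0 ?powR_ge0.
(* Chosen so that 2 K eps = m K / (K + 1) is smaller than the mass m to be covered. *)
pose eps := m / (2 * (K + 1)).
have eps0 : 0 < eps by rewrite divr_gt0// mulr_gt0// ltr_wpDl.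
have d0 : 0 < 2 ^- j0 :> R by rewrite invr_gt0 exprn_gt0.
have [U [cov diamU sumU]] := H0 _ _ d0 eps0.
pose ee i : R := eps / (2 ^ i.+1)%:R.
have ee0 i : 0 < ee i by rewrite divr_gt0// ltr0n expn_gt0.
have /choice[N HN] : forall i, exists N : set V, [/\ measurable N,
    [set y | D y /\ U i (point3 y (f y))] `<=` N &
    (mu N <= K%:E * (diam_pow eucl_dist t (U i)) + K%:E * (ee i)%:E)%E].
  move=> i; have [|nx] := pselect (exists x, D x /\ U i (point3 x (f x))); last first.
    exists set0; split=> //; first by move=> y [? ?]; apply: nx; exists y.
    by rewrite measure0 adde_ge0// mule_ge0// ?lee_fin ?(ltW (ee0 i))// diam_pow_ge0// => *; exact: eucl_dist_ge0.
  move=> [x [[Ax Bx] Ux]].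
  have dU : (0 <= diam eucl_dist (U i))%E.
    apply: (@le_trans _ _ (eucl_dist (point3 x (f x)) (point3 x (f x)))%:E).
      by rewrite lee_fin eucl_dist_ge0.
    by apply: ereal_sup_ubound; exists (point3 x (f x)) => //; exists (point3 x (f x)).
  have dfin : diam eucl_dist (U i) \is a fin_num.
    by rewrite ge0_fin_numE//; apply: le_lt_trans (diamU i) _; exact: ltry.
  pose dd := fine (diam eucl_dist (U i)).
  have ddE : diam eucl_dist (U i) = dd%:E by rewrite fineK.
  have dd0 : 0 <= dd by exact: fine_ge0.
  have dd1 : dd <= 2 ^- j0 by rewrite -lee_fin -ddE.
  (* A piece may have diameter 0, where no dyadic scale fits; its radius is raised to at least c,
     and the extra costs c^t sum to at most eps. *)
  pose c := Num.min (2 ^- j0) (ee i `^ t^-1).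
  have c0 : 0 < c by rewrite lt_min d0 powR_gt0.
  pose r := Num.max dd c.
  have r0 : 0 < r by rewrite lt_max c0 orbT.
  have rj : r <= 2 ^- j0 by rewrite ge_max dd1 ge_min lexx.
  have r01 : 0 < r <= 1.
    by rewrite r0 (le_trans rj)// invf_le1 ?exprn_gt0// exprn_ege1// ler1n.
  have [n /andP[n1 n2]] := dyadic_scale r01.
  have jn : (j0 <= n)%N.
    have := lt_le_trans n1 rj; rewrite ltf_pV2 ?posrE ?exprn_gt0//.
    by rewrite ltr_eXn2l ?ltr1n.
  exists [set y | near_graph f (2 ^- n) x y]; split; first exact: mS.
    move=> y [Dy Uy].
    have : (eucl_dist (point3 x (f x)) (point3 y (f y)) <= 2 ^- n)%R.
      apply: le_trans n2; apply: (@le_trans _ _ dd); last by rewrite le_max lexx.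
      by rewrite -lee_fin -ddE; apply: ereal_sup_ubound; exists (point3 x (f x)) => //; exists (point3 y (f y)).
    have [h1 h2 h3] := eucl_dist_point3_ge x y (f x) (f y).
    by move=> h; split; apply: le_trans h.
  apply: le_trans (small x n Bx jn) _.
  have -> : diam_pow eucl_dist t (U i) = (dd `^ t)%:E.
    rewrite /diam_pow ifF; first by rewrite ddE poweR_EFin.
    by apply/negbTE/set0P; exists (point3 x (f x)).
  rewrite -!EFinM -EFinD lee_fin /K -mulrDr -mulrA; apply: ler_wpM2l => //.
  apply: (@le_trans _ _ ((2 * r) `^ t)).
    apply: ge0_ler_powR; rewrite ?nnegrE ?mulr_ge0 ?(ltW t0) ?(ltW r0) ?invr_ge0 ?exprn_ge0//.
    by apply/ltW; move: n1; rewrite exprS invfM mulrC ltr_pdivrMr// mulrC.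
  rewrite powRM ?(ltW r0)//; apply: ler_wpM2l; first exact: powR_ge0.
  apply: le_trans (maxr_powR _ dd0 (ltW c0)) _; rewrite lerD2l.
  apply: (@le_trans _ _ ((ee i `^ t^-1) `^ t)).
    by apply: ge0_ler_powR; rewrite ?nnegrE ?powR_ge0 ?(ltW t0) ?(ltW c0)// ge_min lexx orbT.
  by rewrite -powRrM mulVf ?gt_eqF// powRr1// ltW.
have cover : (mu D <= \sum_(0 <= i <oo) mu (N i))%E.
  apply: measure_sigma_subadditive => //; first by move=> i; have [] := HN i.
  move=> x Dx; have [i _ Ui] := cov _ (ex_intro2 _ _ x Dx.1 erefl).
  by exists i => //; have [_ s _] := HN i; apply: s.
have dp0 i : (0 <= diam_pow eucl_dist t (U i))%E.
  by apply: diam_pow_ge0 => *; exact: eucl_dist_ge0.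
have : (mu D <= K%:E * (eps%:E + eps%:E))%E.
  apply: (le_trans cover).
  apply: (@le_trans _ _ (\sum_(0 <= i <oo) (K%:E * (diam_pow eucl_dist t (U i) + (ee i)%:E)))%E).
    apply: lee_nneseries => [i _ _|i _]; first exact: measure_ge0.
    by rewrite ge0_muleDr ?lee_fin ?(ltW (ee0 i))//; have [] := HN i.
  rewrite nneseriesZl; last by move=> i _; rewrite adde_ge0// lee_fin ltW.
  apply: lee_wpmul2l; first by rewrite lee_fin.
  apply: le_trans (epsilon_trick _ _ (ltW eps0)) _; first by move=> i; exact: dp0.
  by rewrite leeD2r.
rewrite -(fineK finD) -/m -EFinD -EFinM lee_fin /eps => h.
have k1 : 0 < K + 1 by rewrite ltr_wpDl.
have : K * (m / (2 * (K + 1)) + m / (2 * (K + 1))) = m - m / (K + 1) by field; rewrite gt_eqF.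
have : 0 < m / (K + 1) by rewrite divr_gt0.
lra.
Qed.

Section kernel.
Variables (s s' Mu : R).
Hypothesis s0 : 0 < s.
Hypothesis ss' : s' < s.
Hypothesis s'0 : 0 < s'.
Hypothesis Mu0 : 0 <= Mu.
Hypothesis ballmu : forall x r, 0 < r -> (mu `[(x - r)%R, (x + r)%R]%classic <= (Mu * r `^ s)%:E)%E.

Lemma point_null (x : V) : mu [set x] = 0%E.
Proof.
apply/eqP; rewrite eq_le measure_ge0 andbT; apply/lee_addgt0Pr => e e0; rewrite add0e.
pose r := (e / (Mu + 1)) `^ s^-1.
have M1 : 0 < Mu + 1 by rewrite ltr_wpDl.
have r0 : 0 < r by rewrite powR_gt0// divr_gt0.
apply: (@le_trans _ _ (mu `[x - r, x + r]%classic)).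
  apply: le_measure; rewrite ?inE; [exact: measurable_set1|exact: measurable_itv|].
  by move=> y ->; rewrite /= in_itv /= gerBl lerDl ltW.
apply: le_trans (ballmu x r0) _; rewrite lee_fin /r -powRrM mulVf ?gt_eqF// powRr1; last first.
  by rewrite divr_ge0 ?(ltW e0)// ltW.
by rewrite mulrA ler_pdivrMr// mulrC ler_wpM2l ?(ltW e0)// lerDl.
Qed.

(** The kernel |x - y|^(-s') is bounded on each dyadic shell around x, and balls have measure
    O(radius^s); the shells sum geometrically because s' < s. At x itself only p <= 1 is known, but
    points are null. *)
Lemma shell_integral : exists2 K, 0 <= K & forall (p : V -> \bar R) (x : V) (r A : R),
  0 < r <= 1 -> 0 <= A -> measurable_fun setT p -> (forall y, 0 <= p y <= 1)%E ->
  (forall y, r < `|x - y| -> p y = 0%E) ->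
  (forall y, 0 < `|x - y| -> `|x - y| <= r -> (p y <= (A * `|x - y| `^ (- s'))%:E)%E) ->
  (\int[mu]_y p y <= (A * K)%:E)%E.
Proof.
pose b : R := 2 `^ (- (s - s')).
have b0 : 0 < b by exact: powR_gt0.
have b1 : b < 1.
  by rewrite /b /powR gt_eqF// mulNr expR_lt1 oppr_lt0 mulr_gt0// ?subr_gt0// ln_gt0// ltr1n.
exists (2 `^ s' * Mu / (1 - b)); first by rewrite divr_ge0 ?subr_ge0 ?(ltW b1)// mulr_ge0 ?powR_ge0.
move=> p x r A /andP[r0 r1] A0 mp p01 pout pin.
pose rad j : R := 2 ^- j * r.
have rad0 j : 0 < rad j by rewrite mulr_gt0// invr_gt0 exprn_gt0.
pose ball j := `[x - rad j, x + rad j]%classic : set V.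
pose c j : R := A * (rad j.+1) `^ (- s').
have c0 j : 0 <= c j by rewrite mulr_ge0 ?powR_ge0.
pose maj (y : V) : \bar R := ((\1_[set x] y)%:E + \sum_(0 <= j <oo) (c j * \1_(ball j) y)%:E)%E.
have t0 j y : (0 <= (c j * \1_(ball j) y)%:E)%E by rewrite lee_fin mulr_ge0.
have mt j : measurable_fun [set: V] (fun y => (c j * \1_(ball j) y)%:E).
  apply/measurable_EFinP; apply: measurable_funM; first exact: measurable_cst.
  by apply: measurable_indic; exact: measurable_itv.
have ms : measurable_fun [set: V] (fun y => \sum_(0 <= j <oo) (c j * \1_(ball j) y)%:E)%E.
  by apply: (@ge0_emeasurable_sum _ _ _ _ _ xpredT).
have mx : measurable_fun [set: V] (fun y => (\1_[set x] y)%:E : \bar R).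
  by apply/measurable_EFinP; apply: measurable_indic; exact: measurable_set1.
have majp y : (p y <= maj y)%E.
  have [ry|yr] := ltP r `|x - y|.
    by rewrite pout// adde_ge0 ?lee_fin// nneseries_ge0// => j _ _.
  have [->|xy] := eqVneq y x.
    apply: (@le_trans _ _ 1%E); first by have /andP[] := p01 x.
    by rewrite /maj indicE mem_set// leeDl// nneseries_ge0// => j _ _.
  have h0 : 0 < `|x - y| by rewrite normr_gt0 subr_eq0 eq_sym.
  have h01 : 0 < `|x - y| / r <= 1 by rewrite divr_gt0//= ler_pdivrMr// mul1r.
  have [j] := dyadic_scale h01; rewrite ltr_pdivlMr// ler_pdivrMr// => /andP[j1 j2].
  apply: (@le_trans _ _ (c j * \1_(ball j) y)%:E).
    rewrite indicE mem_set ?mulr1; last first.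
      by rewrite /ball /= in_itv /= -ler_distlC.
    apply: le_trans (pin y h0 yr) _; rewrite lee_fin ler_wpM2l// !powRN lef_pV2 ?posrE ?powR_gt0//.
    by apply: ge0_ler_powR; rewrite ?nnegrE ?(ltW s'0) ?(ltW h0) ?(ltW (rad0 _)) ?(ltW j1).
  apply: (@le_trans _ _ (\sum_(0 <= j <oo) (c j * \1_(ball j) y)%:E)%E); last by rewrite /maj leeDr// lee_fin.
  apply: le_trans (nneseries_lim_ge j.+1 _) => //.
  by rewrite big_nat_recr//= leeDr// sume_ge0.
apply: (@le_trans _ _ (\int[mu]_y maj y)%E).
  apply: ge0_le_integral => //; first by move=> y _; have /andP[] := p01 y.
  exact: emeasurable_funD.
rewrite ge0_integralD//; last by move=> y _; rewrite nneseries_ge0.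
rewrite integral_indic// setIT [X in (X + _)%E](_ : _ = 0%E); last exact: point_null.
rewrite add0e integral_nneseries//.
apply: (@le_trans _ _ (\sum_(0 <= j <oo) (A * (2 `^ s' * Mu) * b ^+ j)%:E)%E).
  apply: lee_nneseries => [j _ _|j _]; first by apply: integral_ge0.
  under eq_integral do rewrite EFinM.
  rewrite ge0_integralZl ?lee_fin//; last first.
    by apply/measurable_EFinP; apply: measurable_indic; exact: measurable_itv.
  rewrite integral_indic//; last exact: measurable_itv.
  rewrite setIT; apply: (@le_trans _ _ ((c j)%:E * (Mu * (rad j) `^ s)%:E)%E).
    by apply: lee_wpmul2l; rewrite ?lee_fin//; exact: ballmu.
  rewrite -EFinM lee_fin /c -!mulrA ler_wpM2l//.
  rewrite mulrCA [leRHS]mulrCA ler_wpM2l//.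
  have -> : rad j.+1 = rad j / 2 by rewrite /rad exprS invfM; ring.
  rewrite powRM ?invr_ge0 ?(ltW (rad0 j))// (_ : (2^-1 : R) `^ (- s') = 2 `^ s'); last first.
    by rewrite /powR !gt_eqF ?invr_gt0// lnV ?posrE// mulrNN.
  rewrite mulrAC mulrC ler_wpM2l ?powR_ge0// -powRD; last first.
    by rewrite (gt_eqF (rad0 j)) implybT.
  rewrite /rad powRM ?(ltW r0) ?invr_ge0 ?exprn_ge0//.
  have -> : (2 ^- j) `^ (- s' + s) = b ^+ j.
    rewrite /b /powR !gt_eqF ?invr_gt0 ?exprn_gt0// lnV ?posrE ?exprn_gt0// lnXn// -expRM_natl.
    by congr expR; rewrite -mulr_natl; ring.
  rewrite ler_piMr ?exprn_ge0 ?(ltW b0)//.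
  apply: (@le_trans _ _ (1 `^ (- s' + s))); last by rewrite powR1.
  by apply: ge0_ler_powR; rewrite ?nnegrE ?(ltW r0)// addrC subr_ge0 ltW.
apply: lime_le.
  by apply: is_cvg_nneseries => j _ _; rewrite lee_fin !mulr_ge0 ?powR_ge0// exprn_ge0// ltW.
apply: nearW => n; rewrite sumEFin lee_fin -mulr_sumr -!mulrA ler_wpM2l// !mulrA ler_wpM2l ?mulr_ge0 ?powR_ge0//.
have hb : `|b| < 1 by rewrite ger0_norm// ltW.
have := @geometric_le_lim R n 1 b ler01 b0 hb.
rewrite mul1r /series /= big_mkord; apply: le_trans; rewrite big_mkord.
by apply: ler_sum => k _; rewrite mul1r.
Qed.
End kernel.
End mass_distribution.

(** * Lower bound for the dimension of the graph *)

Section lower_bound.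
Context d {T : measurableType d} {R : realType} (P : probability T R).
Variable theta : nat -> {RV P >-> R}.
Hypothesis theta_indep : mutually_independent theta.
Hypothesis theta_unif : forall n, uniform01 (theta n).
Variables (a : nat -> R[i]) (phi : nat -> R -> R[i]) (lam : nat -> R) (q M L delta : R).
Hypothesis phiM : forall n x, modulus (phi n x) <= M.
Hypothesis L1 : 1 <= L.
Hypothesis delta0 : 0 < delta.
Hypothesis phiL : forall n x y, `|x - y| <= delta ->
  L^-1 * `|x - y| <= modulus (phi n x - phi n y) <= L * `|x - y|.
Hypothesis asum : (\sum_(0 <= n <oo) (modulus (a n))%:E < +oo)%E.
Hypothesis q1 : 1 < q.
Hypothesis lam1 : forall n, 1 <= lam n.
Local Notation V := (measurableTypeR R).
Local Notation X1 := (fun z : T * V => Sr theta a phi lam z.1 z.2).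
Local Notation X2 := (fun z : T * V => Si theta a phi lam z.1 z.2).

Let mX1 : measurable_fun [set: T * V] X1.
Proof. exact: (@measurable_Sr _ _ _ _ theta a phi lam M L delta). Qed.

Let mX2 : measurable_fun [set: T * V] X2.
Proof. exact: (@measurable_Si _ _ _ _ theta a phi lam M L delta). Qed.

(** Let Z be the small ball bound C (r / h^tt)^2. In the first case min(1, Z) <= Z^(t'/2) since t'
    <= 2, and the power of h is weakened to -s'. In the second, r^2 h^(-2 tt) is rewritten using h
    <= r, which trades a power of r for a power of h. *)
Lemma small_ball_kernel (tt s' t' : R) : 0 <= tt -> (tau_exp a lam q < tt%:E)%E -> 0 < s' ->
  (0 <= t' <= 2 /\ t' * tt <= s') \/ (t' = 2 - 2 * tt + s' /\ 2 * tt <= s') ->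
  exists A h0 : R, [/\ 0 <= A, 0 < h0 <= 1 & forall x y r : R, 0 < `|x - y| -> `|x - y| <= r -> r <= h0 ->
    (P [set w | close X1 X2 r w x y] <= (A * r `^ t' * `|x - y| `^ (- s'))%:E)%E].
Proof.
move=> tt0 taut s'0 cond.
have [C [h0 [C0 h01 hC]]] := small_ball theta_indep theta_unif phiM L1 delta0 phiL asum q1 lam1 tt0 taut.
have /andP[h00 h0le] := h01.
have bound x y r : 0 < `|x - y| -> `|x - y| <= r -> r <= h0 ->
    (P [set w | close X1 X2 r w x y] <= (C * (r / `|x - y| `^ tt) ^+ 2)%:E)%E /\
    (P [set w | close X1 X2 r w x y] <= 1)%E.
  move=> xy0 xyr rh.
  have mc : measurable [set w | close X1 X2 r w x y].
    exact: (measurable_close_w mX1 mX2).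
  split; last exact: probability_le1.
  have xyh : 0 < `|x - y| <= h0 by rewrite xy0 (le_trans xyr).
  apply: le_trans (hC x y r xyh (lt_le_trans xy0 xyr)).
  rewrite (_ : [set w | close X1 X2 r w x y] = [set w | `|Sr theta a phi lam w x - Sr theta a phi lam w y| <= r /\
    `|Si theta a phi lam w x - Si theta a phi lam w y| <= r])//.
  by apply/seteqP; split=> w /=; [case|case=> ? ?; split].
case: cond => [[/andP[t'0 t'2] ts]|[t'E ts]].
  exists (C `^ (t' / 2)), h0; split=> //; first exact: powR_ge0.
  move=> x y r xy0 xyr rh; have [b1 b2] := bound x y r xy0 xyr rh.
  set h := `|x - y| in xy0 xyr b1 *.
  have r0 : 0 < r by exact: lt_le_trans xyr.
  have ht0 : 0 < h `^ tt by exact: powR_gt0.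
  pose Z := C * (r / h `^ tt) ^+ 2.
  have Z0 : 0 < Z by rewrite mulr_gt0// exprn_gt0// divr_gt0.
  have t20 : 0 <= t' / 2 by rewrite divr_ge0.
  apply: (@le_trans _ _ (Z `^ (t' / 2))%:E).
    have [Z1|Z1] := leP Z 1.
      apply: (le_trans b1); rewrite lee_fin -/Z; apply: ger1_powR; first by rewrite Z0.
      by rewrite ler_pdivrMr// mul1r.
    apply: (le_trans b2); rewrite lee_fin; apply: (@le_trans _ _ (1 `^ (t' / 2))); first by rewrite powR1.
    by apply: ge0_ler_powR; rewrite ?nnegrE ?(ltW Z0) ?(ltW Z1).
  rewrite lee_fin /Z powRM ?(ltW C0) ?exprn_ge0 ?divr_ge0 ?(ltW r0) ?(ltW ht0)// -mulrA ler_wpM2l ?powR_ge0//.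
  have -> : ((r / h `^ tt) ^+ 2) `^ (t' / 2) = r `^ t' * h `^ (- (t' * tt)).
    rewrite -powR_mulrn; last by rewrite divr_ge0 ?(ltW r0) ?(ltW ht0).
    rewrite -powRrM (_ : 2 * (t' / 2) = t'); last by field.
    rewrite powRM ?invr_ge0 ?(ltW r0) ?(ltW ht0)//; congr (_ * _).
    by rewrite -powRN -powRrM; congr (_ `^ _); ring.
  rewrite ler_wpM2l ?powR_ge0//; apply: ger_powR; last by rewrite lerN2.
  by rewrite xy0 (le_trans xyr)// (le_trans rh).
exists C, h0; split=> //; first exact: ltW.
move=> x y r xy0 xyr rh; have [b1 _] := bound x y r xy0 xyr rh.
set h := `|x - y| in xy0 xyr b1 *.
have r0 : 0 < r by exact: lt_le_trans xyr.
apply: (le_trans b1); rewrite lee_fin -mulrA ler_wpM2l ?(ltW C0)//.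
have -> : (r / h `^ tt) ^+ 2 = r ^+ 2 * h `^ (- (2 * tt)).
  rewrite exprMn; congr (_ * _).
  by rewrite -powRN -powR_mulrn ?powR_ge0// -powRrM; congr (_ `^ _); ring.
have -> : r ^+ 2 = r `^ t' * r `^ (- (s' - 2 * tt)).
  rewrite -powRD ?(gt_eqF r0) ?implybT// t'E (_ : 2 - 2 * tt + s' + - (s' - 2 * tt) = 2%:R) ?powR_mulrn ?(ltW r0)//.
  by ring.
have -> : h `^ (- s') = h `^ (- (s' - 2 * tt)) * h `^ (- (2 * tt)).
  by rewrite -powRD ?(gt_eqF xy0) ?implybT//; congr (_ `^ _); ring.
rewrite -mulrA ler_wpM2l ?powR_ge0// ler_wpM2r ?powR_ge0//.
rewrite !powRN lef_pV2 ?posrE ?powR_gt0//.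
by apply: ge0_ler_powR; rewrite ?nnegrE ?(ltW xy0) ?(ltW r0)// subr_ge0.
Qed.

(** Here s is the Frostman exponent, s' the order of the kernel, t' the decay rate of the energies
    and t the dimension reached. The gaps s' < s and t < t' pay for the two geometric series, over
    shells and over scales. *)
Lemma dim_graph_ge_param (A : set R) (tt s s' t t' : R) : measurable A ->
  0 <= tt -> (tau_exp a lam q < tt%:E)%E -> 0 < s' -> s' < s -> (s%:E < hausdorff_dim rdist A)%E ->
  0 < t -> t < t' ->
  (0 <= t' <= 2 /\ t' * tt <= s') \/ (t' = 2 - 2 * tt + s' /\ 2 * tt <= s') ->
  {ae P, forall w, (t%:E <= hausdorff_dim eucl_dist (graph (rseries a phi lam (fun n => theta n w)) A))%E}.
Proof.
move=> mA tt0 taut s'0 ss' sA t0 tt' cond.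
have s0 : 0 < s by apply: lt_trans ss'.
have Hs : hausdorff_measure rdist s A <> 0.
  by apply: hdim_gt => //; rewrite (ltW s0).
have [mu [Mu [Mu0 muA ballmu]]] := frostman s0 mA Hs.
have [K K0 hK] := shell_integral s0 ss' s'0 Mu0 ballmu.
have [B [h0 [B0 /andP[h00 h01] hB]]] := small_ball_kernel tt0 taut s'0 cond.
have [j0 _ hj0] : \forall j \near \oo, `|(0 : R) - (2^-1) ^+ j| < h0.
  have : (fun m => (2^-1 : R) ^+ m) @ \oo --> (0 : R).
    by apply: cvg_expr; rewrite ger0_norm// invf_lt1// ltr1n.
  by move/cvgrPdist_lt => /(_ _ h00).
have energyC j x : (j0 <= j)%N ->
    (\int[mu]_y P [set w | close X1 X2 (2 ^- j) w x y] <= (B * K * (2 ^- j) `^ t')%:E)%E.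
  move=> jj; have r0 : 0 < 2 ^- j :> R by rewrite invr_gt0 exprn_gt0.
  have rh : 2 ^- j <= h0.
    have := hj0 j jj; rewrite sub0r normrN ger0_norm ?exprn_ge0// exprVn; exact: ltW.
  rewrite (_ : B * K * _ = B * (2 ^- j) `^ t' * K); last by ring.
  apply: (hK _ x (2 ^- j)).
  - by rewrite r0 (le_trans rh).
  - by rewrite mulr_ge0 ?powR_ge0.
  - exact: (@measurable_close_prob _ _ _ P _ _ mX1 mX2 (2 ^- j) x).
  - move=> y; rewrite measure_ge0 probability_le1//.
    exact: (measurable_close_w mX1 mX2).
  - move=> y ry; rewrite (_ : [set w | _] = set0) ?measure0// -subset0 => w /= [+ _ _].
    by rewrite leNgt ry.
  - by move=> y xy0 xyr; exact: hB.
have := energy_ae mX1 mX2 tt' (mulr_ge0 B0 K0) energyC.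
apply: filterS => w [E [N [mE E0 N0 hE]]].
apply: hdim_ge => //; first exact: eucl_dist_ge0.
apply: (mass_distribution mA mE muA E0 t0 N0 _ hE).
by move=> r x; exact: (measurable_close mX1 mX2).
Qed.

Lemma ereal_between (x : R) (y : \bar R) : (x%:E < y)%E -> exists2 s, x < s & (s%:E < y)%E.
Proof.
case: y => [r| |] //.
  by rewrite lte_fin => xr; exists ((x + r) / 2); rewrite ?lte_fin; lra.
by move=> _; exists (x + 1); rewrite ?ltry//; lra.
Qed.

Lemma dim_graph_ge (A : set R) (tr v : R) : measurable A -> 0 <= tr -> tau_exp a lam q = tr%:E -> 0 < v ->
  (v < 2 /\ ((v * tr)%:E < hausdorff_dim rdist A)%E) \/
  (2 <= v /\ ((v - 2 + 2 * tr)%:E < hausdorff_dim rdist A)%E) ->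
  {ae P, forall w, (v%:E <= hausdorff_dim eucl_dist (graph (rseries a phi lam (fun n => theta n w)) A))%E}.
Proof.
move=> mA tr0 tauE v0 [[v2 /ereal_between[s vs sA]]|[v2 /ereal_between[s vs sA]]].
  have vt0 : 0 <= v * tr by rewrite mulr_ge0// ltW.
  pose s' := (v * tr + s) / 2.
  (* The three terms ensure e^2 <= e, then v + e <= 2, then (v + e) (tr + e) <= v tr + e (v + tr +
     1) <= s'. *)
  pose e := Num.min 1 (Num.min (2 - v) ((s' - v * tr) / (v + tr + 1))).
  have e0 : 0 < e by rewrite !lt_min ltr01 subr_gt0 v2 divr_gt0 /s'//=; lra.
  have e1 : e <= 1 by rewrite ge_min lexx.
  have e2 : e <= 2 - v by rewrite /e minCA ge_min lexx.
  have e3 : e * (v + tr + 1) <= s' - v * tr.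
    by rewrite -ler_pdivlMr; [rewrite /e minA ge_min lexx orbT|lra].
  apply: (@dim_graph_ge_param A (tr + e) s s' v (v + e)) => //.
  - lra.
  - by rewrite tauE lte_fin ltrDl.
  - rewrite /s'; lra.
  - rewrite /s'; lra.
  - by rewrite ltrDl.
  - left; split; first by apply/andP; split; lra.
    have : e * e <= e by rewrite ler_piMr// ltW.
    by move: e3; nra.
(* With tt = tr + eta / 2 and s' = v - 2 + 2 tr + 2 eta, the identity t' = 2 - 2 tt + s' gives t' =
   v + eta, and s - s' = 2 eta is positive. *)
pose eta := (s - (v - 2 + 2 * tr)) / 4.
have eta0 : 0 < eta by rewrite divr_gt0// subr_gt0.
apply: (@dim_graph_ge_param A (tr + eta / 2) s (v - 2 + 2 * tr + 2 * eta) v (v + eta)) => //.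
- lra.
- by rewrite tauE lte_fin; lra.
- lra.
- rewrite /eta; lra.
- lra.
- by right; split; lra.
Qed.
End lower_bound.

(** * Dimension of the graph *)

Section upper_bound.
Context {R : realType}.
Variables (f : R -> R[i]) (A : set R) (g : R).
Hypothesis f_holder : forall B : nat, exists2 C, 0 <= C &
  holder_on [set x | `|x| <= B%:R] g C (fun x => complex.Re (f x)) /\
  holder_on [set x | `|x| <= B%:R] g C (fun x => complex.Im (f x)).

Let AB (B : nat) := A `&` [set x | `|x| <= B%:R].

Let graphE : graph f A = \bigcup_B graph f (AB B).
Proof.
apply/seteqP; split=> [_ [x Ax <-]|_ [B _ [x [Ax _] <-]]]; last by exists x.
exists (Num.truncn `|x|).+1 => //; exists x => //; split=> //=.
by apply/ltW; exact: truncnS_gt.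
Qed.

Let holder_AB B : exists2 C, 0 <= C & holder_on (AB B) g C (fun x => complex.Re (f x)) /\
  holder_on (AB B) g C (fun x => complex.Im (f x)).
Proof.
have [C C0 [h1 h2]] := f_holder B; exists C => //.
by split=> x y r [_ Bx] [_ By]; [exact: h1|exact: h2].
Qed.

Let nullAB s B : hausdorff_measure rdist s A = 0 -> hausdorff_measure rdist s (AB B) = 0.
Proof. by apply: hmeas_eq0_sub => x []. Qed.

Lemma dim_graph_le_div s : 0 < g <= 1 -> 0 < s -> hausdorff_measure rdist s A = 0 ->
  (hausdorff_dim eucl_dist (graph f A) <= (s / g)%:E)%E.
Proof.
move=> /andP[g0 g1] s0 HA; have sg : 0 < s / g by rewrite divr_gt0.
apply: hdim_le => //; first exact: ltW.
rewrite graphE; apply: hmeas_eq0_bigcup => // [x y|B]; first exact: eucl_dist_ge0.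
have [C C0 [h1 h2]] := holder_AB B.
by apply: (hmeas_graph_div _ C0 s0 h1 h2 (nullAB B HA)); rewrite g0.
Qed.

Lemma dim_graph_le_add s : 0 <= g <= 1 -> 0 < s -> hausdorff_measure rdist s A = 0 ->
  (hausdorff_dim eucl_dist (graph f A) <= (s + 2 - 2 * g)%:E)%E.
Proof.
move=> /andP[g0 g1] s0 HA; have sg : 0 < s + 2 - 2 * g by lra.
apply: hdim_le => //; first exact: ltW.
rewrite graphE; apply: hmeas_eq0_bigcup => // [x y|B]; first exact: eucl_dist_ge0.
have [C C0 [h1 h2]] := holder_AB B.
by apply: (hmeas_graph_add _ C0 s0 h1 h2 (nullAB B HA)); rewrite g0.
Qed.
End upper_bound.

Section approximation.
Context {R : realType}.

(** A sequence in (0, 1) that tends to 1. The exponent sigma is approached through countably many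
    multiples of it, so that a single null event suffices. *)
Definition ratio (n : nat) : R := n.+1%:R / n.+2%:R.

Lemma ratio_itv n : 0 < ratio n < 1.
Proof. by rewrite /ratio divr_gt0//= ltr_pdivrMr// mul1r ltr_nat. Qed.

Lemma ratio_near (e : R) : 0 < e -> exists n, 1 - e < ratio n.
Proof.
move=> e0; exists (Num.truncn e^-1); set n := Num.truncn _.
have h : e^-1 < n.+1%:R by exact: truncnS_gt.
have n2 : 0 < n.+2%:R :> R by [].
rewrite /ratio -ltr_pdivrMr ?invr_gt0// invrK.
have : 1 < e * n.+1%:R by rewrite -ltr_pdivrMl// mulr1.
by rewrite -[n.+2%:R]natr1; move=> h1; nra.
Qed.

(** The countable family of targets used for the lower bound, valid for an infinite value as
    well. *)
Lemma ereal_approx (m : \bar R) : (0 < m)%E -> exists v : nat -> R,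
  (forall n, 0 < v n /\ ((v n)%:E < m)%E) /\ (forall y, (forall n, ((v n)%:E <= y)%E) -> (m <= y)%E).
Proof.
case: m => [r| |] //.
  rewrite lte_fin => r0; exists (fun n => r * ratio n); split=> [n|y hy].
    by have /andP[h0 h1] := ratio_itv n; rewrite mulr_gt0// lte_fin gtr_pMr.
  case: y hy => [y| |] hy; rewrite ?leey//; last by have := hy 0%N.
  rewrite lee_fin leNgt; apply/negP => yr.
  have e0 : 0 < (r - y) / r by rewrite divr_gt0// subr_gt0.
  have [n hn] := ratio_near e0; have := hy n; rewrite lee_fin leNgt => /negP; apply.
  have : r * (1 - (r - y) / r) < r * ratio n by rewrite ltr_pM2l.
  by rewrite (_ : r * (1 - (r - y) / r) = y)//; field; rewrite gt_eqF.
move=> _; exists (fun n => n.+1%:R); split=> [n|y hy]; first by rewrite ltry.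
case: y hy => [y| |] hy //; last by have := hy 0%N.
by have := hy (Num.truncn y); rewrite lee_fin leNgt truncnS_gt.
Qed.

Lemma dim_graph_upper (f : R -> R[i]) (A : set R) (sg : R) : 0 < sg <= 1 ->
  (forall n (B : nat), exists2 C, 0 <= C &
    holder_on [set x | `|x| <= B%:R] (sg * ratio n) C (fun x => complex.Re (f x)) /\
    holder_on [set x | `|x| <= B%:R] (sg * ratio n) C (fun x => complex.Im (f x))) ->
  (hausdorff_dim eucl_dist (graph f A) <= Order.min (hausdorff_dim rdist A / sg%:E)
     (hausdorff_dim rdist A + 2%:E - 2%:E * sg%:E))%E.
Proof.
move=> /andP[sg0 sg1] hf; have := hdim_ge0 rdist A.
have gn n : 0 < sg * ratio n <= 1.
  have /andP[r0 /ltW r1] := ratio_itv n; rewrite mulr_gt0//=.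
  by apply: le_trans sg1; rewrite ler_piMr// ltW.
case E : (hausdorff_dim rdist A) => [D| |] // D0; last first.
  by rewrite inver gt_eqF// mulyr gtr0_sg ?invr_gt0// mul1e minxx leey.
rewrite lee_fin in D0.
have null s : D < s -> hausdorff_measure rdist s A = 0.
  by move=> Ds; apply: hdim_lt => //; [exact: rdist_ge0|rewrite E lte_fin].
rewrite le_min; apply/andP; split.
  rewrite inver gt_eqF// -EFinM; apply/lee_addgt0Pr => e e0; rewrite -EFinD.
  pose y := D / sg + e.
  have y0 : 0 < y by rewrite ltr_wpDl// divr_ge0// ltW.
  have ysg : y * sg = D + e * sg by rewrite /y mulrDl divfK// gt_eqF.
  have esg : 0 < e * sg by rewrite mulr_gt0.
  have e20 : 0 < e * sg / (y * sg) by rewrite divr_gt0// mulr_gt0.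
  have [n hn] := ratio_near e20; have /andP[g0 g1] := gn n.
  have Dy : D < y * (sg * ratio n).
    have : y * sg * (1 - e * sg / (y * sg)) < y * sg * ratio n by rewrite ltr_pM2l// mulr_gt0.
    have -> : y * sg * (1 - e * sg / (y * sg)) = D.
      by rewrite -[RHS](addrK (e * sg)) -ysg; field; rewrite !gt_eqF.
    by rewrite mulrA.
  have s0 : 0 < y * (sg * ratio n) by apply: le_lt_trans Dy.
  have := dim_graph_le_div (hf n) (gn n) s0 (null _ Dy).
  by rewrite mulfK// gt_eqF.
rewrite (_ : (D%:E + 2%:E - 2%:E * sg%:E)%E = (D + 2 - 2 * sg)%:E)//; apply/lee_addgt0Pr => e e0; rewrite -EFinD.
have e20 : 0 < e / (4 * sg) by rewrite divr_gt0// mulr_gt0.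
have [n hn] := ratio_near e20; have /andP[g0 g1] := gn n.
have Ds : D < D + e / 2 by rewrite ltrDl divr_gt0.
have s0 : 0 < D + e / 2 by apply: le_lt_trans Ds.
have g01 : 0 <= sg * ratio n <= 1 by rewrite (ltW g0).
apply: le_trans (dim_graph_le_add (hf n) g01 s0 (null _ Ds)) _; rewrite lee_fin.
have : sg * (1 - e / (4 * sg)) < sg * ratio n by rewrite ltr_pM2l.
have -> : sg * (1 - e / (4 * sg)) = sg - e / 4 by field; rewrite gt_eqF.
lra.
Qed.
End approximation.

Theorem theorem1p2 (R : realType) (d : measure_display) (T : measurableType d)
    (P : probability T R) (theta : nat -> {RV P >-> R})
    (a : nat -> R[i]) (phi : nat -> R -> R[i]) (lam : nat -> R) (q : R)
    (phi_bounded : uniformly_bounded phi)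
    (phi_bilipschitz : locally_uniformly_bilipschitz phi)
    (a_neq0 : forall n, a n != 0)
    (a_summable : (\sum_(0 <= n <oo) (modulus (a n))%:E < +oo)%E)
    (lam_increasing : {homo lam : m n / (m <= n)%N >-> m <= n})
    (lam0 : lam 0%N = 1)
    (q_sup : q%:E = ereal_sup (range (fun n => (lam n.+1 / lam n)%:E)))
    (q_gt1 : 1 < q)
    (theta_indep : mutually_independent theta)
    (theta_uniform : forall n, uniform01 (theta n)) :
  let S := fun w : T => rseries a phi lam (fun n => theta n w) in
  let sigma := sigma_exp a lam q in
  let tau := tau_exp a lam q in
  ((0 < sigma)%E -> (sigma <= tau)%E -> (tau <= 1)%E ->
   forall A : set R, measurable A ->
   {ae P, forall w : T,
     let dA := hausdorff_dim rdist A in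
     let dG := hausdorff_dim eucl_dist (graph (S w) A) in
     (Order.min (dA / tau) (dA + 2%:E - 2%:E * tau) <= dG)%E /\
     (dG <= Order.min (dA / sigma) (dA + 2%:E - 2%:E * sigma))%E}) /\
  (tau = 0%E ->
   forall A : set R, measurable A -> (0 < hausdorff_dim rdist A)%E ->
   {ae P, forall w : T,
     hausdorff_dim eucl_dist (graph (S w) A) =
     (2%:E + hausdorff_dim rdist A)%E}).
Proof.
move=> S sigma tau.
have [M phiM] := phi_bounded; have [L [delta [L1 delta0 phiL]]] := phi_bilipschitz.
have lam1 n : 1 <= lam n by rewrite -lam0 lam_increasing.
have lower (A : set R) (tr : R) (m : \bar R) : measurable A -> 0 <= tr -> tau = tr%:E ->
    (forall v : R, 0 < v -> (v%:E < m)%E ->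
      ((v * tr)%:E < hausdorff_dim rdist A)%E /\ ((v - 2 + 2 * tr)%:E < hausdorff_dim rdist A)%E) ->
    {ae P, forall w, (m <= hausdorff_dim eucl_dist (graph (S w) A))%E}.
  move=> mA tr0 tauE hm; have [m0|/ereal_approx[v [v0m vm]]] := leP m 0%E.
    by apply: nearW => w; apply: le_trans m0 _; exact: hdim_ge0.
  have : {ae P, forall w n, ((v n)%:E <= hausdorff_dim eucl_dist (graph (S w) A))%E}.
    apply/ae_foralln => n; have [v0 vnm] := v0m n; have [h1 h2] := hm _ v0 vnm.
    apply: (dim_graph_ge theta_indep theta_uniform phiM L1 delta0 phiL a_summable q_gt1 lam1 mA tr0 tauE v0).
    by have [v2|v2] := ltP (v n) 2; [left|right].
  by apply: filterS => w; exact: vm.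
split.
  move=> sigma0 st tau1 A mA.
  have [sr sE] : exists sr, sigma = sr%:E.
    exists (fine sigma); rewrite fineK// ge0_fin_numE ?(ltW sigma0)//.
    by apply: le_lt_trans st _; apply: le_lt_trans tau1 _; exact: ltry.
  have [tr tE] : exists tr, tau = tr%:E.
    exists (fine tau); rewrite fineK// ge0_fin_numE ?(le_trans (ltW sigma0) st)//.
    by apply: le_lt_trans tau1 _; exact: ltry.
  move: sigma0 st tau1; rewrite sE tE lte_fin !lee_fin => sr0 st tr1.
  have tr0 : 0 < tr by apply: lt_le_trans st.
  have sr1 : 0 < sr <= 1 by rewrite sr0 (le_trans st).
  have low : {ae P, forall w, (Order.min (hausdorff_dim rdist A / tr%:E) (hausdorff_dim rdist A + 2%:E - 2%:E * tr%:E)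
      <= hausdorff_dim eucl_dist (graph (S w) A))%E}.
    apply: (lower A tr) => //; first exact: ltW.
    move=> v v0; rewrite lt_min => /andP[]; rewrite inver gt_eqF//.
    case: (hausdorff_dim rdist A) => [D| |]; last 2 first.
    - by rewrite !ltry.
    - by rewrite mulNyr gtr0_sg ?invr_gt0// mul1e.
    rewrite lte_fin ltr_pdivlMr// => h1.
    have -> : (D%:E + 2%:E - 2%:E * tr%:E)%E = (D + 2 - 2 * tr)%:E by [].
    by rewrite !lte_fin => h2; split=> //; lra.
  have up : {ae P, forall w, forall n (B : nat), exists2 C, 0 <= C &
      holder_on [set x | `|x| <= B%:R] (sr * ratio n) C (Sr theta a phi lam w) /\
      holder_on [set x | `|x| <= B%:R] (sr * ratio n) C (Si theta a phi lam w)}.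
    apply/ae_foralln => n; have /andP[r0 r1] := ratio_itv (R := R) n; have /andP[_ srle] := sr1.
    apply: (holder_ae theta_indep theta_uniform phiM L1 delta0 phiL a_summable q_gt1 lam1).
      by rewrite mulr_gt0//= (lt_le_trans _ srle)// gtr_pMr.
    by rewrite -/sigma sE lte_fin gtr_pMr.
  move: low up; apply: filterS2 => w low up; split; first exact: low.
  exact: (dim_graph_upper A sr1 up).
move=> tau0 A mA dA0.
have low : {ae P, forall w, (2%:E + hausdorff_dim rdist A <= hausdorff_dim eucl_dist (graph (S w) A))%E}.
  apply: (lower A 0) => // v v0.
  case: (hausdorff_dim rdist A) dA0 => [D| |] //.
    by rewrite -EFinD !lte_fin => D0 h; split; lra.
  by move=> _ _; rewrite !ltry.
apply: filterS low => w low; apply/eqP; rewrite eq_le low andbT.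
(* For tau = 0 the upper bound is deterministic: a bounded function is Holder of exponent 0, for
   which cutting into cubes gives dim A + 2. *)
have hold (B : nat) : exists2 C, 0 <= C &
    holder_on [set x | `|x| <= B%:R] 0 C (fun x => complex.Re (S w x)) /\
    holder_on [set x | `|x| <= B%:R] 0 C (fun x => complex.Im (S w x)).
  have h0 := rtail_ge0 phiM a_summable 0.
  exists (2 * rtail a M 0); first by rewrite mulr_ge0.
  split=> x y r _ _ _ _; rewrite powRr0 mulr1.
    have [h1 _] := rseries_bounded lam phiM a_summable (fun n => theta n w) x.
    have [h2 _] := rseries_bounded lam phiM a_summable (fun n => theta n w) y.
    by apply: le_trans (ler_normB _ _) _; rewrite mulr_natl mulr2n lerD.
  have [_ h1] := rseries_bounded lam phiM a_summable (fun n => theta n w) x.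
  have [_ h2] := rseries_bounded lam phiM a_summable (fun n => theta n w) y.
  by apply: le_trans (ler_normB _ _) _; rewrite mulr_natl mulr2n lerD.
case E : (hausdorff_dim rdist A) dA0 => [D| |] //; last by rewrite addey// leey.
rewrite lte_fin => D0; rewrite -EFinD; apply/lee_addgt0Pr => e e0; rewrite -EFinD.
have De : D < D + e by rewrite ltrDl.
have HA : hausdorff_measure rdist (D + e) A = 0.
  by apply: hdim_lt => //; [exact: rdist_ge0|rewrite E lte_fin].
have g01 : (0 : R) <= (0 : R) <= (1 : R) by rewrite lexx ler01.
apply: le_trans (dim_graph_le_add hold g01 (lt_trans D0 De) HA) _.
rewrite lee_fin; lra.
Qed.
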